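(* Let $\{S_i\}_{i\in\mathcal I}$ be either a conformal system on $\overline U$ or a system of similarities in the plane ($d=2$). Then for any transitive subshift of finite type $\Sigma_A$ such that $\dim_{\mathrm H}F_A>1$, we have \[ \dim_{\mathrm H}D(F_A)=1 . \] If, in addition, $F_A$ satisfies the strong separation property, then the assumption $\dim_{\mathrm H}F_A>1$ can be relaxed to $\dim_{\mathrm H}F_A\ge 1$, i.e. $\dim_{\mathrm H} F_A\geq 1$ then suffices for $\dim_{\mathrm H}D(F_A)=1$.
   Context: $\dim_{\mathrm H}$ is Hausdorff dimension. The distance set of $K\subseteq\mathbb R^2=\mathbb C$ is $D(K)=\{|x-y|:x,y\in K\}$. **Symbolic notation.** $\mathcal I=\{0,\dots,M-1\}$ is a finite alphabet, $\Sigma=\mathcal I^{\mathbb N}$; for $\alpha=(\alpha_0,\alpha_1,\dots)\in\Sigma$ write $\alpha|_k=(\alpha_0,\dots,\alpha_{k-1})$. For an $M\times M$ matrix $A$ with entries in $\{0,1\}$, $\Sigma_A=\{\alpha\in\Sigma: A_{\alpha_l,\alpha_{l+1}}=1\ \forall l\ge 0\}$ is the subshift of finite type. It is transitive if $A$ is irreducible: for all $i,j\in\mathcal I$ there is $n\in\mathbb N$ with $(A^n)_{i,j}>0$. **Systems of maps.** $\{S_i\}_{i\in\mathcal I}$ is a finite family of contracting self-maps of a compact set $X$, and $S_{\alpha|_k}=S_{\alpha_0}\circ\cdots\circ S_{\alpha_{k-1}}$. (1) Conformal system: $X=\overline U$ with $U=\{x+iy\in\mathbb C:x,y\in(0,1)\}$,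 and each $S_i$ is conformal on $U$ (holomorphic with non-vanishing derivative). Bounded distortion holds: there is $L\ge1$ with $\mathrm{Lip}^+(S_{\alpha|_k})\le L\,\mathrm{Lip}^-(S_{\alpha|_k})$ (with $\mathrm{Lip}^->0$) for all $\alpha\in\Sigma,k\in\mathbb N$, where $\mathrm{Lip}^{+}(T)$, $\mathrm{Lip}^-(T)$ are the supremum, infimum of $|T(x)-T(y)|/|x-y|$ over $x\ne y$ in $X$. (2) System of similarities: $X=[0,1]^d$ and each $S_i$ is a (contracting) similarity. The coding map $\Pi:\Sigma\to X$ is $\{\Pi(\alpha)\}=\bigcap_{k\ge1}S_{\alpha|_k}(X)$, and $F_A=\Pi(\Sigma_A)$. **Strong separation property.** Two finite words are incomparable if neither is a subword of the other. $F_A$ satisfies the strong separation property if for all $\alpha,\beta\in\Sigma_A$ and $k,l\in\mathbb N$ with $\alpha|_k,\beta|_l$ incomparable, $S_{\alpha|_k}(X)\cap S_{\beta|_l}(X)=\emptyset$. *)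

(* Defs.v *)
From mathcomp Require Export all_boot all_order all_algebra.
From mathcomp Require Export complex.
From mathcomp Require Export all_classical all_reals all_analysis.
From mathcomp Require Import ring lra.
Export numFieldNormedType.Exports.
Export Order.TTheory GRing.Theory Num.Theory.
Import Normc.

Set Implicit Arguments.
Unset Strict Implicit.
Unset Printing Implicit Defensive.

Local Open Scope classical_set_scope.
Local Open Scope ring_scope.

(* The metric is an explicit parameter [d] because the library gives R[i] only
   an R[i]-valued norm; it is instantiated below on R and on R[i]. *)
Section Hausdorff.
Context {R : realType} {T : Type} (d : T -> T -> R).

(* 0 is added so that the empty set has diameter 0 and not -oo. *)
Definition diam (A : set T) : \bar R :=
  ereal_sup (0%E |` [set (d p.1 p.2)%:E | p in A `*` A]).

(* [poweR 0 0 = 1], so the empty set must be given weight 0 separately: it is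
   the padding which turns finite covers into sequences. *)
Definition gauge (s : R) (A : set T) : \bar R :=
  if A == set0 then 0%E else poweR (diam A) s.

Definition hausdorff_premeasure (s delta : R) (E : set T) : \bar R :=
  ereal_inf [set (\sum_(0 <= n <oo) gauge s (V n))%E | V in
    [set V : nat -> set T |
      E `<=` \bigcup_n V n /\ forall n, (diam (V n) <= delta%:E)%E]].

Definition hausdorff_measure (s : R) (E : set T) : \bar R :=
  ereal_sup [set hausdorff_premeasure s delta E |
    delta in [set delta : R | 0 < delta]].

Definition hausdorff_dim (E : set T) : \bar R :=
  ereal_inf [set s%:E | s in [set s : R | 0 <= s /\ hausdorff_measure s E = 0%E]].

End Hausdorff.

Section Plane.
Context {R : realType}.
Implicit Types (z : R[i]) (K : set R[i]).

Definition distR (x y : R) : R := `|x - y|.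
Definition distC (x y : R[i]) : R := normc (x - y).

Definition dimR : set R -> \bar R := hausdorff_dim distR.
Definition dimC : set R[i] -> \bar R := hausdorff_dim distC.

Definition distance_set K : set R := [set distC p.1 p.2 | p in K `*` K].

Definition open_square : set R[i] :=
  [set z | 0 < complex.Re z < 1 /\ 0 < complex.Im z < 1].

(* [0,1]^2, under the identification of R^2 with C. *)
Definition square : set R[i] :=
  [set z | 0 <= complex.Re z <= 1 /\ 0 <= complex.Im z <= 1].

(* The spaces X of the two kinds of system coincide. *)
Lemma closure_open_square : closure (open_square : set R[i]^o) = square.
Proof.
have le_normc (a b e : R) : normc (a +i* b)%C <= e -> `|a| <= e /\ `|b| <= e.
  by move=> h; split; apply: le_trans h; rewrite /= -sqrtr_sqr ler_wsqrtr//
    ?lerDl ?lerDr sqr_ge0.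
have normc_lt1 (a b : R) : `|a| <= 2^-1 -> `|b| <= 2^-1 -> normc (a +i* b)%C < 1.
  move=> /ler_normlP[a1 a2] /ler_normlP[b1 b2].
  by rewrite -[ltRHS]sqrtr1 ltr_sqrt//; nra.
apply/seteqP; split => [[x y] zU|[x y] [/= /andP[x0 x1] /andP[y0 y1]] B].
- have near_z (e : R) : 0 < e -> exists u v, [/\ 0 < u < 1, 0 < v < 1,
      `|x - u| <= e & `|y - v| <= e].
    move=> e0; have e0C : 0 < (e%:C)%C :> R[i] by rewrite ltcR.
    have [[u v] [[/= u01 v01]]] := zU _ (nbhsx_ballx ((x +i* y)%C : R[i]^o) _ e0C).
    rewrite -ball_normE /= => /ltW; rewrite lecR => /le_normc[xu yv].
    by exists u, v.
  split => /=; apply/andP; split; apply/ler_addgt0Pr => e /near_z;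
    move=> [u [v [/andP[u0 u1] /andP[v0 v1]]]] /ler_normlP[? ?] /ler_normlP[? ?];
    lra.
- move=> /nbhs_ballP[[e e'] /= e0 zB].
  move: e0; rewrite ltcE /= => /andP[/eqP e'0 e0]; rewrite e'0 in zB.
  pose t := Num.min 2^-1 e.
  have t0 : 0 < t by rewrite lt_min e0 invr_gt0 ltr0n.
  have t1 : t <= 2^-1 by rewrite ge_min lexx.
  have te : t <= e by rewrite ge_min lexx orbT.
  exists ((x + t * (2^-1 - x)) +i* (y + t * (2^-1 - y)))%C; split.
    by split => /=; apply/andP; split; nra.
  apply: zB; rewrite -ball_normE /=.
  have -> : ((x +i* y) - ((x + t * (2^-1 - x)) +i* (y + t * (2^-1 - y))) =
      t%:C * ((x - 2^-1) +i* (y - 2^-1)))%C.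
    by apply/eqP; rewrite eq_complex /=; apply/andP; split; apply/eqP; ring.
  rewrite normrM (_ : (e +i* 0)%C = (e%:C)%C)//.
  rewrite -[`|(t%:C)%C|]/((normc (t%:C)%C)%:C)%C -[`|(_ +i* _)%C|]/((normc _)%:C)%C.
  rewrite -rmorphM ltcR (lt_le_trans _ te)//.
  have -> : normc (t%:C)%C = t by rewrite /= expr0n addr0 sqrtr_sqr gtr0_norm.
  by rewrite gtr_pMr// normc_lt1//; apply/ler_normlP; split; lra.
Qed.

(* Best Lipschitz constants, over [square]. *)
Definition quotients (f : R[i] -> R[i]) : set (\bar R) :=
  [set (distC (f p.1) (f p.2) / distC p.1 p.2)%:E |
    p in [set p | [/\ square p.1, square p.2 & p.1 != p.2]]].
Definition Lip_sup (f : R[i] -> R[i]) : \bar R := ereal_sup (quotients f).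
Definition Lip_inf (f : R[i] -> R[i]) : \bar R := ereal_inf (quotients f).

(* The derivative is the complex one: R[i]^o is R[i] as a normed space over
   itself. *)
Definition conformal_on (U : set R[i]) (f : R[i] -> R[i]) : Prop :=
  forall z, U z -> derivable (f : R[i]^o -> R[i]^o) z 1 /\
                   'D_1 (f : R[i]^o -> R[i]^o) z != 0.

Definition contracting_similarity (f : R[i] -> R[i]) : Prop :=
  exists2 r : R, 0 < r < 1 &
    forall x y, square x -> square y -> distC (f x) (f y) = r * distC x y.

End Plane.

Section Symbolic.
Context {M : nat}.
Implicit Types (A : 'M[nat]_M) (a b : nat -> 'I_M).

Definition zero_one A : Prop := forall i j, A i j = 0%N \/ A i j = 1%N.

Definition irreducible_mx A : Prop :=
  forall i j, exists n : nat, (0 < n)%N /\ (0 < (A ^+ n) i j)%N.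

Definition SFT A : set (nat -> 'I_M) := [set a | forall l, A (a l) (a l.+1) = 1%N].

Definition prefix_word a (k : nat) : seq 'I_M := mkseq a k.

Definition incomparable (u v : seq 'I_M) : Prop := ~~ infix u v /\ ~~ infix v u.

End Symbolic.

(* Each S i is a total function on R[i], of which only the restriction to
   [square] is used. *)
Section Systems.
Context {R : realType} {M : nat} (S : 'I_M -> R[i] -> R[i]).

Definition word_map (w : seq 'I_M) : R[i] -> R[i] :=
  foldr (fun i f => S i \o f) id w.

Definition self_maps : Prop := forall i, S i @` square `<=` square.

Definition bounded_distortion : Prop :=
  exists2 L : R, 1 <= L &
    forall (a : nat -> 'I_M) (k : nat),
      (0 < Lip_inf (word_map (prefix_word a k)))%E /\
      (Lip_sup (word_map (prefix_word a k)) <=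
         L%:E * Lip_inf (word_map (prefix_word a k)))%E.

Definition conformal_system : Prop :=
  [/\ self_maps,
      forall i, (Lip_sup (S i) < 1)%E,
      forall i, conformal_on open_square (S i)
    & bounded_distortion].

Definition similarity_system : Prop :=
  self_maps /\ forall i, contracting_similarity (S i).

(* For contracting self-maps the intersection is a singleton, whose point
   [xget] returns. *)
Definition coding (a : nat -> 'I_M) : R[i] :=
  xget 0 (\bigcap_(k in [set k | (1 <= k)%N])
            (word_map (prefix_word a k) @` square)).

Definition limit_set (A : 'M[nat]_M) : set R[i] := coding @` SFT A.

Definition strong_separation (A : 'M[nat]_M) : Prop :=
  forall a b, SFT A a -> SFT A b -> forall k l : nat,
    incomparable (prefix_word a k) (prefix_word b l) ->
    (word_map (prefix_word a k) @` square) `&`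
    (word_map (prefix_word b l) @` square) = set0.

End Systems.

(* Main.v *)
(** Fix s < 1. We show that the s-dimensional Hausdorff measure of the distance
    set is positive, by finding in it the image of a regular tree of cylinders
    under x |-> |p - x|.

    On a small cylinder every word w acts, up to a small relative error, as a
    scalar multiple of an element o(w) of O(2): exactly so for similarities,
    and by Cauchy's formula for conformal maps. By pigeonhole, finitely many
    words u are enough to correct any w to o(w u) ~ 1. Along a tree whose nodes
    are all corrected in this way, the distance to a far point p is close, at
    every scale, to one fixed linear projection.

    Since F has no efficient covers of dimension less than 1, there are
    loops v_1, ..., v_N of comparable size r and with N about r^(-s) whose
    cylinders are r-separated. Averaged over the directions of projection, few
    pairs of products of these loops collide. A weighted Caro-Wei bound turns
    this into one direction t and a large set of words of a given length whose
    cylinders project to separated intervals.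

    It remains to find p such that the segment from p to the tree has
    direction t. If the directions between points of some cylinder miss a
    neighbourhood of t, this cylinder is a bi-Lipschitz copy of a subset of a
    line, whence dim F <= 1; under strong separation the subset is moreover
    porous, whence dim F < 1. *)
From mathcomp Require Import ring lra.
Require Import Defs.
Import Normc.

Set Implicit Arguments.
Unset Strict Implicit.
Unset Printing Implicit Defensive.

Local Open Scope classical_set_scope.
Local Open Scope ring_scope.

(** * Complex differentiation and bounded distortion *)

(** Correction is forced because a single direction [t] serves for the whole tree: the words
    supplied by the energy estimate have separated projections in their own frame, and an
    uncorrected node would turn this frame. A correction has to follow the whole word leading to a
    node, so it varies with the node, but its cost must not depend on the depth. This dictates the
    order of the choices. The gap [g] of the projected alphabet is fixed first, then an error [eta]
    small against [g / L], then the word [z] and the finite set of corrections belonging to [eta],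
    with a lower bound [kap] for their scales, and only then the length [n] of the words of one
    step. The loss [lam z * kap] per step is thereby fixed, whereas the number of words exceeds what
    is needed by the factor [q^(-n (s3 - s2))], with exponents [s < s2 < s3 < 1].

    In the conformal case derivatives exist only in the open square. That the limit set reaches it
    follows from the same graph argument that supplies the directions. A lower bound for the
    dimension of F is used throughout in the form that certain finite covers do not exist. *)

Section Modulus.
Context {R : realType}.
Implicit Types (x y z : R[i]).

Lemma eq_ler (a b : R) : a = b -> a <= b.
Proof. by move=> ->. Qed.

Lemma normc_ge0 z : 0 <= normc z.
Proof. by case: z => a b; rewrite sqrtr_ge0. Qed.

Lemma normc_gt0 z : (0 < normc z) = (z != 0).
Proof.
rewrite lt_neqAle normc_ge0 andbT eq_sym; congr (~~ _); apply/eqP/eqP.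
  exact: eq0_normc.
by move=> ->; exact: normc0.
Qed.

Lemma normcBC x y : normc (x - y) = normc (y - x).
Proof. by rewrite -normcN opprB. Qed.

Lemma ler_normcB x y : normc (x - y) <= normc x + normc y.
Proof. by rewrite -(normcN y) le_normcD. Qed.

Lemma ler_normc_sub z x y : normc (x - y) <= normc (x - z) + normc (z - y).
Proof. by apply: le_trans (le_normcD _ _); rewrite addrA subrK. Qed.

Lemma lerB_normc x y : normc x - normc y <= normc (x - y).
Proof. by rewrite lerBlDr; apply: le_trans (le_normcD _ _); rewrite subrK. Qed.

Lemma normc_real (a : R) : normc (a%:C)%C = `|a|.
Proof. by rewrite /= expr0n addr0 sqrtr_sqr. Qed.

Lemma Re_le_normc z : `|complex.Re z| <= normc z.
Proof. by case: z => a b /=; rewrite -sqrtr_sqr ler_wsqrtr// lerDl sqr_ge0. Qed.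

Lemma Im_le_normc z : `|complex.Im z| <= normc z.
Proof. by case: z => a b /=; rewrite -sqrtr_sqr ler_wsqrtr// lerDr sqr_ge0. Qed.

Lemma normc_le_ReIm z : normc z <= `|complex.Re z| + `|complex.Im z|.
Proof.
case: z => a b /=.
rewrite -(@ler_pXn2r _ 2) ?nnegrE ?sqrtr_ge0 ?addr_ge0//.
rewrite sqr_sqrtr ?addr_ge0 ?sqr_ge0// -(real_normK (num_real a)) -(real_normK (num_real b)).
have := normr_ge0 a; have := normr_ge0 b; nra.
Qed.

Lemma normc_expi (t : R) : normc (cos t +i* sin t)%C = 1.
Proof. by rewrite /= cos2Dsin2 sqrtr1. Qed.

Lemma normc_lt z (e : R) : (`|z| < e%:C%C) = (normc z < e).
Proof. by rewrite -[`|z|]/((normc z)%:C)%C ltcR. Qed.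

Lemma derivable_expand (f : R[i]^o -> R[i]^o) z :
  derivable f z 1 -> forall e : R, 0 < e -> exists2 d : R, 0 < d &
    forall h : R[i], normc h < d ->
      normc (f (z + h) - f z - 'D_1 f z * h) <= e * normc h.
Proof.
move=> df e e0.
have /cvgrPdist_lt/(_ (e%:C)%C) := df.
rewrite ltcR => /(_ e0) [[d d'] /=]; rewrite ltcE /= => /andP[/eqP -> d0] hd.
exists d => // h hd0; have [->|h0] := eqVneq h 0.
  by rewrite addr0 subrr mulr0 subrr normc0 mulr0.
have := hd h.
rewrite /ball_ /= sub0r normrN.
rewrite -[`|h|]/((normc h)%:C)%C ltcR hd0 => /(_ isT h0).
rewrite -['D_1 f z]/(lim _).
set D := lim _.
rewrite normc_lt => H.
have key (E F : R[i]) : F - E * h = - h * (E - h^-1 * F).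
  by rewrite mulrBr !mulNr opprK mulrA mulfV// mul1r addrC mulrC.
have hz : h%:A + z = z + h :> R[i] by rewrite addrC /GRing.scale /= mulr1.
move: H; rewrite hz => H.
rewrite (key D) normcM normcN mulrC ler_wpM2r ?normc_ge0// ltW//.
Qed.

End Modulus.

(** * Integrals over a period that depend on a parameter *)

Section IntegralDerivative.
Context {R : realType}.
Notation mu := (@lebesgue_measure R).

Lemma is_derive_continuous (f : R -> R) (l x : R) :
  is_derive x 1 f l -> {for x, continuous f}.
Proof. by move=> [df _]; apply/differentiable_continuous/derivable1_diffP. Qed.

Lemma continuous_integrable (f : R -> R) (a b : R) :
  continuous f -> mu.-integrable `[a, b] (EFin \o f).
Proof.
move=> cf; apply: continuous_compact_integrable; first exact: segment_compact.
exact: continuous_subspaceT.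
Qed.

(** The primitive based at [-2] has two-sided derivatives at [h] and [P + h] for all [|h| < 1], so
    the integral over a shifted window can be differentiated in the shift. *)
Lemma Rintegral_shift (f : R -> R) (P : R) : 0 < P -> continuous f ->
  exists F : R -> R, forall h : R, -1 < h -> h < 1 ->
  [/\ is_derive h 1 F (f h), is_derive (P + h) 1 F (f (P + h)) &
      \int[mu]_(x in `[0, P]) f (x + h) = F (P + h) - F h].
Proof.
move=> P0 cf; pose F (x : R) : R := \int[mu]_(t in `[-2, x]) f t; exists F => h h1 h2.
have dF (x : R) : -2 < x -> is_derive x 1 F (f x).
  move=> x2; have xS : x < x + 1 by rewrite ltrDl.
  have [dF <-] := continuous_FTC1_closed xS (continuous_integrable (-2) (x + 1) cf) x2 (cf x).
  by rewrite derive1E; apply: DeriveDef.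
split; [by apply: dF; lra|by apply: dF; lra|].
have dG (x : R) : -1 < x -> is_derive x 1 (fun y => F (y + h)) (f (x + h)).
  move=> x1; have dFx : is_derive (x + h) 1 F (f (x + h)) by apply: dF; lra.
  rewrite -[X in is_derive _ _ _ X]mulr1.
  apply: (@is_derive1_comp _ F (fun y => y + h) x (f (x + h)) 1 dFx).
  by rewrite -[X in is_derive _ _ _ X]addr0; apply: is_deriveD.
rewrite /Rintegral (@continuous_FTC2 _ _ (fun y => F (y + h))) ?add0r//.
- apply: continuous_subspaceT => x.
  apply: (@continuous_comp _ _ _ (fun y => y + h) f); last exact: cf.
  by apply: cvgD; [exact: cvg_id|exact: cvg_cst].
- split.
  + move=> x; rewrite in_itv/= => /andP[x0 _]; have x1 : -1 < x by lra.
    by have [? _] := dG x x1.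
  + apply: cvg_at_right_filter; apply: (is_derive_continuous (dG _ _)); lra.
  + apply: cvg_at_left_filter; apply: (is_derive_continuous (dG _ _)); lra.
- move=> x; rewrite in_itv/= => /andP[x0 _].
  rewrite derive1E; have x1 : -1 < x by lra.
  by have [_ ->] := dG x x1.
Qed.

Lemma is_derive_Rintegral (f df : R -> R -> R) (P B a u v : R) :
  u < a -> a < v -> (forall x : R, u < x -> x < v -> continuous (f x)) ->
  (forall x y : R, u < x -> x < v -> is_derive x 1 (f ^~ y) (df x y)) ->
  (forall x y : R, u < x -> x < v -> `|df x y| <= B) ->
  is_derive a 1 (fun x => \int[mu]_(y in `[0, P]) f x y)
    (\int[mu]_(y in `[0, P]) df a y).
Proof.
move=> ua av cf hd dB.
have B0 : 0 <= B by exact: le_trans (dB a 0 ua av).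
have Ia : `]u, v[%classic a by rewrite /= in_itv/= ua av.
have intf x : `]u, v[%classic x -> mu.-integrable `[0, P] (EFin \o f x).
  by rewrite /= in_itv/= => /andP[? ?]; apply: continuous_integrable; exact: cf.
have der x y : `]u, v[%classic x -> `[0, P]%classic y -> derivable (f ^~ y) x 1.
  by rewrite /= in_itv/= => /andP[ux xv] _; have [] := hd x y ux xv.
have B0' (y : R) : 0 <= (fun=> B) y by [].
have intB : mu.-integrable `[0, P] (EFin \o (fun=> B)).
  by apply: continuous_integrable => x; exact: cvg_cst.
have ub x y : `]u, v[%classic x -> `[0, P]%classic y -> `|partial1of2 f x y| <= B.
  rewrite /= in_itv/= => /andP[ux xv] _; rewrite partial1of2E.
  by have [_ ->] := hd x y ux xv; exact: dB.
have mP : measurable (`[0, P] : set R) by exact: measurable_itv.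
apply: DeriveDef.
  exact: (@derivable_under_integral R _ _ mu f _ mP a u v Ia intf der (fun=> B) B0' intB ub).
rewrite -derive1E.
rewrite (@differentiation_under_integral R _ _ mu f _ mP a u v Ia intf der (fun=> B) B0' intB ub).
apply: eq_Rintegral => y _; rewrite partial1of2E.
by have [_ ->] := hd a y ua av.
Qed.

(* Only boundedness of [w] is assumed: its continuity is not known for the
   derivative of a complex differentiable function. *)
Lemma Rintegral_derive (f w : R -> R) (B P : R) : 0 < P ->
  (forall x : R, is_derive x 1 f (w x)) -> (forall x : R, `|w x| <= B) ->
  \int[mu]_(x in `[0, P]) w x = f P - f 0.
Proof.
move=> P0 df wB.
have cf : continuous f by move=> x; exact: is_derive_continuous (df x).
have cfs (h : R) : continuous (fun x => f (x + h)).
  move=> x; apply: (@continuous_comp _ _ _ (fun y => y + h) f); last exact: cf.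
  by apply: cvgD; [exact: cvg_id|exact: cvg_cst].
have dfs (h x : R) : is_derive h 1 (fun k => f (x + k)) (w (x + h)).
  rewrite -[X in is_derive _ _ _ X]mulr1.
  apply: (@is_derive1_comp _ f (fun y => x + y) h (w (x + h)) 1 (df _)).
  by rewrite -[X in is_derive _ _ _ X]add0r; apply: is_deriveD.
(* The integral of [f (x + h)] over [[0, P]] is differentiated at [h = 0] in two ways: under the
   integral sign, which gives the integral of [w], and at the two ends of the window, which gives
   [f P - f 0]. *)
have [F hF] := Rintegral_shift P0 cf.
have dG := @is_derive_Rintegral (fun h x => f (x + h)) (fun h x => w (x + h)) P B
  0 (-1) 1 (ltrN10 _) ltr01 (fun h _ _ => cfs h) (fun h x _ _ => dfs h x)
  (fun h x _ _ => wB (x + h)).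
have := dG; rewrite /= => -[_ dG0].
have [F0 FP _] := hF 0 (ltrN10 _) ltr01.
have dD : is_derive (0 : R) 1 (fun h => F (P + h) - F h) (f (P + 0) - f 0).
  apply: is_deriveB; rewrite -[X in is_derive _ _ _ X]mulr1.
  apply: (@is_derive1_comp _ F (fun y => P + y) 0 (f (P + 0)) 1 FP).
  by rewrite -[X in is_derive _ _ _ X]add0r; apply: is_deriveD.
rewrite addr0 in dD; case: dD => _ <-.
transitivity (\int[mu]_(x in `[0, P]) w (x + 0)).
  by apply: eq_Rintegral => x _; rewrite addr0.
rewrite -dG0; apply: near_eq_derive; rewrite ?oner_neq0//.
have : \forall h \near (0 : R), h \in `]-1, 1[.
  by apply: near_in_itvoo; rewrite in_itv/= ltrN10 ltr01.
apply: filterS => h; rewrite in_itv/= => /andP[h1 h2].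
by have [_ _ ->] := hF h h1 h2.
Qed.

(** The derivative of the mean of [u] in [t] is the integral of [w / t]. As [w] is the angular
    derivative of the periodic [v], it vanishes. This is how the Cauchy-Riemann equations in polar
    coordinates enter. *)
Lemma Rintegral_period_constant (u v w : R -> R -> R) (T B P : R) : 0 < P ->
  (forall t y : R, 0 < t -> t < T -> is_derive t 1 (u ^~ y) (w t y / t)) ->
  (forall t y : R, 0 < t -> t < T -> is_derive y 1 (v t) (w t y)) ->
  (forall t : R, 0 < t -> t < T -> continuous (u t)) ->
  (forall t y : R, 0 < t -> t < T -> `|w t y| <= B) ->
  (forall t : R, 0 < t -> t < T -> v t P = v t 0) ->
  forall s t : R, 0 < s -> s < t -> t < T ->
  \int[mu]_(y in `[0, P]) u t y = \int[mu]_(y in `[0, P]) u s y.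
Proof.
move=> P0 du dv cu wB vP s t s0 st tT.
have B0 : 0 <= B by apply: le_trans (wB s 0 s0 (lt_trans st tT)).
pose I (x : R) : R := \int[mu]_(y in `[0, P]) u x y.
(* Staying above [s / 2] bounds [w / x] uniformly, as differentiation under the integral sign
   requires. *)
have dI (x : R) : s / 2 < x -> x < T -> is_derive x 1 I 0.
  move=> sx xT; have s20 : 0 < s / 2 by rewrite divr_gt0.
  have x0 : 0 < x by apply: lt_trans sx.
  have -> : 0 = \int[mu]_(y in `[0, P]) (w x y / x) :> R.
    have dvx (y : R) : is_derive y 1 (fun z => v x z / x) (w x y / x).
      rewrite (_ : (fun z => v x z / x) = x^-1 *: v x); last first.
        by apply/funext => z; rewrite mulrC.
      by rewrite mulrC; apply: is_deriveZ; exact: dv.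
    have wx (y : R) : `|w x y / x| <= B / x.
      rewrite normrM normfV (gtr0_norm x0).
      by apply: ler_wpM2r; [rewrite invr_ge0 ltW|exact: wB].
    by rewrite (Rintegral_derive P0 dvx wx) vP// subrr.
  apply: (@is_derive_Rintegral u (fun x y => w x y / x) P (B / (s / 2)) x (s / 2) T) => //.
  - by move=> z sz; apply: cu; exact: lt_trans sz.
  - by move=> z y sz; apply: du; exact: lt_trans sz.
  - move=> z y sz zT; have z0 : 0 < z by apply: lt_trans sz.
    rewrite normrM normfV (gtr0_norm z0).
    apply: ler_pM => //; [by rewrite invr_ge0 ltW|exact: wB|].
    by rewrite lef_pV2 ?posrE// ltW.
have [c cst] : exists2 c, c \in `[s, t] & I t - I s = 0 * (t - s).
  apply: (@MVT_segment R I (fun=> 0) s t (ltW st)).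
    by move=> x; rewrite in_itv/= => /andP[sx xt]; apply: dI; lra.
  apply: derivable_within_continuous => x; rewrite in_itv/= => /andP[sx xt].
  by have [] : is_derive x 1 I 0 by apply: dI; lra.
by rewrite mul0r => /eqP; rewrite subr_eq0 => /eqP.
Qed.

End IntegralDerivative.

(** * Curves in the plane and the chain rule *)

Section PathDerivative.
Context {R : realType}.
Implicit Types (f : R -> R) (g : R[i] -> R[i]) (p z l m : R[i]).

Lemma is_derive_expandP f (x l : R) :
  is_derive x 1 f l <-> (forall e : R, 0 < e -> exists2 d : R, 0 < d &
    forall k : R, `|k| < d -> `|f (x + k) - f x - l * k| <= e * `|k|).
Proof.
have E k : k^-1 *: (f (k%:A + x) - f x) = k^-1 * (f (x + k) - f x).
  by rewrite [k%:A]mulr1 (addrC k x).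
split=> [[df <-] e e0|H].
- have /cvgrPdist_le/(_ e e0)[d /= d0 hd] := df.
  exists d => // k kd; have [->|k0] := eqVneq k 0.
    by rewrite addr0 subrr mulr0 subrr normr0 mulr0.
  have := hd k; rewrite /ball_ /= sub0r normrN => /(_ kd k0).
  rewrite -['D_1 f x]/(lim _) E; set D := lim _ => hk.
  have -> : f (x + k) - f x - D * k = (k^-1 * (f (x + k) - f x) - D) * k.
    by rewrite mulrBl mulrAC mulVf// mul1r.
  by rewrite normrM ler_wpM2r// distrC.
- have cv : h^-1 *: (f (h *: 1 + x) - f x) @[h --> 0^'] --> l.
    apply/cvgrPdist_le => e e0; have [d d0 hd] := H e e0.
    exists d => // k /=; rewrite sub0r normrN => /hd kd k0; rewrite E.
    have -> : l - k^-1 * (f (x + k) - f x) = - k^-1 * (f (x + k) - f x - l * k).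
      by field.
    rewrite normrM normrN normfV mulrC ler_pdivrMr ?normr_gt0//.
  apply: DeriveDef; first by apply/cvg_ex; exists l.
  exact: cvg_lim cv.
Qed.

(** Complex differentiability at [z] with derivative [l], in Landau form and with the real-valued
    modulus. *)
Definition cdiff g z l := forall e : R, 0 < e -> exists2 d : R, 0 < d &
  forall h : R[i], normc h < d -> normc (g (z + h) - g z - l * h) <= e * normc h.

(** Coordinatewise, so that integration and the mean value theorem for real functions apply
    directly. *)
Definition path_diff (c : R -> R[i]) (t : R) l :=
  is_derive t 1 (fun s => complex.Re (c s)) (complex.Re l) /\
  is_derive t 1 (fun s => complex.Im (c s)) (complex.Im l).

Lemma path_diff_cst z (t : R) : path_diff (fun=> z) t 0.
Proof. by split; exact: is_derive_cst. Qed.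

Lemma path_diff_real f (t l : R) :
  is_derive t 1 f l -> path_diff (fun s => (f s)%:C%C) t (l%:C)%C.
Proof. by move=> df; split => //=; exact: is_derive_cst. Qed.

Lemma path_diffD c d (t : R) l m : path_diff c t l -> path_diff d t m ->
  path_diff (fun s => c s + d s) t (l + m).
Proof.
move=> [c1 c2] [d1 d2]; split; rewrite raddfD /=.
- rewrite (_ : (fun s => _) = (fun s => complex.Re (c s)) + (fun s => complex.Re (d s)));
    last by apply/funext => s; rewrite raddfD.
  exact: is_deriveD.
- rewrite (_ : (fun s => _) = (fun s => complex.Im (c s)) + (fun s => complex.Im (d s)));
    last by apply/funext => s; rewrite raddfD.
  exact: is_deriveD.
Qed.

Lemma path_diffM c d (t : R) l m : path_diff c t l -> path_diff d t m ->
  path_diff (fun s => c s * d s) t (l * d t + c t * m).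
Proof.
have ReM (x y : R[i]) : complex.Re (x * y) =
    complex.Re x * complex.Re y - complex.Im x * complex.Im y by case: x y => [? ?] [? ?].
have ImM (x y : R[i]) : complex.Im (x * y) =
    complex.Re x * complex.Im y + complex.Im x * complex.Re y by case: x y => [? ?] [? ?].
move=> [c1 c2] [d1 d2]; split.
- rewrite (_ : (fun s => _) = (fun s => complex.Re (c s)) * (fun s => complex.Re (d s))
      - (fun s => complex.Im (c s)) * (fun s => complex.Im (d s)));
    last by apply/funext => s; rewrite ReM.
  have H := is_deriveB (is_deriveM c1 d1) (is_deriveM c2 d2).
  rewrite raddfD/= !ReM; apply: (is_derive_eq H); rewrite /GRing.scale/=; ring.
- rewrite (_ : (fun s => _) = (fun s => complex.Re (c s)) * (fun s => complex.Im (d s))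
      + (fun s => complex.Im (c s)) * (fun s => complex.Re (d s)));
    last by apply/funext => s; rewrite ImM.
  have H := is_deriveD (is_deriveM c1 d2) (is_deriveM c2 d1).
  rewrite raddfD/= !ImM; apply: (is_derive_eq H); rewrite /GRing.scale/=; ring.
Qed.

Lemma path_diff_expandP c (t : R) l :
  path_diff c t l <-> (forall e : R, 0 < e -> exists2 d : R, 0 < d &
    forall k : R, `|k| < d -> normc (c (t + k) - c t - l * k%:C%C) <= e * `|k|).
Proof.
have ReE (k : R) : complex.Re (c (t + k) - c t - l * k%:C%C) =
    complex.Re (c (t + k)) - complex.Re (c t) - complex.Re l * k.
  by rewrite !raddfB/=; case: (l) => a b /=; ring.
have ImE (k : R) : complex.Im (c (t + k) - c t - l * k%:C%C) =
    complex.Im (c (t + k)) - complex.Im (c t) - complex.Im l * k.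
  by rewrite !raddfB/=; case: (l) => a b /=; ring.
split=> [[/is_derive_expandP H1 /is_derive_expandP H2] e e0|H].
- have e20 : 0 < e / 2 by rewrite divr_gt0.
  have [d1 d10 h1] := H1 _ e20; have [d2 d20 h2] := H2 _ e20.
  exists (Num.min d1 d2); first by rewrite lt_min d10.
  move=> k; rewrite lt_min => /andP[/h1 {}h1 /h2 {}h2].
  apply: le_trans (normc_le_ReIm _) _; rewrite ReE ImE.
  by apply: le_trans (lerD h1 h2) _; rewrite -mulrDl -splitr.
- split; apply/is_derive_expandP => e e0; have [d d0 h] := H e e0; exists d => // k /h.
  + by move=> hk; rewrite -ReE (le_trans (Re_le_normc _)).
  + by move=> hk; rewrite -ImE (le_trans (Im_le_normc _)).
Qed.

Lemma path_diff_comp g c (t : R) l m :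
  path_diff c t l -> cdiff g (c t) m -> path_diff (g \o c) t (m * l).
Proof.
move=> /path_diff_expandP dc dg; apply/path_diff_expandP => e e0 /=.
have L0 : 0 < normc l + 1 by rewrite ltr_wpDl// normc_ge0.
have M0 : 0 < normc m + 1 by rewrite ltr_wpDl// normc_ge0.
(* The bound [1] makes the increment of [c] at most [(normc l + 1) * |k|]; the other bound keeps the
   error multiplied by [m] below [e / 2]. *)
pose e1 := Num.min 1 (e / 2 / (normc m + 1)).
have e10 : 0 < e1 by rewrite lt_min ltr01 !divr_gt0.
have [d1 d10 h1] := dc _ e10.
have [d2 d20 h2] : exists2 d2 : R, 0 < d2 & forall h : R[i], normc h < d2 ->
    normc (g (c t + h) - g (c t) - m * h) <= e / 2 / (normc l + 1) * normc h.
  by apply: dg; rewrite !divr_gt0.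
exists (Num.min d1 (d2 / (normc l + 1))); first by rewrite lt_min d10 divr_gt0.
move=> k; rewrite lt_min => /andP[/h1 {}h1 kd2].
pose h : R[i] := c (t + k) - c t.
have hE : c (t + k) = c t + h by rewrite /h addrCA subrr addr0.
have hl : normc h <= (normc l + 1) * `|k|.
  have -> : h = h - l * (k%:C)%C + l * (k%:C)%C by rewrite subrK.
  apply: le_trans (le_normcD _ _) _; rewrite normcM normc_real mulrDl mul1r addrC lerD2l.
  apply: le_trans h1 _; rewrite ler_piMl// /e1 ge_min lexx//.
have hd2 : normc h < d2.
  by apply: le_lt_trans hl _; rewrite mulrC -ltr_pdivlMr.
rewrite hE.
have -> : g (c t + h) - g (c t) - m * l * (k%:C)%C =
    (g (c t + h) - g (c t) - m * h) + m * (h - l * (k%:C)%C) by ring.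
apply: le_trans (le_normcD _ _) _.
rewrite [e]splitr mulrDl; apply: lerD.
  apply: le_trans (h2 _ hd2) _.
  rewrite -mulrA; apply: ler_wpM2l; last by rewrite ler_pdivrMl.
  by rewrite divr_ge0 ?(ltW e0).
rewrite normcM; apply: (@le_trans _ _ (normc m * (e1 * `|k|))).
  by rewrite ler_wpM2l ?normc_ge0.
rewrite mulrA ler_wpM2r//.
apply: (@le_trans _ _ ((normc m + 1) * e1)); first by rewrite ler_wpM2r ?(ltW e10)// lerDl.
by rewrite mulrC -ler_pdivlMr// /e1 ge_min lexx orbT.
Qed.

Lemma cdiff_le_lipschitz g z l (T B : R) : 0 < T -> 
  (forall h : R[i], normc h < T -> normc (g (z + h) - g z) <= B * normc h) ->
  cdiff g z l -> normc l <= B.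
Proof.
move=> T0 lip dg; apply/ler_addgt0Pr => e e0; have [d d0 hd] := dg e e0.
pose k := Num.min T d / 2.
have m0 : 0 < Num.min T d by rewrite lt_min T0.
have k0 : 0 < k by rewrite divr_gt0.
have km : k < Num.min T d by rewrite ltr_pdivrMr// ltr_pMr// ltr1n.
have nk : normc (k%:C)%C = k by rewrite normc_real gtr0_norm.
have := hd (k%:C)%C; have := lip (k%:C)%C; rewrite nk.
move: (km); rewrite lt_min => /andP[-> ->] /(_ isT) h1 /(_ isT) h2.
rewrite -(ler_pM2r k0) mulrDl -{1}nk -normcM.
have -> : l * (k%:C)%C = (g (z + (k%:C)%C) - g z) - (g (z + (k%:C)%C) - g z - l * (k%:C)%C) by ring.
by apply: le_trans (ler_normcB _ _) (lerD h1 h2).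
Qed.

End PathDerivative.

(* The mean over the circle of radius [t] of the difference quotient at [p]
   does not depend on [t], because its radial and its angular derivatives are
   proportional. Letting [t] tend to [0] gives Cauchy's formula for [D p]. *)
Section CauchyFormula.
Context {R : realType}.
Notation mu := (@lebesgue_measure R).
Variables (g D : R[i] -> R[i]) (p : R[i]) (T B : R).
Hypothesis T0 : 0 < T.
Hypothesis gD : forall z, normc (z - p) < T -> cdiff g z (D z).
Hypothesis gB : forall x y, normc (x - p) < T -> normc (y - p) < T ->
  normc (g x - g y) <= B * normc (x - y).

Let E (y : R) : R[i] := (cos y +i* sin y)%C.
Let c (t y : R) : R[i] := p + (t%:C)%C * E y.

(** The quotient of [g (p + t e^(iy)) - g p] by [t e^(iy)]. The inverse of [e^(iy)] is written as
    its conjugate, so that product rules give both partial derivatives. *)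
Definition circle_quotient (t y : R) : R[i] :=
  (g (p + (t%:C)%C * (cos y +i* sin y)%C) - g p) *
  ((cos y -i* sin y)%C * (t^-1%:C)%C).
Let H := circle_quotient.

Let B0 : 0 <= B.
Proof.
have pT (z : R[i]) : normc z < T -> normc (p + z - p) < T by rewrite addrAC subrr add0r.
have nk : normc ((T / 2)%:C)%C = T / 2 by rewrite normc_real gtr0_norm ?divr_gt0.
have T2 : T / 2 < T by rewrite ltr_pdivrMr// ltr_pMr// ltr1n.
have := gB (pT ((T / 2)%:C)%C _) (pT 0 _); rewrite nk normc0 T2 T0 => /(_ isT isT).
rewrite addr0 addrAC subrr add0r nk => h.
by rewrite -(pmulr_lge0 _ (divr_gt0 T0 (ltr0Sn R 1))) (le_trans _ h) ?normc_ge0.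
Qed.

Let normE y : normc (E y) = 1. Proof. exact: normc_expi. Qed.

Let EEc y : E y * (cos y -i* sin y)%C = 1.
Proof.
apply/eqP; rewrite eq_complex /=; apply/andP; split; apply/eqP; last by ring.
by rewrite mulrN opprK -!expr2 cos2Dsin2.
Qed.

Let c_ball t y : 0 < t -> t < T -> normc (c t y - p) < T.
Proof.
by move=> t0 tT; rewrite /c addrAC subrr add0r normcM normE mulr1 normc_real gtr0_norm.
Qed.

(** The common factor of both partial derivatives: that of [H] in [t] is [W / t], that in [y] is
    [i W]. *)
Let W t y := D (c t y) - H t y.

Let D_le z : normc (z - p) < T -> normc (D z) <= B.
Proof.
move=> zT; apply: (@cdiff_le_lipschitz _ g z (D z) (T - normc (z - p))); last exact: gD.
  by rewrite subr_gt0.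
move=> h hT; have zh : normc (z + h - p) < T.
  by rewrite addrAC (le_lt_trans (le_normcD _ _))// -ltrBrDl.
by apply: le_trans (gB zh zT) _; rewrite addrAC subrr add0r.
Qed.

Let H_le t y : 0 < t -> t < T -> normc (H t y) <= B.
Proof.
move=> t0 tT; rewrite /H /circle_quotient !normcM normc_real.
have pp : normc (p - p) < T by rewrite subrr normc0.
have -> : normc (cos y -i* sin y)%C = 1 by rewrite /= sqrrN cos2Dsin2 sqrtr1.
rewrite mul1r normfV gtr0_norm// ler_pdivrMr//.
apply: le_trans (gB (c_ball y t0 tT) pp) _.
by rewrite /c addrAC subrr add0r normcM normE mulr1 normc_real gtr0_norm.
Qed.

Let W_le t y : 0 < t -> t < T -> normc (W t y) <= 2 * B.
Proof.
move=> t0 tT; apply: le_trans (ler_normcB _ _) _; rewrite mulr_natl mulr2n.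
by apply: lerD; [exact/D_le/c_ball|exact: H_le].
Qed.

Let dE (y : R) : path_diff E y ('i%C * E y).
Proof.
split => /=; rewrite ?mul0r ?mul1r ?sub0r ?add0r.
  exact: is_derive_cos.
exact: is_derive_sin.
Qed.

Let dEc (y : R) : path_diff (fun y : R => (cos y -i* sin y)%C) y (- 'i%C * (cos y -i* sin y)%C).
Proof.
split => /=.
  by apply: (is_derive_eq (is_derive_cos y)); ring.
by apply: (is_derive_eq (is_deriveN (is_derive_sin y))); ring.
Qed.

Let dH_radius (t y : R) : 0 < t -> t < T -> path_diff (H ^~ y) t (W t y * (t^-1%:C)%C).
Proof.
move=> t0 tT.
have dt : path_diff (fun s : R => (s%:C)%C) t 1.
  by apply: (path_diff_real (@is_derive_id _ _ t 1)).
have dti : path_diff (fun s : R => (s^-1%:C)%C) t ((- t ^- 2)%:C)%C.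
  apply: path_diff_real; have := @is_deriveV R (fun s : R => s) t 1 1 (lt0r_neq0 t0).
  by rewrite /GRing.scale /= mulr1; apply; exact: is_derive_id.
have dc := path_diffD (path_diff_cst p t) (path_diffM dt (path_diff_cst (E y) t)).
have dg := path_diff_comp dc (gD (c_ball y t0 tT)).
have dd := path_diffD dg (path_diff_cst (- g p) t).
have := path_diffM dd (path_diffM (path_diff_cst (cos y -i* sin y)%C t) dti).
congr path_diff; rewrite /W /H /circle_quotient -/(E y) -/(c t y).
set G := g _ - g p; set Ec := (_ -i* _)%C; set d := D _.
have e1 : E y * Ec = 1 := EEc y.
have e2 : ((- t ^- 2)%:C)%C = - ((t^-1)%:C)%C * ((t^-1)%:C)%C.
  by rewrite -rmorphN -rmorphM /= -exprVn expr2 mulNr.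
rewrite e2 /comp /=; transitivity (d * ((t^-1)%:C)%C * (E y * Ec) - G * Ec * ((t^-1)%:C)%C * ((t^-1)%:C)%C).
  rewrite /G /c; ring.
by rewrite e1; ring.
Qed.

Let dH_angle (t y : R) : 0 < t -> t < T -> path_diff (H t) y ('i%C * W t y).
Proof.
move=> t0 tT.
have dc := path_diffD (path_diff_cst p y) (path_diffM (path_diff_cst (t%:C)%C y) (dE y)).
have dg := path_diff_comp dc (gD (c_ball y t0 tT)).
have dd := path_diffD dg (path_diff_cst (- g p) y).
have := path_diffM dd (path_diffM (dEc y) (path_diff_cst (t^-1%:C)%C y)).
congr path_diff; rewrite /W /H /circle_quotient -/(E y) -/(c t y).
set G := g _ - g p; set Ec := (_ -i* _)%C; set d := D _.
have e1 : E y * Ec = 1 := EEc y.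
have e2 : (t%:C)%C * ((t^-1)%:C)%C = 1 by rewrite -rmorphM /= mulfV ?rmorph1// gt_eqF.
rewrite /comp /=; transitivity ('i%C * (d * (E y * Ec) * ((t%:C)%C * ((t^-1)%:C)%C) - G * (Ec * ((t^-1)%:C)%C))).
  rewrite /G /c; ring.
by rewrite e1 e2; ring.
Qed.

Let Re_i z : complex.Re ('i%C * z) = - complex.Im z :> R.
Proof. by case: z => a b /=; ring. Qed.
Let Im_i z : complex.Im ('i%C * z) = complex.Re z :> R.
Proof. by case: z => a b /=; ring. Qed.
Let Re_r z (a : R) : complex.Re (z * (a%:C)%C) = complex.Re z * a.
Proof. by case: z => x y /=; ring. Qed.
Let Im_r z (a : R) : complex.Im (z * (a%:C)%C) = complex.Im z * a.
Proof. by case: z => x y /=; ring. Qed.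

Let pi2 : 0 < pi *+ 2 :> R. Proof. by rewrite pmulrn_lgt0// pi_gt0. Qed.

Let H_period t : H t (pi *+ 2) = H t 0.
Proof. by rewrite /H /circle_quotient cos2pi sin2pi cos0 sin0. Qed.

Let Re_const s t : 0 < s -> s < t -> t < T ->
  \int[mu]_(y in `[0, pi *+ 2]) complex.Re (H t y) =
  \int[mu]_(y in `[0, pi *+ 2]) complex.Re (H s y).
Proof.
apply: (@Rintegral_period_constant R (fun t y => complex.Re (H t y))
  (fun t y => complex.Im (H t y)) (fun t y => complex.Re (W t y)) T (2 * B) _ pi2).
- by move=> r y r0 rT; have [+ _] := dH_radius y r0 rT; rewrite Re_r.
- by move=> r y r0 rT; have [_] := dH_angle y r0 rT; rewrite Im_i.
- by move=> r r0 rT y; have [h _] := dH_angle y r0 rT; exact: is_derive_continuous h.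
- by move=> r y r0 rT; apply: le_trans (Re_le_normc _) (W_le _ r0 rT).
- by move=> r r0 rT; rewrite H_period.
Qed.

Let Im_const s t : 0 < s -> s < t -> t < T ->
  \int[mu]_(y in `[0, pi *+ 2]) complex.Im (H t y) =
  \int[mu]_(y in `[0, pi *+ 2]) complex.Im (H s y).
Proof.
apply: (@Rintegral_period_constant R (fun t y => complex.Im (H t y))
  (fun t y => - complex.Re (H t y)) (fun t y => complex.Im (W t y)) T (2 * B) _ pi2).
- by move=> r y r0 rT; have [_] := dH_radius y r0 rT; rewrite Im_r.
- move=> r y r0 rT; have [h _] := dH_angle y r0 rT; have := is_deriveN h.
  by rewrite Re_i opprK.
- by move=> r r0 rT y; have [_ h] := dH_angle y r0 rT; exact: is_derive_continuous h.
- by move=> r y r0 rT; apply: le_trans (Im_le_normc _) (W_le _ r0 rT).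
- by move=> r r0 rT; rewrite H_period.
Qed.

Let H_limit e : 0 < e -> exists2 d : R, 0 < d & forall t y : R, 0 < t -> t < d ->
  t < T /\ normc (H t y - D p) <= e.
Proof.
move=> e0; have pT : normc (p - p) < T by rewrite subrr normc0.
have [d d0 hd] := gD pT e0; exists (Num.min d T); first by rewrite lt_min d0.
move=> t y t0; rewrite lt_min => /andP[td tT]; split=> //.
have nt : normc ((t%:C)%C * E y) = t by rewrite normcM normE mulr1 normc_real gtr0_norm.
have := hd ((t%:C)%C * E y); rewrite nt => /(_ td).
have -> : H t y - D p = (g (p + (t%:C)%C * E y) - g p - D p * ((t%:C)%C * E y)) *
   ((cos y -i* sin y)%C * (t^-1%:C)%C).
  rewrite mulrBl; congr (_ - _).
  have e2 : (t%:C)%C * ((t^-1)%:C)%C = 1 by rewrite -rmorphM /= mulfV ?rmorph1// gt_eqF.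
  transitivity (D p * (E y * (cos y -i* sin y)%C) * ((t%:C)%C * ((t^-1)%:C)%C)).
    by rewrite EEc e2 !mulr1.
  ring.
rewrite !normcM normc_real normfV gtr0_norm//.
have -> : normc (cos y -i* sin y)%C = 1 by rewrite /= sqrrN cos2Dsin2 sqrtr1.
by rewrite mul1r ler_pdivrMr.
Qed.

Let mean_limit (f : R -> R -> R) (l : R) :
  (forall t : R, 0 < t -> t < T -> continuous (f t)) ->
  (forall e : R, 0 < e -> exists2 d : R, 0 < d & forall t y : R, 0 < t -> t < d ->
    t < T /\ `|f t y - l| <= e) ->
  (forall s t : R, 0 < s -> s < t -> t < T ->
    \int[mu]_(y in `[0, pi *+ 2]) f t y = \int[mu]_(y in `[0, pi *+ 2]) f s y) ->
  forall t : R, 0 < t -> t < T -> \int[mu]_(y in `[0, pi *+ 2]) f t y = l * (pi *+ 2).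
Proof.
move=> cf fl fc t t0 tT.
have mI : measurable (`[0, pi *+ 2] : set R) by exact: measurable_itv.
have mI2 : fine (mu (`[0, pi *+ 2] : set R)) = pi *+ 2.
  by rewrite lebesgue_measure_itv/= lte_fin pi2 oppr0 adde0.
apply/eqP; rewrite -subr_eq0 -normr_le0; apply/ler_addgt0Pr => e e0; rewrite add0r.
have [d d0 hd] := fl (e / (pi *+ 2)) (divr_gt0 e0 pi2).
pose s := Num.min t d / 2.
have m0 : 0 < Num.min t d by rewrite lt_min t0.
have s0 : 0 < s by rewrite divr_gt0.
have : s < Num.min t d by rewrite ltr_pdivrMr// ltr_pMr// ltr1n.
rewrite lt_min => /andP[st sd]; rewrite (fc s t)//.
have sT : s < T by exact: lt_trans tT.
have ic (k : R) : mu.-integrable `[0, pi *+ 2] (EFin \o (fun=> k)).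
  by apply: continuous_integrable => x; exact: cvg_cst.
have -> : l * (pi *+ 2) = \int[mu]_(y in `[0, pi *+ 2]) (fun=> l) y.
  by rewrite Rintegral_cst// mI2.
have is_ : mu.-integrable `[0, pi *+ 2] (EFin \o f s) by apply/continuous_integrable/cf.
rewrite -RintegralB//; apply: le_trans (le_normr_Rintegral _ _) _ => //.
  apply: (@continuous_integrable R (fun y => f s y - l)) => x.
  by apply: cvgB; [exact: cf|exact: cvg_cst].
have -> : e = \int[mu]_(y in `[0, pi *+ 2]) (fun=> e / (pi *+ 2)) y.
  by rewrite Rintegral_cst// mI2 divfK// gt_eqF.
apply: le_Rintegral => //.
  apply: (@continuous_integrable R (fun y => `|f s y - l|)) => x.
  by apply: cvg_norm; apply: cvgB; [exact: cf|exact: cvg_cst].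
by move=> y _; have [] := hd s y s0 sd.
Qed.

Lemma circle_mean_Re t : 0 < t -> t < T ->
  \int[mu]_(y in `[0, pi *+ 2]) complex.Re (circle_quotient t y) =
  complex.Re (D p) * (pi *+ 2).
Proof.
apply: (@mean_limit (fun t y => complex.Re (H t y))) => [r r0 rT y|e e0|].
- by have [h _] := dH_angle y r0 rT; exact: is_derive_continuous h.
- have [d d0 hd] := H_limit e0; exists d => // r y r0 /(hd r y r0)[? h]; split=> //.
  by rewrite -raddfB; apply: le_trans (Re_le_normc _) h.
- exact: Re_const.
Qed.

Lemma circle_mean_Im t : 0 < t -> t < T ->
  \int[mu]_(y in `[0, pi *+ 2]) complex.Im (circle_quotient t y) =
  complex.Im (D p) * (pi *+ 2).
Proof.
apply: (@mean_limit (fun t y => complex.Im (H t y))) => [r r0 rT y|e e0|].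
- by have [_ h] := dH_angle y r0 rT; exact: is_derive_continuous h.
- have [d d0 hd] := H_limit e0; exists d => // r y r0 /(hd r y r0)[? h]; split=> //.
  by rewrite -raddfB; apply: le_trans (Im_le_normc _) h.
- exact: Im_const.
Qed.

Lemma circle_quotient_continuous t : 0 < t -> t < T ->
  continuous (fun y => complex.Re (circle_quotient t y)) /\
  continuous (fun y => complex.Im (circle_quotient t y)).
Proof.
move=> t0 tT; split => y; have [h1 h2] := dH_angle y t0 tT.
  exact: is_derive_continuous h1.
exact: is_derive_continuous h2.
Qed.

End CauchyFormula.

(** * Lipschitz bound for the derivative and distortion on small discs *)

Section Distortion.
Context {R : realType}.
Notation mu := (@lebesgue_measure R).

(** The mean value theorem is applied to the real and the imaginary part along the segment
    separately; this costs the factor 2. *)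
Lemma mean_value_normc (g D : R[i] -> R[i]) (x y : R[i]) (B : R) :
  (forall s : R, 0 <= s <= 1 -> cdiff g (y + (s%:C)%C * (x - y)) (D (y + (s%:C)%C * (x - y)))) ->
  (forall s : R, 0 <= s <= 1 -> normc (D (y + (s%:C)%C * (x - y))) <= B) ->
  normc (g x - g y) <= 2 * (B * normc (x - y)).
Proof.
move=> gD DB; pose c (s : R) := y + (s%:C)%C * (x - y).
have dc (s : R) : 0 <= s <= 1 -> path_diff (g \o c) s (D (c s) * (x - y)).
  move=> s01; have dt : path_diff (fun r : R => (r%:C)%C) s 1.
    by apply: (path_diff_real (@is_derive_id _ _ s 1)).
  have := path_diff_comp (path_diffD (path_diff_cst y s)
    (path_diffM dt (path_diff_cst (x - y) s))) (gD s s01).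
  by rewrite mul1r mulr0 addr0 add0r.
have c1 : c 1 = x by rewrite /c rmorph1 mul1r addrC subrK.
have c0 : c 0 = y by rewrite /c rmorph0 mul0r addr0.
have bnd (s : R) : 0 <= s <= 1 -> normc (D (c s) * (x - y)) <= B * normc (x - y).
  by move=> s01; rewrite normcM ler_wpM2r ?normc_ge0// DB.
have mvt (f f' : R -> R) : (forall s : R, 0 <= s <= 1 -> is_derive s 1 f (f' s)) ->
    (forall s : R, 0 <= s <= 1 -> `|f' s| <= B * normc (x - y)) ->
    `|f 1 - f 0| <= B * normc (x - y).
  move=> df fB; have [s s01 ->] : exists2 s, s \in `[0, 1] & f 1 - f 0 = f' s * (1 - 0).
    apply: (@MVT_segment R f f' 0 1 ler01).
      by move=> s; rewrite in_itv/= => /andP[s0 s1]; apply: df; rewrite !ltW.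
    apply: derivable_within_continuous => s; rewrite in_itv/= => s01.
    by have [] := df s s01.
  by rewrite subr0 mulr1 fB// -in_itv.
rewrite -c1 -c0; apply: le_trans (normc_le_ReIm _) _.
rewrite mulr_natl mulr2n c1 c0; apply: lerD; rewrite raddfB /= -{1}c1 -{1}c0.
- apply: (mvt (fun s => complex.Re (g (c s))) (fun s => complex.Re (D (c s) * (x - y)))).
    by move=> s /dc[].
  by move=> s s01; apply: le_trans (Re_le_normc _) (bnd _ s01).
- apply: (mvt (fun s => complex.Im (g (c s))) (fun s => complex.Im (D (c s) * (x - y)))).
    by move=> s /dc[].
  by move=> s s01; apply: le_trans (Im_le_normc _) (bnd _ s01).
Qed.

Variables (g D : R[i] -> R[i]) (p : R[i]) (T B : R).
Hypothesis T0 : 0 < T.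
Hypothesis gD : forall z, normc (z - p) < 2 * T -> cdiff g z (D z).
Hypothesis gB : forall x y, normc (x - p) < 2 * T -> normc (y - p) < 2 * T ->
  normc (g x - g y) <= B * normc (x - y).

Let sub_ball (x z : R[i]) : normc (x - p) < T -> normc (z - x) < T -> normc (z - p) < 2 * T.
Proof.
move=> xT zT; apply: le_lt_trans (ler_normc_sub x _ _) _.
by rewrite mulr_natl mulr2n; apply: ltrD.
Qed.

(** [D x] and [D p] are means over circles of the same radius [t = T / 2] about [x] and [p], and the
    two integrands differ by at most [2 B |x - p| / t]. Adding the bounds for the two coordinates
    gives the 8. *)
Lemma derivative_lipschitz (x : R[i]) : normc (x - p) < T ->
  normc (D x - D p) <= 8 * B / T * normc (x - p).
Proof.
move=> xT.
have pT : normc (p - p) < T by rewrite subrr normc0.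
have gDx z : normc (z - x) < T -> cdiff g z (D z) by move=> zT; apply/gD/(sub_ball xT).
have gDp z : normc (z - p) < T -> cdiff g z (D z) by move=> zT; apply/gD/(sub_ball pT).
have gBx y z : normc (y - x) < T -> normc (z - x) < T -> normc (g y - g z) <= B * normc (y - z).
  by move=> yT zT; apply: gB; apply: (sub_ball xT).
have gBp y z : normc (y - p) < T -> normc (z - p) < T -> normc (g y - g z) <= B * normc (y - z).
  by move=> yT zT; apply: gB; apply: (sub_ball pT).
pose t := T / 2.
have t0 : 0 < t by rewrite divr_gt0.
have tT : t < T by rewrite ltr_pdivrMr// ltr_pMr// ltr1n.
have P0 : 0 < pi *+ 2 :> R by rewrite pmulrn_lgt0// pi_gt0.
have qE (y : R) : normc (circle_quotient g x t y - circle_quotient g p t y) <=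
    2 * B * normc (x - p) / t.
  rewrite /circle_quotient; set E := (_ +i* _)%C; set Ec := (_ -i* _)%C.
  have nE : normc ((t%:C)%C * E) = t.
    by rewrite normcM normc_expi mulr1 normc_real gtr0_norm.
  rewrite -mulrBl normcM normcM.
  have -> : normc Ec = 1 by rewrite /= sqrrN cos2Dsin2 sqrtr1.
  rewrite mul1r normc_real normfV gtr0_norm// ler_wpM2r ?invr_ge0 ?(ltW t0)//.
  have -> : g (x + (t%:C)%C * E) - g x - (g (p + (t%:C)%C * E) - g p) =
    (g (x + (t%:C)%C * E) - g (p + (t%:C)%C * E)) - (g x - g p) by ring.
  apply: le_trans (ler_normcB _ _) _; rewrite -mulrA mulr_natl mulr2n; apply: lerD.
    apply: le_trans (gB _ _) _.
    - by apply: (sub_ball xT); rewrite addrAC subrr add0r nE.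
    - by apply: (sub_ball pT); rewrite addrAC subrr add0r nE.
    - by rewrite opprD addrACA subrr addr0.
  by apply: gB; [apply: (sub_ball xT)|apply: (sub_ball pT)]; rewrite ?subrr ?normc0.
have [cRx cIx] := circle_quotient_continuous gDx t0 tT.
have [cRp cIp] := circle_quotient_continuous gDp t0 tT.
have mI : measurable (`[0, pi *+ 2] : set R) by exact: measurable_itv.
have mI2 : fine (mu (`[0, pi *+ 2] : set R)) = pi *+ 2.
  by rewrite lebesgue_measure_itv/= lte_fin P0 oppr0 adde0.
have key (u v : R -> R) (a b : R) : continuous u -> continuous v ->
    (forall y, `|u y - v y| <= 2 * B * normc (x - p) / t) ->
    \int[mu]_(y in `[0, pi *+ 2]) u y = a * (pi *+ 2) ->
    \int[mu]_(y in `[0, pi *+ 2]) v y = b * (pi *+ 2) ->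
    `|a - b| <= 2 * B * normc (x - p) / t.
  move=> cu cv uv ia ib; rewrite -(ler_pM2r P0).
  have -> : `|a - b| * (pi *+ 2) = `|\int[mu]_(y in `[0, pi *+ 2]) (u y - v y)|.
    rewrite RintegralB//; [|exact: continuous_integrable..].
    by rewrite ia ib -mulrBl normrM (gtr0_norm P0).
  apply: le_trans (le_normr_Rintegral _ _) _ => //.
    apply: (@continuous_integrable R (fun y => u y - v y)) => z.
    by apply: cvgB; [exact: cu|exact: cv].
  have -> : 2 * B * normc (x - p) / t * (pi *+ 2) =
      \int[mu]_(y in `[0, pi *+ 2]) (fun=> 2 * B * normc (x - p) / t) y.
    by rewrite Rintegral_cst// mI2.
  apply: le_Rintegral => //.
  - apply: (@continuous_integrable R (fun y => `|u y - v y|)) => z.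
    by apply: cvg_norm; apply: cvgB; [exact: cu|exact: cv].
  - by apply: continuous_integrable => z; exact: cvg_cst.
have kR := key _ _ _ _ cRx cRp (fun y => le_trans (_ : _ <= _) (qE y))
  (circle_mean_Re T0 gDx gBx t0 tT) (circle_mean_Re T0 gDp gBp t0 tT).
have kI := key _ _ _ _ cIx cIp (fun y => le_trans (_ : _ <= _) (qE y))
  (circle_mean_Im T0 gDx gBx t0 tT) (circle_mean_Im T0 gDp gBp t0 tT).
apply: le_trans (normc_le_ReIm _) _; rewrite !raddfB /=.
apply: le_trans (lerD (kR _) (kI _)) _.
- by move=> y; rewrite -raddfB; exact: Re_le_normc.
- by move=> y; rewrite -raddfB; exact: Im_le_normc.
- by rewrite /t; apply/eq_ler; field; rewrite gt_eqF.
Qed.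

(** The mean value estimate for [g z - D p * z], whose derivative [D z - D p] is at most [8 B r / T]
    on the disc of radius [r]. *)
Lemma holomorphic_distortion (r : R) (x y : R[i]) : r <= T ->
  normc (x - p) < r -> normc (y - p) < r ->
  normc (g x - g y - D p * (x - y)) <= 16 * B / T * r * normc (x - y).
Proof.
move=> rT xr yr.
have seg (s : R) : 0 <= s <= 1 -> normc (y + (s%:C)%C * (x - y) - p) < r.
  move=> /andP[s0 s1].
  have -> : y + (s%:C)%C * (x - y) - p = (s%:C)%C * (x - p) + ((1 - s)%:C)%C * (y - p).
    by rewrite rmorphB rmorph1; ring.
  apply: le_lt_trans (le_normcD _ _) _.
  rewrite !normcM !normc_real !ger0_norm ?subr_ge0//.
  have [->|s1'] := eqVneq s 1; first by rewrite subrr mul0r mul1r addr0.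
  have : (1 - s) * normc (y - p) < (1 - s) * r by rewrite ltr_pM2l// subr_gt0 lt_neqAle s1'.
  have : s * normc (x - p) <= s * r by rewrite ler_wpM2l// ltW.
  lra.
pose F z := g z - D p * z.
have -> : g x - g y - D p * (x - y) = F x - F y by rewrite /F; ring.
have r0 : 0 < r by apply: le_lt_trans xr; exact: normc_ge0.
have B0 : 0 <= B.
  have r20 : 0 < r / 2 by rewrite divr_gt0.
  have h1 : normc ((r / 2)%:C)%C = r / 2 by rewrite normc_real gtr0_norm.
  have r2T : r / 2 < 2 * T by lra.
  have := gB (x := p + ((r / 2)%:C)%C) (y := p).
  rewrite addrAC subrr add0r normc0 h1 => /(_ r2T) /(_ _)/wrap[]; first by rewrite mulr_gt0.
  by move=> h; rewrite -(pmulr_lge0 _ r20) (le_trans _ h)// normc_ge0.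
apply: le_trans (@mean_value_normc F (fun z => D z - D p) x y (8 * B / T * r) _ _) _.
- move=> s /seg sr e e0; have sT : normc (y + (s%:C)%C * (x - y) - p) < 2 * T.
    by apply: lt_trans sr _; lra.
  have [d d0 hd] := gD sT e0.
  exists d => // h /hd; congr (normc _ <= _); rewrite /F; ring.
- move=> s /seg sr; apply: le_trans (derivative_lipschitz (lt_le_trans sr rT)) _.
  by rewrite ler_wpM2l ?(ltW sr)// divr_ge0 ?(ltW T0)// mulr_ge0.
- by apply/eq_ler; field; rewrite gt_eqF.
Qed.

End Distortion.

(** * Hausdorff measure *)

Section SmallCovers.
Context {R : realType} {T : Type} (d : T -> T -> R).
Implicit Types (s : R) (E : set T).

(** Finite covers, with upper bounds [r i] for the diameters as part of the data. They force measure
    zero; the positivity of [r i] keeps the powers away from base 0. *)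
Definition small_cover s E : Prop := forall e : R, 0 < e ->
  exists (I : finType) (V : I -> set T) (r : I -> R),
  [/\ forall x, E x -> exists i, V i x,
      forall i, 0 < r i <= e,
      forall i x y, V i x -> V i y -> d x y <= r i
    & \sum_i (r i) `^ s <= e].

Lemma diam_ge0 E : (0 <= diam d E)%E.
Proof. by apply: ereal_sup_ubound; left. Qed.

Lemma diam_le E (r : R) : 0 <= r -> (forall x y, E x -> E y -> d x y <= r) ->
  (diam d E <= r%:E)%E.
Proof.
move=> r0 h; apply: ge_ereal_sup => _ [->|[[x y] [/= Ex Ey] <-]]; rewrite lee_fin//.
exact: h.
Qed.

Lemma dist_le_diam E x y : E x -> E y -> ((d x y)%:E <= diam d E)%E.
Proof. by move=> Ex Ey; apply: ereal_sup_ubound; right; exists (x, y). Qed.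

Lemma diam_set0 : diam d set0 = 0%E.
Proof. by apply/eqP; rewrite eq_le diam_ge0 diam_le. Qed.

Lemma gauge_ge0 s E : (0 <= gauge d s E)%E.
Proof. by rewrite /gauge; case: ifP => // _; exact: poweR_ge0. Qed.

Lemma gauge_le s E (r : R) : 0 <= s -> 0 <= r -> (diam d E <= r%:E)%E ->
  (gauge d s E <= (r `^ s)%:E)%E.
Proof.
move=> s0 r0 h; rewrite /gauge; case: ifP => _; first by rewrite lee_fin powR_ge0.
rewrite -poweR_EFin; by apply: gt0_ler_poweR => //; rewrite in_itv/= ?diam_ge0 ?lee_fin ?r0 ?leey.
Qed.

Lemma small_cover_measure s E : 0 <= s -> small_cover s E ->
  hausdorff_measure d s E = 0%E.
Proof.
move=> s0 sc; apply/eqP; rewrite eq_le; apply/andP; split; last first.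
  apply: (@le_trans _ _ (hausdorff_premeasure d s 1 E)); last first.
    by apply: ereal_sup_ubound; exists 1 => //=.
  apply: le_ereal_inf_tmp => _ [V _ <-]; apply: nneseries_ge0 => n _ _; exact: gauge_ge0.
apply: ge_ereal_sup => _ [dl /= dl0 <-]; apply/lee_addgt0Pr => e e0; rewrite add0e.
have m0 : 0 < Num.min e dl by rewrite lt_min e0.
have [I [V [r [EV re dV sr]]]] := sc _ m0.
(* Beyond the finite index set the sequence is filled with empty sets, whose gauge is 0. *)
pose W n := if insub n is Some i then V (enum_val (i : 'I_#|I|)) else set0.
have Wn0 n : (#|I| <= n)%N -> W n = set0.
  by move=> h; rewrite /W insubN// -leqNgt.
have Wi (i : 'I_#|I|) : W i = V (enum_val i).
  by rewrite /W insubT//= => hi; congr (V (enum_val _)); apply/val_inj.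
apply: (@le_trans _ _ (\sum_(0 <= n <oo) gauge d s (W n))%E).
  apply: ereal_inf_lbound; exists W => //; split.
    move=> x /EV[i Vix]; exists (enum_rank i) => //.
    by rewrite -[X in W X]/(nat_of_ord (enum_rank i)) Wi enum_rankK.
  move=> n; have [ni|ni] := ltnP n #|I|; last by rewrite Wn0// diam_set0 lee_fin ltW.
  rewrite -[n]/(nat_of_ord (Ordinal ni)) Wi.
  have /andP[ri0 rie] := re (enum_val (Ordinal ni)).
  apply: (@le_trans _ _ (r (enum_val (Ordinal ni)))%:E).
    by apply: diam_le; [exact: ltW|move=> x y; exact: dV].
  by rewrite lee_fin (le_trans rie)// ge_min lexx orbT.
rewrite (@nneseries_split _ _ 0 #|I|); last by move=> k _; exact: gauge_ge0.
rewrite eseries0; last by move=> i + _ => /Wn0 ->; rewrite /gauge eqxx.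
rewrite adde0 big_mkord.
apply: (@le_trans _ _ (\sum_(i < #|I|) ((r (enum_val i)) `^ s)%:E)%E).
  apply: lee_sum => i _; rewrite Wi; have /andP[ri0 _] := re (enum_val i).
  apply: gauge_le; [by []|exact: ltW|apply: diam_le; [exact: ltW|move=> x y; exact: dV]].
rewrite sumEFin lee_fin; apply: le_trans (_ : Num.min e dl <= e); last first.
  by rewrite ge_min lexx.
apply: le_trans sr; rewrite le_eqVlt; apply/orP; left; apply/eqP.
rewrite (reindex (@enum_val I I)) //=.
by apply: onW_bij; exact: enum_val_bij.
Qed.

Lemma small_cover_dim s E : 0 <= s -> small_cover s E ->
  (hausdorff_dim d E <= s%:E)%E.
Proof.
move=> s0 sc; apply: ereal_inf_lbound; exists s => //; split=> //.
exact: small_cover_measure.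
Qed.

Lemma small_cover_bigcup s (J : finType) (F : J -> set T) :
  (forall j, small_cover s (F j)) -> small_cover s [set x | exists j, F j x].
Proof.
move=> sc e e0; have n0 : 0 < (#|J|.+1)%:R :> R by rewrite ltr0n.
pose e' := e / (#|J|.+1)%:R.
have e'0 : 0 < e' by rewrite divr_gt0.
have e'e : e' <= e by rewrite ler_pdivrMr// ler_peMr ?(ltW e0)// ler1n.
pose G j (I : finType) := exists (V : I -> set T) (r : I -> R),
  [/\ forall x, F j x -> exists i, V i x, forall i, 0 < r i <= e',
      forall i x y, V i x -> V i y -> d x y <= r i & \sum_i (r i) `^ s <= e'].
have /choice[I hI] : forall j, exists I, G j I by move=> j; exact: sc.
pose V j := projT1 (cid (hI j)); pose r j := projT1 (cid (projT2 (cid (hI j)))).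
have hVr j : [/\ forall x, F j x -> exists i, V j i x, forall i, 0 < r j i <= e',
      forall i x y, V j i x -> V j i y -> d x y <= r j i & \sum_i (r j i) `^ s <= e'].
  exact: (projT2 (cid (projT2 (cid (hI j))))).
exists {j : J & I j}, (fun p => V (tag p) (tagged p)), (fun p => r (tag p) (tagged p)).
split.
- by move=> x [j Fjx]; have [/(_ x Fjx)[i Vi] _ _ _] := hVr j; exists (Tagged I i).
- by move=> [j i] /=; have [_ /(_ i)/andP[-> h] _ _] := hVr j; rewrite (le_trans h).
- by move=> [j i] /=; have [_ _ + _] := hVr j; apply.
- rewrite -(@sig_big_dep _ _ _ J I xpredT (fun _ => xpredT) (fun j i => (r j i) `^ s)).
  apply: (@le_trans _ _ (\sum_(j : J) e')).
    by apply: ler_sum => j _; have [_ _ _] := hVr j.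
  rewrite sumr_const -mulr_natr /e' mulrAC ler_pdivrMr// ler_pM2l// ler_nat.
  exact: leqnSn.
Qed.

Lemma small_cover_sub s E F : E `<=` F -> small_cover s F -> small_cover s E.
Proof.
move=> EF sc e e0; have [I [V [r [FV re dV sr]]]] := sc e e0.
by exists I, V, r; split=> // x /EF; exact: FV.
Qed.

End SmallCovers.

Lemma small_cover_expanding (R : realType) (T T' : Type) (d : T -> T -> R)
    (d' : T' -> T' -> R) (s C : R) (f : T -> T') (E : set T) (G : set T') :
  0 <= s -> 0 < C -> (forall x, E x -> G (f x)) ->
  (forall x y, E x -> E y -> d x y <= C * d' (f x) (f y)) ->
  small_cover d' s G -> small_cover d s E.
Proof.
move=> s0 C0 fG fC sc e e0.
have Cs0 : 0 < C `^ s by exact: powR_gt0.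
pose e' := Num.min (e / C) (e / C `^ s).
have e'0 : 0 < e' by rewrite lt_min !divr_gt0.
have [I [V [r [GV re dV sr]]]] := sc e' e'0.
exists I, (fun i => E `&` f @^-1` (V i)), (fun i => C * r i); split.
- by move=> x Ex; have [i Vi] := GV _ (fG x Ex); exists i.
- move=> i; have /andP[r0 r1] := re i; rewrite mulr_gt0//= mulrC -ler_pdivlMr//.
  by apply: le_trans r1 _; rewrite ge_min lexx.
- move=> i x y [Ex Vx] [Ey Vy]; apply: le_trans (fC _ _ Ex Ey) _.
  by rewrite ler_pM2l//; exact: dV Vx Vy.
- under eq_bigr => i _.
    have /andP[r0 _] := re i; rewrite powRM ?(ltW C0) ?(ltW r0)//.
    over.
  rewrite -mulr_sumr mulrC -ler_pdivlMr//.
  by apply: le_trans sr _; rewrite ge_min lexx orbT.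
Qed.

(** * Positive measure of images of regular trees *)

Section DigitTree.
Context {R : realType}.
Notation mu := (@lebesgue_measure R).

Lemma expr_lt_eps (q e : R) : 0 <= q < 1 -> 0 < e -> exists n, q ^+ n < e.
Proof.
move=> /andP[q0 q1] e0; have qn : `|q| < 1 by rewrite ger0_norm.
have /cvgrPdist_lt/(_ e e0)[n _ /(_ n)/= h] := cvg_expr qn.
by exists n; move: (h (leqnn n)); rewrite sub0r normrN ger0_norm// exprn_ge0.
Qed.

Lemma natr_expr_ge (q B : R) : 1 < q -> exists n, B <= q ^+ n.
Proof.
move=> q1; have q0 : 0 < q by apply: lt_trans q1.
have [B0|B0] := leP B 0; first by exists 0%N; rewrite (le_trans B0)// expr0.
have [||n hn] := @expr_lt_eps q^-1 B^-1; first by rewrite invr_ge0 (ltW q0) invf_lt1.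
  by rewrite invr_gt0.
by exists n; move: hn; rewrite exprVn ltf_pV2 ?posrE ?exprn_gt0// => /ltW.
Qed.

Lemma powR_exprn (x r : R) (k : nat) : 0 <= x -> (x ^+ k) `^ r = (x `^ r) ^+ k.
Proof.
move=> x0; elim: k => [|k IH]; first by rewrite !expr0 powR1.
by rewrite !exprS powRM ?exprn_ge0// IH.
Qed.

Variables (m : nat) (m1 : (1 < m)%N).

Let digit (x : R) (j : nat) : 'I_m :=
  Ordinal (ltn_pmod (Num.truncn (x * (m ^ j.+1)%:R)) (ltn_trans (ltn0Sn 0) m1)).

Let truncn_digit (x : R) (j : nat) : 0 <= x ->
  Num.truncn (x * (m ^ j.+1)%:R) = (Num.truncn (x * (m ^ j)%:R) * m + digit x j)%N.
Proof.
move=> x0; rewrite /digit /=.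
set N := Num.truncn (x * (m ^ j.+1)%:R).
rewrite {1}(divn_eq N m); congr (_ * _ + _)%N; apply/esym/truncn_def.
have m0 : 0 < m%:R :> R by rewrite ltr0n ltnW.
have y0 : 0 <= x * (m ^ j.+1)%:R by rewrite mulr_ge0.
have /andP[] := truncn_itv y0; rewrite -/N expnSr natrM mulrA => h1 h2.
apply/andP; split.
  rewrite -(ler_pM2r m0); apply: le_trans h1; rewrite -natrM ler_nat.
  exact: leq_divM.
rewrite -(ltr_pM2r m0); apply: lt_le_trans h2 _; rewrite -natrM ler_nat.
by rewrite ltn_ceil// ltnW.
Qed.

Let digit_interval (x y : R) (k : nat) : 0 <= x < 1 -> 0 <= y < 1 ->
  (forall j, (j < k)%N -> digit x j = digit y j) ->
  Num.truncn (x * (m ^ k)%:R) = Num.truncn (y * (m ^ k)%:R).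
Proof.
move=> /andP[x0 x1] /andP[y0 y1]; elim: k => [_|k IH h].
  by rewrite expn0 !mulr1 (@truncn_def _ x 0) ?x0// (@truncn_def _ y 0) ?y0.
rewrite !truncn_digit// IH; last by move=> j jk; apply/h/ltnW.
by rewrite h.
Qed.

Variables (T : Type) (d : T -> T -> R) (E : set T) (e : (nat -> 'I_m) -> T).
Variables (Q s c : R).
Hypothesis Q01 : 0 < Q < 1.
Hypothesis c0 : 0 < c.
Hypothesis mQ : 1 <= m%:R * Q `^ s.
Hypothesis eE : forall b, E (e b).
Hypothesis sep : forall k b b', (forall i, (i < k)%N -> b i = b' i) -> b k != b' k ->
  c * Q ^+ k <= d (e b) (e b').

(** Points whose digits first differ at place [j] are at least [c Q^j] apart. So points of [V] share
    all digits before the first [k] with [c Q^k <= diam V], and their preimages lie in one interval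
    of length [m^-k <= Q^(ks) <= (diam V / c)^s]. The exponent may be lowered to [t] as the diameter
    is at most 1; [eta] takes care of diameter 0. *)
Let preimage_interval (t : R) (V : set T) (eta : R) : 0 <= t <= s -> 0 < eta ->
  (diam d V <= 1)%E -> exists a l : R, [/\ 0 <= l,
    forall x : R, 0 <= x < 1 -> V (e (digit x)) -> a <= x <= a + l &
    (l%:E <= (c^-1 `^ s)%:E * gauge d t V + eta%:E)%E].
Proof.
move=> /andP[t0 ts] eta0 V1.
have cs0 : 0 <= c^-1 `^ s by exact: powR_ge0.
have [[x0 [x01 Vx0]]|nV] := pselect (exists x : R, 0 <= x < 1 /\ V (e (digit x))); last first.
  exists 0, 0; split => //.
    by move=> x x01 Vx; exfalso; apply: nV; exists x.
  apply: adde_ge0; last by rewrite lee_fin ltW.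
  by rewrite mule_ge0// gauge_ge0.
have m0 : 0 < m%:R :> R by rewrite ltr0n ltnW.
have mk0 k : 0 < (m ^ k)%:R :> R by rewrite ltr0n expn_gt0 ltnW.
pose a (k : nat) : R := (Num.truncn (x0 * (m ^ k)%:R))%:R / (m ^ k)%:R.
have mem k (D : R) : (forall y z, V y -> V z -> d y z <= D) ->
    (forall j, (j < k)%N -> D < c * Q ^+ j) ->
    forall x : R, 0 <= x < 1 -> V (e (digit x)) ->
    a k <= x <= a k + (m ^ k)%:R^-1.
  move=> VD Dk x x1 Vx.
  have dE j : (j < k)%N -> digit x j = digit x0 j.
    elim/ltn_ind: j => j IH jk; apply/eqP/negPn/negP => ne.
    have := sep (fun i ij => IH i ij (ltn_trans ij jk)) ne.
    by apply/negP; rewrite -ltNge (le_lt_trans (VD _ _ Vx Vx0))// Dk.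
  have E1 := digit_interval x1 x01 dE.
  have y0 : 0 <= x * (m ^ k)%:R by case/andP: x1 => ? _; rewrite mulr_ge0.
  have := truncn_itv y0; rewrite E1 => /andP[h1 h2].
  rewrite /a ler_pdivrMr// h1/= -[X in _ + X]mul1r -mulrDl ler_pdivlMr//.
  by rewrite natr1 ltW.
have [r Vr] : exists r : R, diam d V = r%:E.
  have := diam_ge0 d V; case: (diam d V) V1 => // r _ _; by exists r.
have VD y z : V y -> V z -> d y z <= r.
  by move=> Vy Vz; rewrite -lee_fin -Vr; exact: dist_le_diam.
have r0 : 0 <= r by rewrite -lee_fin -Vr diam_ge0.
have r1 : r <= 1 by rewrite -lee_fin -Vr.
have [Q0 Q1] := andP Q01.
have gV : gauge d t V = (r `^ t)%:E.
  rewrite /gauge; case: ifPn => [/eqP V0|_]; first by move: Vx0; rewrite V0.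
  by rewrite Vr poweR_EFin.
have [r00|rn0] := eqVneq r 0.
  have [k hk] : exists k, eta^-1 <= m%:R ^+ k by apply: natr_expr_ge; rewrite ltr1n.
  exists (a k), (m ^ k)%:R^-1; split.
  - by rewrite invr_ge0.
  - by apply: (mem k r) => // j _; rewrite r00 mulr_gt0// exprn_gt0.
  - apply: (@le_trans _ _ eta%:E).
      by rewrite lee_fin invf_ple ?posrE// natrX.
    by rewrite leeDr// mule_ge0// gauge_ge0.
have rp : 0 < r by rewrite lt_neqAle eq_sym rn0.
have ex : exists k, c * Q ^+ k <= r.
  have Q01' : 0 <= Q < 1 by rewrite (ltW Q0).
  have [k hk] := expr_lt_eps Q01' (divr_gt0 rp c0).
  by exists k; rewrite mulrC -ler_pdivlMr// ltW.
case: (ex_minnP ex) => k ck kmin.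
exists (a k), (m ^ k)%:R^-1; split.
- by rewrite invr_ge0.
- apply: (mem k r) => // j jk; rewrite ltNge; apply/negP => /kmin.
  by rewrite leqNgt jk.
- apply: (@le_trans _ _ ((c^-1 `^ s)%:E * gauge d t V)%E); last by rewrite leeDl// lee_fin ltW.
  rewrite gV -EFinM lee_fin.
  have s0 : 0 <= s by apply: le_trans ts.
  apply: (@le_trans _ _ ((c^-1 * r) `^ s)); last first.
    rewrite powRM ?invr_ge0 ?(ltW c0)// ler_wpM2l//.
    by apply: ger_powR => //; rewrite rp.
  apply: (@le_trans _ _ ((Q ^+ k) `^ s)); last first.
    apply: ge0_ler_powR => //; rewrite ?nnegrE ?exprn_ge0 ?(ltW Q0)//.
      by rewrite mulr_ge0// invr_ge0 ltW.
    by rewrite ler_pdivlMl.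
  rewrite powR_exprn ?(ltW Q0)//.
  rewrite natrX -exprVn; apply: lerXn2r; rewrite ?nnegrE ?powR_ge0 ?invr_ge0//.
  by rewrite -[m%:R^-1]mul1r ler_pdivrMr// mulrC.
Qed.

(* Digit expansions in base [m] pull a cover of [E] back to a cover of [0, 1[ by
   sets of diameter comparable to the [s]-th powers, to which the countable
   subadditivity of the Lebesgue measure applies. *)
Lemma hausdorff_measure_tree (t : R) : 0 <= t <= s -> hausdorff_measure d t E != 0%E.
Proof.
move=> ts; apply/eqP => H0.
pose C := c^-1 `^ s.
have C0 : 0 < C by rewrite powR_gt0// invr_gt0.
(* A cover of this weight pulls back to intervals of total length at most [1/4]; with another [1/4]
   for the errors [eta n] this is less than the length 1 of [[0, 1[]. *)
have e0 : 0 < (4 * C)^-1 by rewrite invr_gt0 mulr_gt0.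
have : (hausdorff_premeasure d t 1 E < (4 * C)^-1%:E)%E.
  apply: (@le_lt_trans _ _ 0%E); last by rewrite lte_fin.
  by rewrite -H0; apply: ereal_sup_ubound; exists 1 => //=.
move=> /ereal_inf_lt[_ [V [EV V1] <-]] sV.
have g0 n : (0 <= gauge d t (V n))%E by exact: gauge_ge0.
pose eta (n : nat) : R := 4^-1 / (2 ^ n.+1)%:R.
have eta0 n : 0 < eta n by rewrite divr_gt0 ?invr_gt0// ltr0n expn_gt0.
have /choice[a /choice[l al]] : forall n, exists a l : R, [/\ 0 <= l,
    forall x : R, 0 <= x < 1 -> V n (e (digit x)) -> a <= x <= a + l &
    (l%:E <= (c^-1 `^ s)%:E * gauge d t (V n) + (eta n)%:E)%E].
  by move=> n; apply: preimage_interval => //; exact: V1.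
have cover : [set` `[0 : R, 1[] `<=` \bigcup_n [set` `[a n, a n + l n]].
  move=> x /=; rewrite in_itv/= => x01.
  have [n _ Vn] := EV _ (eE (digit x)).
  exists n => //=; rewrite in_itv/=; have [_ h _] := al n; exact: h.
have : (mu [set` `[0%R : R, 1%R[] <= \sum_(0 <= n <oo) mu [set` `[a n, (a n + l n)%R]])%E.
  apply: measure_sigma_subadditive => // n; exact: measurable_itv.
rewrite lebesgue_measure_itv/= lte_fin ltr01 oppr0 adde0; apply/negP; rewrite -ltNge.
apply: (@le_lt_trans _ _ (\sum_(0 <= n <oo) (C%:E * gauge d t (V n) + (eta n)%:E))%E).
  apply: lee_nneseries => [n _ _|n _]; first exact: measure_ge0.
  have [l0 _] := al n; apply: le_trans.
  rewrite lebesgue_measure_itv/= lte_fin; case: ifPn => _; last by rewrite lee_fin.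
  by rewrite -EFinD lee_fin addrAC subrr add0r.
apply: (@le_lt_trans _ _ (\sum_(0 <= n <oo) C%:E * gauge d t (V n) + (4^-1)%:E)%E).
  apply: epsilon_trick => [n|]; last by rewrite invr_ge0.
  by rewrite mule_ge0// lee_fin ltW.
rewrite nneseriesZl; last by move=> n _; exact: g0.
apply: (@le_lt_trans _ _ ((4^-1)%:E + (4^-1)%:E)%E).
  apply: leeD => //; apply: (@le_trans _ _ (C%:E * (4 * C)^-1%:E)%E).
    by apply: lee_wpmul2l; [rewrite lee_fin ltW|exact: ltW].
  by rewrite -EFinM lee_fin invfM mulrCA mulfV ?mulr1// gt_eqF.
by rewrite -EFinD lte_fin; lra.
Qed.

End DigitTree.

(** * Separated projections *)

Section SeparatedTrees.
Context {R : realType}.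

(* By double counting, [Z v] is for some [v] at least the sum of the left-hand
   terms over the closed neighbourhood of [v]: put [v] in [I], delete its
   neighbourhood and repeat. *)
Lemma weighted_independent_set (V : finType) (e : rel V) (Z : V -> R) :
  symmetric e -> (forall v, 0 <= Z v) ->
  exists I : {set V}, {in I &, forall u v, u != v -> ~~ e u v} /\
    \sum_v Z v / #|[set u | (u == v) || e v u]%SET|%:R <= \sum_(v in I) Z v.
Proof.
move=> esym Z0.
pose N v := [set u | (u == v) || e v u]%SET.
have NC u v : (u \in N v) = (v \in N u) by rewrite !inE eq_sym esym.
have N0 v : 0 < #|N v|%:R :> R.
  by rewrite ltr0n card_gt0; apply/finset.set0Pn; exists v; rewrite inE eqxx.
have W0 v : 0 <= Z v / #|N v|%:R by rewrite divr_ge0 ?(ltW (N0 v)).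
have main n (A : {set V}) : (#|A| <= n)%N ->
    exists I : {set V}, [/\ I \subset A, {in I &, forall u v, u != v -> ~~ e u v} &
      \sum_(v in A) Z v / #|N v|%:R <= \sum_(v in I) Z v].
  elim: n A => [|n IH] A An.
    have -> : A = finset.set0 by apply/eqP; rewrite -cards_eq0 -leqn0.
    exists finset.set0; split; rewrite ?finset.sub0set ?big_set0//.
    by move=> u v; rewrite inE.
  have [->|[a aA]] := set_0Vmem A.
    exists finset.set0; split; rewrite ?finset.sub0set ?big_set0//.
    by move=> u v; rewrite inE.
  have [v vA hv] : exists2 v, v \in A &
      \sum_(u in A | u \in N v) Z u / #|N u|%:R <= Z v.
    apply: contrapT => nex.
    suff : \sum_(v in A) Z v < \sum_(v in A) Z v by rewrite ltxx.
    apply: (@lt_le_trans _ _ (\sum_(v in A) \sum_(u in A | u \in N v) Z u / #|N u|%:R)).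
      apply: ltr_sum; first by apply/hasP; exists a; rewrite ?mem_index_enum.
      move=> v vA; rewrite ltNge; apply/negP => h; apply: nex; by exists v.
    rewrite (exchange_big_dep (mem A)) /=; last by move=> ? ? _ /andP[].
    apply: ler_sum => u uA.
    rewrite (eq_bigl (fun v => v \in A :&: N u)); last first.
      by move=> v; rewrite !inE uA /= eq_sym esym.
    rewrite sumr_const -(mulr_natr (Z u / _)) mulrAC ler_pdivrMr// ler_wpM2l// ler_nat.
    exact/subset_leq_card/finset.subsetIr.
  have An' : (#|A :\: N v| <= n)%N.
    rewrite -ltnS; apply: leq_trans An; apply: proper_card.
    apply/properP; split; first exact: finset.subsetDl.
    by exists v => //; rewrite !inE eqxx.
  have [I [IA Ie hI]] := IH _ An'.
  have vI : v \notin I by apply/negP => /(fintype.subsetP IA); rewrite !inE eqxx.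
  have vIe u : u \in I -> ~~ e v u.
    by move=> /(fintype.subsetP IA); rewrite !inE negb_or => /andP[/andP[]].
  exists (v |: I); split.
  - by rewrite finset.subUset finset.sub1set vA (fintype.subset_trans IA)// finset.subsetDl.
  - move=> u w; rewrite !inE => /predU1P[->|uI] /predU1P[->|wI].
    + by rewrite eqxx.
    + by move=> _; exact: vIe.
    + by move=> _; rewrite esym; exact: vIe.
    + exact: Ie.
  - rewrite big_setU1//= (bigID (mem (N v))) /=; apply: lerD => //.
    rewrite (eq_bigl (fun u => u \in A :\: N v))// => u.
    by rewrite !inE andbC.
have [I [_ Ie hI]] := main #|V| finset.setT (max_card _).
exists I; split=> //; apply: le_trans hI.
by rewrite le_eqVlt; apply/orP; left; apply/eqP/eq_bigl => v; rewrite inE.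
Qed.

(** Jensen's inequality for the logarithm, from its tangent at [Y]: [ln y <= ln Y + (y / Y - 1)]. *)
Lemma sum_ln_le (U : finType) (y : U -> R) (Y : R) : 0 < Y ->
  (forall u, 0 < y u) -> \sum_u y u <= Y * #|U|%:R ->
  \sum_u ln (y u) <= ln Y * #|U|%:R.
Proof.
move=> Y0 y0 yY.
have h u : ln (y u) <= ln Y + (y u / Y - 1).
  have p : 0 < y u / Y by rewrite divr_gt0.
  have E : Y * (1 + (y u / Y - 1)) = y u by field; rewrite gt_eqF.
  rewrite -{1}E lnM ?posrE//; last by rewrite addrC subrK.
  by rewrite lerD2l; apply: le_ln1Dx; lra.
apply: le_trans (ler_sum _ (fun u _ => h u)) _.
rewrite big_split /= sumr_const -(mulr_natr (ln Y)) gerDl.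
rewrite big_split /= sumr_const -mulr_suml mulNrn subr_le0.
by rewrite ler_pdivrMr// mulrC.
Qed.

Variables (V D : finType) (coll : D -> seq V -> rel V) (K : R).
Hypothesis V0 : (0 < #|V|)%N.
Hypothesis D0 : (0 < #|D|)%N.
Hypothesis K0 : 0 < K.
Hypothesis coll_sym : forall t sigma, symmetric (coll t sigma).

Let deg t sigma v := #|[set u | (u == v) || coll t sigma v u]%SET|.

Hypothesis coll_le : forall sigma,
  \sum_t \sum_v (deg t sigma v)%:R <= K * #|D|%:R * #|V|%:R ^+ 2.

Definition separated_words (t : D) (sigma : seq V) (T : seq (seq V)) : Prop :=
  forall tau tau', tau \in T -> tau' \in T -> tau != tau' ->
  exists rho v v' w w', [/\ tau = rho ++ v :: w, tau' = rho ++ v' :: w', v != v' &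
    ~~ coll t (sigma ++ rho) v v'].

Let NV : 0 < #|V|%:R :> R. Proof. by rewrite ltr0n. Qed.

(** The size is bounded on the logarithmic scale, on which the contributions of the levels add up
    and can be averaged over [t]. *)
Let has_tree t sigma n (x : R) := exists T : seq (seq V),
  [/\ uniq T, {in T, forall tau, size tau = n}, separated_words t sigma T,
      (0 < size T)%N & x <= ln (size T)%:R].

Let deg_gt0 t sigma v : 0 < (deg t sigma v)%:R :> R.
Proof. by rewrite ltr0n card_gt0; apply/finset.set0Pn; exists v; rewrite inE eqxx. Qed.

(** The first letters are chosen by [weighted_independent_set] with the sizes of the subtrees as
    weights. Concavity of the logarithm turns the resulting sum into a mean over all first
    letters. *)
Let has_treeS t sigma n (x : V -> R) :
  (forall v, has_tree t (rcons sigma v) n (x v)) ->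
  has_tree t sigma n.+1
    (#|V|%:R^-1 * \sum_v (x v + ln #|V|%:R - ln (deg t sigma v)%:R)).
Proof.
move=> /choice[T hT]; pose Z v : R := (size (T v))%:R.
have Z0 v : 0 < Z v by have [_ _ _ h _] := hT v; rewrite ltr0n.
have [I [Ie hI]] := weighted_independent_set (coll_sym t sigma) (fun v => ltW (Z0 v)).
pose TT := [seq v :: tau | v <- enum I, tau <- T v].
have sTT : (size TT)%:R = \sum_(v in I) Z v.
  rewrite size_allpairs_dep sumnE big_map natr_sum big_enum //.
have xT : #|V|%:R^-1 * \sum_v (x v + ln #|V|%:R - ln (deg t sigma v)%:R) <=
   ln (\sum_v Z v / (deg t sigma v)%:R).
  (* Normalised so that the mean of [y] over [V] is [Y]. *)
  pose y v := #|V|%:R * (Z v / (deg t sigma v)%:R).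
  have y0 v : 0 < y v by rewrite mulr_gt0// divr_gt0.
  pose Y := \sum_v Z v / (deg t sigma v)%:R.
  have Y0 : 0 < Y.
    have /card_gt0P[v _] := V0; rewrite /Y (bigD1 v)//=.
    apply: ltr_pwDl; first by rewrite divr_gt0.
    by apply: sumr_ge0 => u _; rewrite divr_ge0 ?ltW.
  rewrite mulrC ler_pdivrMr//.
  apply: le_trans (@sum_ln_le V y Y Y0 y0 _); last by rewrite -mulr_sumr mulrC.
  apply: ler_sum => v _; rewrite /y lnM ?posrE ?divr_gt0// ln_div ?posrE//.
  have [_ _ _ _ h] := hT v; rewrite -/(Z v) in h.
  by rewrite addrAC [leRHS]addrCA -addrA lerD// addrC.
have TT0 : 0 < (size TT)%:R :> R.
  rewrite sTT; apply: lt_le_trans hI.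
  have /card_gt0P[v _] := V0; rewrite (bigD1 v)//=.
  apply: ltr_pwDl; first by rewrite divr_gt0// deg_gt0.
  by apply: sumr_ge0 => u _; rewrite divr_ge0 ?ltW// ?deg_gt0.
exists TT; split.
- apply: allpairs_uniq_dep; first exact: enum_uniq.
    by move=> v _; have [] := hT v.
  by move=> [v tau] [v' tau'] _ _ /= [-> ->].
- move=> _ /allpairsPdep[v [tau [_ tT ->]]] /=.
  by have [_ /(_ _ tT) -> _ _] := hT v.
- move=> _ _ /allpairsPdep[v [tau [vI tT ->]]] /allpairsPdep[v' [tau' [vI' tT' ->]]].
  have [vv'|ne] := eqVneq v v'.
    subst v'; rewrite eqseq_cons eqxx /= => ne.
    have [_ _ sp _] := hT v.
    have [rho [a [a' [w [w' [-> -> aa' h]]]]]] := sp _ _ tT tT' ne.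
    exists (v :: rho), a, a', w, w'; split=> //.
    by rewrite -cat_rcons.
  move=> _; exists [::], v, v', tau, tau'; split=> //.
  by rewrite cats0 Ie// -mem_enum.
- by rewrite -(ltr0n R).
- apply: le_trans xT _; rewrite ler_ln ?posrE//; first by rewrite sTT.
  have /card_gt0P[v _] := V0; rewrite (bigD1 v)//=.
  apply: ltr_pwDl; first by rewrite divr_gt0.
  by apply: sumr_ge0 => u _; rewrite divr_ge0 ?ltW.
Qed.

Let Phi t := fix Phi n sigma : R := if n is n'.+1 then
  #|V|%:R^-1 * \sum_v (Phi n' (rcons sigma v) + ln #|V|%:R - ln (deg t sigma v)%:R)
  else 0.

Let has_tree_Phi t n sigma : has_tree t sigma n (Phi t n sigma).
Proof.
elim: n sigma => [|n IH] sigma /=; last by apply: has_treeS => v.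
exists [:: [::]]; split => //=; last by rewrite ln1.
- by move=> tau; rewrite inE => /eqP ->.
- by move=> tau tau'; rewrite !inE => /eqP -> /eqP ->; rewrite eqxx.
Qed.

(** Each level gains [ln #|V|] and loses the mean of the logarithms of the degrees, which by
    concavity and [coll_le] is at most [ln (K #|V|)]. The net gain is at least [- ln K]. *)
Let sum_Phi n sigma : #|D|%:R * - (n%:R * ln K) <= \sum_t Phi t n sigma.
Proof.
elim: n sigma => [|n IH] sigma /=; first by rewrite mul0r oppr0 mulr0 big1.
have QD : 0 < #|D|%:R :> R by rewrite ltr0n.
rewrite -mulr_sumr ler_pdivlMl//.
under eq_bigr do rewrite !big_split /= sumrN.
rewrite big_split big_split /= sumrN exchange_big /=.
have S1 : \sum_(v : V) #|D|%:R * - (n%:R * ln K) <= \sum_v \sum_t Phi t n (rcons sigma v).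
  by apply: ler_sum => v _; exact: IH.
have S2 : \sum_t \sum_v ln (deg t sigma v)%:R <= ln (K * #|V|%:R) * (#|D|%:R * #|V|%:R).
  rewrite pair_big /= -natrM.
  have -> : (#|D| * #|V|)%N = #|{: D * V}| by rewrite card_prod.
  apply: (@sum_ln_le _ (fun p : D * V => (deg p.1 sigma p.2)%:R)).
  - by rewrite mulr_gt0.
  - by move=> p; exact: deg_gt0.
  - rewrite card_prod natrM.
    rewrite -(pair_big xpredT xpredT (fun t v => (deg t sigma v)%:R)) /=.
    by apply: le_trans (coll_le sigma) _; rewrite expr2 le_eqVlt; apply/orP; left; apply/eqP; ring.
have cst (U : finType) (r : R) : \sum_(u : U) r = #|U|%:R * r by rewrite sumr_const mulr_natl.
rewrite cst in S1; rewrite !cst; rewrite lnM ?posrE// in S2.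
move: S1 S2; rewrite -natr1.
set a := \sum_v \sum_t _; set b := \sum_t \sum_v _; lra.
Qed.

(** Since the logarithm of the total size is averaged, one [t] that is at least average serves all
    levels and all nodes at once. *)
Lemma exists_separated_words n : exists t (T : seq (seq V)),
  [/\ uniq T, {in T, forall tau, size tau = n}, separated_words t [::] T &
      K^-1 ^+ n <= (size T)%:R].
Proof.
have QD : 0 < #|D|%:R :> R by rewrite ltr0n.
have [t ht] : exists t, - (n%:R * ln K) <= Phi t n [::].
  apply: contrapT => nex.
  have : \sum_t Phi t n [::] < \sum_(t : D) - (n%:R * ln K).
    apply: ltr_sum; first by have /card_gt0P[t _] := D0; apply/hasP; exists t; rewrite ?mem_index_enum.
    by move=> t _; rewrite ltNge; apply/negP => h; apply: nex; exists t.
  by apply/negP; rewrite -leNgt sumr_const -(mulr_natl (- _)) sum_Phi.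
have [T [uT sT spT T0 hT]] := has_tree_Phi t n [::].
exists t, T; split=> //.
rewrite -ler_ln ?posrE ?exprn_gt0 ?invr_gt0 ?ltr0n//.
by rewrite lnXn ?invr_gt0// lnV ?posrE// mulNrn -(mulr_natl (ln K)) (le_trans ht).
Qed.

End SeparatedTrees.

(** * Compactness of the square *)

Section CompactSquare.
Context {R : realType}.
Notation C := (R[i]^o).

Lemma nbhs_normcP (z : C) (P : set C) :
  nbhs z P <-> exists2 e : R, 0 < e & forall y : C, normc (z - y) < e -> P y.
Proof.
split=> [/nbhs_ballP[[e e'] /= + h]|[e e0 h]].
  rewrite ltcE /= => /andP[/eqP e'0 e0]; subst e'; exists e => // y zy.
  by apply: h; rewrite -ball_normE /= (_ : (e +i* 0)%C = (e%:C)%C)// normc_lt.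
apply/nbhs_ballP; exists (e%:C)%C; first by rewrite /= ltcR.
by move=> y; rewrite -ball_normE /= normc_lt; exact: h.
Qed.

Lemma compact_square : compact (square : set C).
Proof.
have -> : (square : set C) =
    (fun p : R * R => (p.1 +i* p.2)%C : C) @` (`[0, 1]%classic `*` `[0, 1]%classic).
  apply/seteqP; split=> [[x y] [/= x01 y01]|_ [[x y] [/= x01 y01] <-]].
    by exists (x, y) => //; split; rewrite /= in_itv.
  by split=> /=; [move: x01|move: y01]; rewrite in_itv.
apply: continuous_compact; last first.
  by apply: compact_setX; exact: segment_compact.
apply: continuous_subspaceT => -[x y] P /nbhs_normcP[e e0 h].
have e20 : 0 < e / 2 by rewrite divr_gt0.
exists (ball x (e / 2), ball y (e / 2)); first by split; exact: nbhsx_ballx.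
move=> [u v] [/= xu yv]; apply: h; apply: le_lt_trans (normc_le_ReIm _) _ => /=.
rewrite [e]splitr; apply: ltrD.
  by move: xu; rewrite -ball_normE.
by move: yv; rewrite -ball_normE.
Qed.

Lemma lipschitz_compact (f : C -> C) (A : set C) (B : R) :
  (forall x y, A x -> A y -> normc (f x - f y) <= B * normc (x - y)) ->
  compact A -> compact (f @` A).
Proof.
move=> fB cA; apply: continuous_compact cA; apply/subspace_continuousP => x Ax.
move=> P /nbhs_normcP[e e0 h].
have B10 : 0 < `|B| + 1 by rewrite ltr_wpDl.
apply/nbhs_normcP; exists (e / (`|B| + 1)); first by rewrite divr_gt0.
move=> y xy Ay; apply: h; apply: le_lt_trans (fB _ _ Ax Ay) _.
apply: le_lt_trans (_ : _ <= (`|B| + 1) * normc (x - y)) _.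
  apply: ler_wpM2r; first exact: normc_ge0.
  by rewrite (le_trans (ler_norm _))// lerDl.
by rewrite mulrC -ltr_pdivlMr.
Qed.

Lemma compact_disjoint_dist (A B : set C) : compact A -> compact B ->
  A `&` B = set0 -> exists2 g : R, 0 < g & forall x y, A x -> B y -> g <= normc (x - y).
Proof.
move=> cA cB AB.
pose D := (fun p : C * C => normc (p.1 - p.2)) @` (A `*` B).
have cD : compact D.
  apply: continuous_compact; last exact: compact_setX.
  apply: continuous_subspaceT => -[x y] P /nbhs_ballP[e /= e0 h].
  have e20 : 0 < e / 2 by rewrite divr_gt0.
  exists ([set u : C | normc (x - u) < e / 2], [set v : C | normc (y - v) < e / 2]).
    by split; apply/nbhs_normcP; exists (e / 2).
  move=> [u v] [/= xu yv]; apply: h; rewrite -ball_normE /=.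
  have h1 : normc (x - y) <= normc (u - v) + (normc (x - u) + normc (y - v)).
    have -> : x - y = (u - v) + ((x - u) - (y - v)) by ring.
    by apply: le_trans (le_normcD _ _) _; rewrite lerD2l; exact: ler_normcB.
  have h2 : normc (u - v) <= normc (x - y) + (normc (x - u) + normc (y - v)).
    have -> : u - v = (x - y) - ((x - u) - (y - v)) by ring.
    by apply: le_trans (ler_normcB _ _) _; rewrite lerD2l; exact: ler_normcB.
  by apply/ltr_normlP; split; lra.
have D0 : ~ D 0.
  move=> [[x y] [/= Ax By]] /eq0_normc /eqP; rewrite subr_eq0 => /eqP xy.
  have : (A `&` B) y by split=> //; rewrite -xy.
  by rewrite AB.
have cl : closed D by apply: compact_closed; [exact: Rhausdorff|exact: cD].
have /nbhs_ballP[g /= g0 hg] : nbhs (0 : R) (~` D).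
  by apply: open_nbhs_nbhs; split=> //; rewrite openC.
exists g => // x y Ax By; rewrite leNgt; apply/negP => lt.
apply: (hg (normc (x - y))); last by exists (x, y).
by rewrite -ball_normE /= sub0r normrN ger0_norm// normc_ge0.
Qed.

End CompactSquare.

(** * Cylinders *)

(* [lam w] stands for the lower Lipschitz constant of [word_map S w], which is
   supermultiplicative. *)
Record regular_system (R : realType) (M : nat) (S : 'I_M -> R[i] -> R[i])
    (L rho : R) (lam : seq 'I_M -> R) : Prop := RegularSystem {
  regular_self : self_maps S;
  regular_L : 1 <= L;
  regular_rho : 0 <= rho < 1;
  regular_lam_gt0 : forall w, 0 < lam w;
  regular_lower : forall w x y, square x -> square y ->
    lam w * distC x y <= distC (word_map S w x) (word_map S w y);
  regular_upper : forall w x y, square x -> square y ->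
    distC (word_map S w x) (word_map S w y) <= L * lam w * distC x y;
  regular_lamM : forall w v, lam w * lam v <= lam (w ++ v);
  regular_contr : forall i x y, square x -> square y ->
    distC (S i x) (S i y) <= rho * distC x y }.

Section Words.
Context {M : nat}.
Implicit Types (w v : seq 'I_M) (a b : nat -> 'I_M).

Definition wcat w a : nat -> 'I_M :=
  fun n => if (n < size w)%N then nth (a 0%N) w n else a (n - size w)%N.

Lemma prefix_wcat w a k : prefix_word (wcat w a) (size w + k) = w ++ prefix_word a k.
Proof.
apply: (@eq_from_nth _ (a 0%N)); first by rewrite size_cat !size_mkseq.
rewrite size_mkseq => i ik; rewrite nth_mkseq// nth_cat /wcat.
case: ifPn => // wi; rewrite nth_mkseq//.
by rewrite ltn_subLR // leqNgt.
Qed.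

Lemma prefix_wcat_take w a k : (k <= size w)%N -> prefix_word (wcat w a) k = take k w.
Proof.
move=> kw; apply: (@eq_from_nth _ (a 0%N)); first by rewrite size_mkseq size_takel.
rewrite size_mkseq => i ik; rewrite nth_mkseq// nth_take// /wcat.
by rewrite (leq_trans ik kw).
Qed.

Lemma wcat_prefix a k : wcat (prefix_word a k) (fun n => a (k + n)%N) = a.
Proof.
apply/funext => n; rewrite /wcat size_mkseq; case: ifPn => [nk|].
  by rewrite nth_mkseq.
by rewrite -leqNgt => kn; rewrite subnKC.
Qed.

Lemma size_prefix a k : size (prefix_word a k) = k.
Proof. exact: size_mkseq. Qed.

Lemma prefix_wordS a k : prefix_word a k.+1 = rcons (prefix_word a k) (a k).
Proof. exact: mkseqS. Qed.

Lemma take_prefix a j k : (j <= k)%N -> take j (prefix_word a k) = prefix_word a j.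
Proof.
move=> jk; apply: (@eq_from_nth _ (a 0%N)); first by rewrite size_takel ?size_mkseq.
rewrite size_takel ?size_mkseq// => i ij; rewrite nth_take// !nth_mkseq//.
exact: leq_trans jk.
Qed.

End Words.

(** * Sizes of cylinders and the coding map *)

Section RegularSystems.
Context {R : realType} {M : nat} (S : 'I_M -> R[i] -> R[i]).
Variables (L rho : R) (lam : seq 'I_M -> R).
Hypothesis H : regular_system S L rho lam.
Implicit Types (w v : seq 'I_M) (a b : nat -> 'I_M) (x y : R[i]).

Lemma distC_ge0 x y : 0 <= distC x y. Proof. exact: normc_ge0. Qed.

Lemma distCC x y : distC x y = distC y x. Proof. exact: normcBC. Qed.

Lemma square0 : square (0 : R[i]).
Proof. by split; rewrite /= ler01 lexx. Qed.

Lemma square1 : square (1 : R[i]).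
Proof. by split; rewrite /= ler01 lexx. Qed.

Lemma distC01 : distC (0 : R[i]) 1 = 1.
Proof. by rewrite /distC normcBC subr0 normc1. Qed.

Lemma square_dist x y : square x -> square y -> distC x y <= 2.
Proof.
move=> [/andP[x0 x1] /andP[x2 x3]] [/andP[y0 y1] /andP[y2 y3]].
apply: le_trans (normc_le_ReIm _) _; rewrite !raddfB /=.
have h1 : `|complex.Re x - complex.Re y| <= 1 by apply/ler_normlP; split; lra.
have h2 : `|complex.Im x - complex.Im y| <= 1 by apply/ler_normlP; split; lra.
lra.
Qed.

Lemma word_map_cat w v x : word_map S (w ++ v) x = word_map S w (word_map S v x).
Proof. by elim: w => //= i w ->. Qed.

Lemma word_map_square w x : square x -> square (word_map S w x).
Proof.
move=> sx; elim: w => //= i w IH; apply: (regular_self H (i := i)).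
by exists (word_map S w x).
Qed.

Let rho0 : 0 <= rho. Proof. by case/andP: (regular_rho H). Qed.
Let rho1 : rho < 1. Proof. by case/andP: (regular_rho H). Qed.

Lemma word_map_contr w x y : square x -> square y ->
  distC (word_map S w x) (word_map S w y) <= rho ^+ size w * distC x y.
Proof.
move=> sx sy; elim: w => [|i w IH] /=; first by rewrite expr0 mul1r.
apply: le_trans (regular_contr H i (word_map_square w sx) (word_map_square w sy)) _.
by rewrite exprS -mulrA ler_wpM2l.
Qed.

Lemma word_map_dist_le w x y : square x -> square y ->
  distC (word_map S w x) (word_map S w y) <= distC x y.
Proof.
move=> sx sy; apply: le_trans (word_map_contr w sx sy) _.
by rewrite ler_piMl ?distC_ge0// exprn_ile1 ?rho0 ?(ltW rho1).
Qed.

Lemma lam_le_rho w : lam w <= rho ^+ size w.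
Proof.
have := regular_lower H w square0 square1.
have := word_map_contr w square0 square1.
by rewrite distC01 !mulr1 => h1 h2; apply: le_trans h1.
Qed.

Lemma lam_le1 w : lam w <= 1.
Proof. by apply: le_trans (lam_le_rho w) _; rewrite exprn_ile1 ?rho0 ?(ltW rho1). Qed.

(** Both constants are compared on the images of [0] and [1], whose distance 1 is not increased by
    [word_map S v]. Hence [lam] decreases along prefixes up to the factor [L]. *)
Lemma lam_cat_le w v : lam (w ++ v) <= L * lam w.
Proof.
have := regular_lower H (w ++ v) square0 square1.
rewrite !word_map_cat distC01 mulr1 => h; apply: (le_trans h).
apply: le_trans (regular_upper H w (word_map_square v square0) (word_map_square v square1)) _.
have L0 : 0 <= L by apply: le_trans (regular_L H).
rewrite ler_piMr ?mulr_ge0 ?(ltW (regular_lam_gt0 H w))//.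
by rewrite -distC01; exact: (word_map_dist_le v square0 square1).
Qed.

Lemma image_square_dist w x y : (word_map S w @` square) x -> (word_map S w @` square) y ->
  distC x y <= 2 * (L * lam w).
Proof.
move=> [u su <-] [v sv <-]; apply: le_trans (regular_upper H w su sv) _.
have L0 : 0 <= L by apply: le_trans (regular_L H).
rewrite mulrC; apply: ler_wpM2r; last exact: square_dist.
by rewrite mulr_ge0 ?(ltW (regular_lam_gt0 H w)).
Qed.

Lemma image_square_dist_rho w x y :
  (word_map S w @` square) x -> (word_map S w @` square) y ->
  distC x y <= 2 * rho ^+ size w.
Proof.
move=> [u su <-] [v sv <-]; apply: le_trans (word_map_contr w su sv) _.
by rewrite mulrC ler_wpM2r ?exprn_ge0// square_dist.
Qed.

Lemma image_cat_sub w v : word_map S (w ++ v) @` square `<=` word_map S w @` square.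
Proof.
move=> _ [x sx <-]; rewrite word_map_cat; exists (word_map S v x) => //.
exact: word_map_square.
Qed.

Lemma prefix_image_sub a j k : (j <= k)%N ->
  word_map S (prefix_word a k) @` square `<=` word_map S (prefix_word a j) @` square.
Proof.
move=> jk; rewrite -(cat_take_drop j (prefix_word a k)) take_prefix//.
exact: image_cat_sub.
Qed.

(** The images are nested and compact, so a cluster point of the images of [0] lies in all of
    them. *)
Lemma coding_exists a : exists p, forall k, (word_map S (prefix_word a k) @` square) p.
Proof.
pose F k : set (R[i]^o) := word_map S (prefix_word a k) @` square.
have cF k : compact (F k).
  apply: (lipschitz_compact (B := 1)) compact_square => x y sx sy.
  by rewrite mul1r; exact: word_map_dist_le.
have clF k : closed (F k) by apply: compact_closed; [exact: norm_hausdorff|exact: cF].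
pose x k : R[i]^o := word_map S (prefix_word a k) 0.
have xF k n : (k <= n)%N -> F k (x n).
  by move=> kn; apply: (@prefix_image_sub a k n kn); exists 0 => //; exact: square0.
have FF : ProperFilter (x n @[n --> \oo]) by exact: fmap_proper_filter.
have F0 : (x n @[n --> \oo]) (F 0%N) by exists 0%N => // n _ /=; exact: xF.
have [p [_ pc]] := cF 0%N _ FF F0.
exists p => k; apply: clF => B Bp.
have Fk : (x n @[n --> \oo]) (F k) by exists k => // n /= kn; exact: xF.
have [q [qF qB]] := pc _ _ Fk Bp.
by exists q.
Qed.

Lemma coding_unique a p q : (forall k, (1 <= k)%N -> (word_map S (prefix_word a k) @` square) p) ->
  (forall k, (1 <= k)%N -> (word_map S (prefix_word a k) @` square) q) -> p = q.
Proof.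
move=> hp hq; apply/eqP; rewrite -subr_eq0; apply/eqP/eq0_normc/eqP.
rewrite eq_le normc_ge0 andbT leNgt; apply/negP => d0.
have rho01 : 0 <= rho < 1 by rewrite rho0 rho1.
have d20 : 0 < normc (p - q) / 2 by rewrite divr_gt0.
have [n hn] := expr_lt_eps rho01 d20.
have := image_square_dist_rho (hp n.+1 isT) (hq n.+1 isT).
rewrite size_prefix exprS; apply/negP; rewrite -ltNge /distC.
have : rho * rho ^+ n <= rho ^+ n by rewrite ler_piMl ?exprn_ge0// ltW.
by move: hn; rewrite ltr_pdivlMr//; lra.
Qed.

Lemma coding_mem a k : (word_map S (prefix_word a k) @` square) (coding S a).
Proof.
suff h k' : (1 <= k')%N -> (word_map S (prefix_word a k') @` square) (coding S a).
  case: k => [|k]; last exact: h.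
  exact: (@prefix_image_sub a 0 1 isT) (h 1%N isT).
rewrite /coding; case: xgetP => [p -> hp k1|hn]; first exact: hp.
have [p hp] := coding_exists a; exfalso; apply: (hn p) => j _; exact: hp.
Qed.

Lemma coding_square a : square (coding S a).
Proof. by have [x sx <-] := coding_mem a 0. Qed.

Lemma codingE a p : (forall k, (1 <= k)%N -> (word_map S (prefix_word a k) @` square) p) ->
  coding S a = p.
Proof. by apply: coding_unique => k _; exact: coding_mem. Qed.

Lemma coding_wcat w a : coding S (wcat w a) = word_map S w (coding S a).
Proof.
apply: codingE => k _; have [kw|wk] := leqP (size w) k.
  rewrite -(subnKC kw) prefix_wcat.
  have [x sx <-] := coding_mem a (k - size w).
  by exists x => //; rewrite word_map_cat.
rewrite prefix_wcat_take ?(ltnW wk)//.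
exists (word_map S (drop k w) (coding S a)).
  by apply/word_map_square/coding_square.
by rewrite -word_map_cat cat_take_drop.
Qed.

End RegularSystems.

(** * Paths in the transition graph *)

Section Subshift.
Context {M : nat} (A : 'M[nat]_M).
Hypothesis hA : irreducible_mx A.
Implicit Types (w v : seq 'I_M) (a b : nat -> 'I_M).

Definition adm : rel 'I_M := fun i j => A i j == 1%N.

Hypothesis hA01 : zero_one A.

(** The path [p] omits both ends, so [i :: p] can be followed by any admissible word that begins
    with [j]. *)
Lemma adm_connect i j : exists p, path adm i p /\ adm (last i p) j.
Proof.
have [n [n0 An]] := hA i j; case: n n0 An => // n _.
elim: n i => [|n IH] i.
  rewrite expr1 => Aij; exists [::]; split=> //=; rewrite /adm.
  by case: (hA01 i j) Aij => ->.
rewrite exprS -mulmxE mxE => h.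
have [k /=] : exists k, (0 < A i k * (A ^+ n.+1) k j)%N.
  apply: contrapT => nk; move: h; rewrite big1// => k _; apply/eqP.
  by rewrite -leqn0 leqNgt; apply/negP => h; apply: nk; exists k.
rewrite muln_gt0 => /andP[Aik Akj]; have [p [pk pj]] := IH k Akj.
exists (k :: p); split=> //=; rewrite pk andbT /adm.
by case: (hA01 i k) Aik => ->.
Qed.

Lemma SFT_adm a l : SFT A a -> adm (a l) (a l.+1).
Proof. by move=> h; apply/eqP; exact: h. Qed.

Lemma SFT_path a k : SFT A a -> path adm (a 0%N) (prefix_word (fun n => a n.+1) k) /\
  last (a 0%N) (prefix_word (fun n => a n.+1) k) = a k.
Proof.
move=> h; elim: k => [|k [IH1 IH2]] //.
by rewrite prefix_wordS rcons_path last_rcons IH1 IH2 SFT_adm.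
Qed.

Lemma SFT_wcat i p a : path adm i p -> adm (last i p) (a 0%N) -> SFT A a ->
  SFT A (wcat (i :: p) a).
Proof.
move=> pp pl h l; rewrite /wcat /= !ltnS.
have [lp|lp] := ltnP l (size p).
  rewrite ltnW//=; apply/eqP; rewrite (set_nth_default i)//=; last exact: leqW.
  move/pathP: pp => /(_ i l lp); rewrite /adm.
  by rewrite (set_nth_default i (a 0%N)).
case: ltnP => [lp2|lp2].
  by rewrite subSn//; exact: h.
have -> : l = size p by apply/eqP; rewrite eqn_leq lp andbT.
by rewrite subSS subnn (set_nth_default i)// nth_last /=; exact/eqP.
Qed.

End Subshift.

(** * Energy of projections averaged over directions *)

Section ProjectedEnergy.
Context {R : realType}.

(** The scalar product with [1 + i t], without normalisation. It is linear in [t], and slopes in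
    [[0, 1]] suffice for the counting below. *)
Definition proj (t : R) (z : R[i]) : R := complex.Re z + t * complex.Im z.

Lemma projB t x y : proj t (x - y) = proj t x - proj t y.
Proof. by rewrite /proj !raddfB /=; ring. Qed.

Lemma proj_le t z : 0 <= t <= 1 -> `|proj t z| <= 2 * normc z.
Proof.
move=> /andP[t0 t1]; apply: le_trans (ler_normD _ _) _.
have h1 := Re_le_normc z; have h2 := Im_le_normc z.
rewrite normrM (ger0_norm t0).
have : t * `|complex.Im z| <= `|complex.Im z| by rewrite ler_piMl.
lra.
Qed.

Lemma count_close_nats (Q : nat) (P : pred 'I_Q) (D : R) : 0 <= D ->
  (forall i j, P i -> P j -> `|i%:R - j%:R| <= D :> R) -> #|P|%:R <= D + 1.
Proof.
move=> D0 h; have [->|] := eqVneq #|P| 0%N; first by rewrite addr_ge0.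
rewrite -lt0n => /card_gt0P[i0 Pi0].
case: (arg_minnP (fun i : 'I_Q => nat_of_ord i) Pi0) => i Pi imin.
have hd j : P j -> (j - i <= Num.truncn D)%N.
  move=> Pj; have := h _ _ Pj Pi.
  rewrite -natrB ?imin// normr_nat => /le_truncn; rewrite natrK//.
have sub : (#|P| <= (Num.truncn D).+1)%N.
  rewrite -(card_ord (Num.truncn D).+1).
  have inj : {in P &, injective (fun j : 'I_Q => inord (j - i) : 'I_(Num.truncn D).+1)}.
    move=> j k Pj Pk /(congr1 val) /=; rewrite !inordK ?ltnS ?hd// => e.
    by apply/val_inj; rewrite /= -(subnK (imin _ Pj)) -(subnK (imin _ Pk)) e.
  by rewrite -(card_in_image inj) max_card.
apply: (@le_trans _ _ (Num.truncn D).+1%:R); first by rewrite ler_nat.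
by rewrite -natr1 lerD2r truncn_le.
Qed.

(** Transversality. If [|Im a|] is at least a quarter of [|a|], the projection moves with [t] at
    speed [|Im a|], so the good [t] lie in a short interval. Otherwise a single hit forces
    [|a| <= 2 e], and then the bound exceeds the number [Q] of all directions. *)
Lemma count_directions (Q : nat) (a : R[i]) (e : R) : (0 < Q)%N -> 0 < e -> a != 0 ->
  \sum_(t < Q) (`|proj (t%:R / Q%:R) a| <= e)%R%:R <= 8 * e * Q%:R / normc a + 1.
Proof.
move=> Q0 e0 a0; have na : 0 < normc a by rewrite normc_gt0.
have Qr : 0 < Q%:R :> R by rewrite ltr0n.
have -> : \sum_(t < Q) (`|proj (t%:R / Q%:R) a| <= e)%R%:R =
    #|[pred t : 'I_Q | `|proj (t%:R / Q%:R) a| <= e]|%:R :> R.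
  rewrite -sum1_card natr_sum [RHS]big_mkcond /=.
  by apply: eq_bigr => t _; rewrite inE; case: ifP.
have [small|big] := leP (normc a) (4 * `|complex.Im a|).
  have ia : 0 < `|complex.Im a| by lra.
  apply: le_trans (@count_close_nats Q _ (2 * e * Q%:R / `|complex.Im a|) _ _) _.
  - by rewrite divr_ge0// ?mulr_ge0// ?(ltW e0)// (ltW Qr).
  - move=> i j; rewrite !inE => hi hj.
    have : `|proj (i%:R / Q%:R) a - proj (j%:R / Q%:R) a| <= 2 * e.
      by apply: le_trans (ler_normB _ _) _; lra.
    rewrite /proj.
    have -> : complex.Re a + i%:R / Q%:R * complex.Im a - (complex.Re a + j%:R / Q%:R * complex.Im a)
      = (i%:R - j%:R) * complex.Im a / Q%:R by ring.
    rewrite !normrM normfV (gtr0_norm Qr) ler_pdivrMr// => h.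
    by rewrite ler_pdivlMr.
  - rewrite lerD2r ler_pdivrMr//.
    have -> : 8 * e * Q%:R / normc a * `|complex.Im a| =
      2 * e * Q%:R * (4 * `|complex.Im a|) / normc a by ring.
    rewrite ler_pdivlMr//.
    by rewrite ler_wpM2l// ?mulr_ge0// ?(ltW e0)// (ltW Qr).
apply: (@le_trans _ _ (8 * e * Q%:R / normc a)); last by rewrite lerDl.
have [->|] := eqVneq #|[pred t : 'I_Q | `|proj (t%:R / Q%:R) a| <= e]| 0%N.
  by rewrite divr_ge0 ?mulr_ge0 ?(ltW e0) ?(ltW na) ?(ltW Qr).
rewrite -lt0n => /card_gt0P[t]; rewrite inE => ht.
have t0 : 0 <= t%:R / Q%:R :> R by rewrite divr_ge0.
have t1 : t%:R / Q%:R <= 1 :> R by rewrite ler_pdivrMr// mul1r ler_nat ltnW.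
have : normc a <= 2 * `|complex.Im a| + e.
  apply: le_trans (normc_le_ReIm _) _.
  have -> : complex.Re a = proj (t%:R / Q%:R) a - t%:R / Q%:R * complex.Im a.
    by rewrite /proj addrK.
  have : `|proj (t%:R / Q%:R) a - t%:R / Q%:R * complex.Im a| <= e + `|complex.Im a|.
    apply: le_trans (ler_normB _ _) _; apply: lerD => //.
    by rewrite normrM (ger0_norm t0) ler_piMl.
  lra.
move=> na2; have na3 : normc a <= 2 * e by lra.
apply: (@le_trans _ _ Q%:R); first by rewrite ler_nat -[X in (_ <= X)%N]card_ord max_card.
rewrite ler_pdivlMr// mulrC ler_pM2r//; lra.
Qed.

Lemma sumr_card (U : finType) (a : R) : \sum_(u : U) a = #|U|%:R * a.
Proof. by rewrite sumr_const mulr_natl. Qed.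

Lemma big_tuple_cons (T : finType) (k : nat) (f : seq T -> R) :
  \sum_(s : k.+1.-tuple T) f s = \sum_v \sum_(s : k.-tuple T) f (v :: s).
Proof.
rewrite pair_big /= (reindex (fun p : T * k.-tuple T => cons_tuple p.1 p.2)) //=.
exists (fun s => (thead s, behead_tuple s)) => [[v s] _|s _] /=.
  by rewrite theadE; congr (_, _); exact/val_inj.
by apply/val_inj; case/tupleP: s.
Qed.

Variables (M : nat) (S : 'I_M -> R[i] -> R[i]) (L rho : R) (lam : seq 'I_M -> R).
Hypothesis H : regular_system S L rho lam.
Variables (N Q : nat) (v : 'I_N -> seq 'I_M) (r q : R).
Hypothesis N0 : (0 < N)%N.
Hypothesis Q0 : (0 < Q)%N.
Hypothesis r0 : 0 < r.
Hypothesis q0 : 0 < q.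
Hypothesis lam_v : forall i, q <= lam (v i).
Hypothesis sep_v : forall i j x y, i != j -> square x -> square y ->
  r <= distC (word_map S (v i) x) (word_map S (v j) y).

Definition words_cat (s : seq 'I_N) : seq 'I_M := flatten [seq v i | i <- s].

Arguments words_cat : simpl never.

Lemma words_cat_cons i s : words_cat (i :: s) = v i ++ words_cat s.
Proof. by []. Qed.

Lemma words_cat_cat s s' : words_cat (s ++ s') = words_cat s ++ words_cat s'.
Proof. by rewrite /words_cat map_cat flatten_cat. Qed.

Definition collision (e : R) (w : seq 'I_M) (t : 'I_Q) (s s' : seq 'I_N) : bool :=
  `|proj (t%:R / Q%:R) (word_map S (w ++ words_cat s) 0 - word_map S (w ++ words_cat s') 0)| <= e.

(** Induction by first letters. An equal first letter is moved into [w]: this multiplies [1 / lam w]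
    by at most [1 / q], but concerns only one pair in [N], and [b] bounds the factor [1 / (N q)].
    Distinct first letters leave the points [lam w * r] apart, so [count_directions] applies; its
    summand 1 accumulates to [k / Q]. The term [N^-k] stems from pairs of equal words. *)
Lemma projected_energy (b e : R) (w : seq 'I_M) (k : nat) : 0 < e ->
  1 <= b -> 1 <= b * (N%:R * q) ->
  \sum_(t < Q) \sum_(s : k.-tuple 'I_N) \sum_(s' : k.-tuple 'I_N) (collision e w t s s')%:R
  <= Q%:R * N%:R ^+ (2 * k) *
     (N%:R ^- k + k%:R / Q%:R + 8 * e / (lam w * r) * k%:R * b ^+ k) :> R.
Proof.
move=> e0 b1 bN; have Nr : 0 < N%:R :> R by rewrite ltr0n.
have Qr : 0 < Q%:R :> R by rewrite ltr0n.
have b0 : 0 < b by apply: lt_le_trans b1.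
elim: k w => [|k IH] w.
  rewrite muln0 !expr0 invr1 !mul0r !mulr0 mul0r !addr0 !mulr1.
  apply: (@le_trans _ _ (\sum_(t < Q) 1)); last by rewrite sumr_const card_ord.
  apply: ler_sum => t _.
  have one (f : 0.-tuple 'I_N -> R) : \sum_(s : 0.-tuple 'I_N) f s = f [tuple].
    by rewrite (big_pred1 [tuple])// => s; rewrite [s]tuple0 /= eqxx.
  by rewrite !one lern1 leq_b1.
have lw : 0 < lam w := regular_lam_gt0 H w.
pose X := 8 * e / (lam w * r).
have X0 : 0 <= X by rewrite divr_ge0 ?mulr_ge0 ?(ltW e0) ?(ltW lw) ?(ltW r0).
have -> : \sum_(t < Q) \sum_(s : k.+1.-tuple 'I_N) \sum_(s' : k.+1.-tuple 'I_N)
      (collision e w t s s')%:R =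
    \sum_(i < N) \sum_(j < N) \sum_(t < Q) \sum_(s : k.-tuple 'I_N) \sum_(s' : k.-tuple 'I_N)
      (collision e w t (i :: s) (j :: s'))%:R :> R.
  under eq_bigr => t _.
    rewrite (@big_tuple_cons _ _ (fun s => \sum_(s' : k.+1.-tuple 'I_N) (collision e w t s s')%:R)).
    under eq_bigr => i _.
      under eq_bigr => s _.
        rewrite (@big_tuple_cons _ _ (fun s' => (collision e w t (i :: s) s')%:R)).
        over.
      rewrite exchange_big /=.
      over.
    over.
  rewrite exchange_big /=; apply: eq_bigr => i _.
  by rewrite exchange_big.
have diag i : \sum_(t < Q) \sum_(s : k.-tuple 'I_N) \sum_(s' : k.-tuple 'I_N)
      (collision e w t (i :: s) (i :: s'))%:R <=
    Q%:R * N%:R ^+ (2 * k) * (N%:R ^- k + k%:R / Q%:R + X / q * k%:R * b ^+ k) :> R.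
  have -> : \sum_(t < Q) \sum_(s : k.-tuple 'I_N) \sum_(s' : k.-tuple 'I_N)
      (collision e w t (i :: s) (i :: s'))%:R =
      \sum_(t < Q) \sum_(s : k.-tuple 'I_N) \sum_(s' : k.-tuple 'I_N)
      (collision e (w ++ v i) t s s')%:R :> R.
    do 3 ! apply: eq_bigr => ? _.
    by rewrite /collision !words_cat_cons !catA.
  apply: le_trans (IH _) _.
  rewrite ler_wpM2l ?mulr_ge0 ?exprn_ge0 ?(ltW Qr) ?(ltW Nr)// lerD2l.
  rewrite ler_wpM2r ?exprn_ge0 ?(ltW b0)// ler_wpM2r//.
  rewrite /X -[leRHS]mulrA -invfM ler_wpM2l ?mulr_ge0 ?(ltW e0)//.
  rewrite lef_pV2 ?posrE ?mulr_gt0 ?(regular_lam_gt0 H)//.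
  rewrite mulrAC ler_pM2r//; apply: le_trans (regular_lamM H w (v i)).
  by rewrite ler_pM2l.
have off i j : i != j -> \sum_(t < Q) \sum_(s : k.-tuple 'I_N) \sum_(s' : k.-tuple 'I_N)
      (collision e w t (i :: s) (j :: s'))%:R <= N%:R ^+ (2 * k) * (X * Q%:R + 1) :> R.
  move=> ij; rewrite exchange_big /=.
  under eq_bigr do rewrite exchange_big /=.
  apply: (@le_trans _ _ (\sum_(s : k.-tuple 'I_N) \sum_(s' : k.-tuple 'I_N) (X * Q%:R + 1))).
    apply: ler_sum => s _; apply: ler_sum => s' _.
    set a := word_map S (w ++ words_cat (i :: s)) 0 - word_map S (w ++ words_cat (j :: s')) 0.
    have na : lam w * r <= normc a.
      rewrite /a !(@word_map_cat _ _ S w); have s0 := square0 (R := R).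
      have h1 : lam w * distC (word_map S (words_cat (i :: s)) 0)
          (word_map S (words_cat (j :: s')) 0) <= normc (word_map S w (word_map S (words_cat (i :: s)) 0) -
          word_map S w (word_map S (words_cat (j :: s')) 0)) := regular_lower H w (word_map_square H (words_cat (i :: s)) s0)
        (word_map_square H (words_cat (j :: s')) s0).
      apply: (le_trans _ h1); rewrite ler_pM2l// !words_cat_cons.
      rewrite (@word_map_cat _ _ S (v i)) (@word_map_cat _ _ S (v j)).
      exact: (sep_v ij (word_map_square H _ s0) (word_map_square H _ s0)).
    have lr0 : 0 < lam w * r by rewrite mulr_gt0.
    have na0 : 0 < normc a by apply: lt_le_trans na.
    apply: le_trans (@count_directions Q a e Q0 e0 _) _; first by rewrite -normc_gt0.
    rewrite lerD2r /X mulrAC ler_wpM2r ?(ltW Qr)//.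
    by rewrite ler_wpM2l ?mulr_ge0 ?(ltW e0)// lef_pV2 ?posrE.
  by rewrite !sumr_card !card_tuple card_ord natrX mul2n -addnn exprD mulrA.
have off0 : 0 <= N%:R ^+ (2 * k) * (X * Q%:R + 1) :> R.
  by rewrite mulr_ge0 ?exprn_ge0 ?(ltW Nr)// addr_ge0// mulr_ge0// ltW.
set dg := Q%:R * N%:R ^+ (2 * k) * (N%:R ^- k + k%:R / Q%:R + X / q * k%:R * b ^+ k) in diag.
apply: (@le_trans _ _ (\sum_(i < N) (dg + \sum_(j < N) N%:R ^+ (2 * k) * (X * Q%:R + 1)))).
  apply: ler_sum => i _; rewrite (bigD1 i)//=; apply: lerD; first exact: diag.
  rewrite [leRHS](bigD1 i)//= -[leLHS]add0r; apply: lerD => //.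
  by apply: ler_sum => j ji; apply: off; rewrite eq_sym.
rewrite !sumr_card !card_ord.
have -> : N%:R ^+ (2 * k.+1) = N%:R ^+ (2 * k) * N%:R * N%:R :> R.
  by rewrite mulnS addnC exprD expr2 mulrA.
rewrite -/X /dg -[in N%:R ^- k.+1]addn1 exprD expr1 invfM.
clearbody X; clear dg diag off off0 IH.
have h1 : k%:R / N%:R <= k%:R :> R by rewrite ler_pdivrMr// ler_peMr// ler1n.
have h2 : (q * N%:R)^-1 * b ^+ k <= b ^+ k.+1.
  rewrite exprS ler_wpM2r ?exprn_ge0 ?(ltW b0)//.
  by rewrite -[_^-1]mul1r ler_pdivrMr ?mulr_gt0// (mulrC q).
have h3 : 1 <= b ^+ k.+1 by rewrite exprn_ege1.
have QX0 : 0 <= Q%:R * X by rewrite mulr_ge0// ltW.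
have h4 := ler_wpM2l (mulr_ge0 QX0 (ler0n R k)) h2.
have h5 := ler_wpM2l QX0 h3.
have kS : k.+1%:R = k%:R + 1 :> R by rewrite natr1.
move: h1 h2 h3 h4 h5; rewrite kS; move: (N%:R ^+ (2 * k)) (exprn_ge0 (2 * k) (ltW Nr)) => A A0.
move: (N%:R ^- k) (b ^+ k) (b ^+ k.+1) => nk bk bk1 h1 h2 h3 h4 h5.
have ANN0 : 0 <= A * N%:R * N%:R by rewrite !mulr_ge0// ltW.
have fin : Q%:R * (nk / N%:R) + k%:R / N%:R + Q%:R * X * k%:R * ((q * N%:R)^-1 * bk) +
    (X * Q%:R + 1) <= Q%:R * (nk / N%:R) + (k%:R + 1) + Q%:R * X * k%:R * bk1 + Q%:R * X * bk1.
  lra.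
apply: le_trans (le_trans _ (ler_wpM2l ANN0 fin)) _.
  by apply: eq_ler; field; rewrite !gt_eqF.
by apply: eq_ler; field; rewrite !gt_eqF.
Qed.

End ProjectedEnergy.

(** * Many separated loops of comparable size *)

Section SeparatedLoops.
Context {R : realType}.

Lemma pos_lower_bound (U : finType) (f : U -> R) : (forall u, 0 < f u) ->
  exists2 m : R, 0 < m & forall u, m <= f u.
Proof.
move=> f0; have s0 : 0 <= \sum_u (f u)^-1 by apply: sumr_ge0 => u _; rewrite invr_ge0 ltW.
have p0 : 0 < 1 + \sum_u (f u)^-1 by rewrite ltr_pwDl.
(* This witness also serves an empty [U], over which there is no minimum. *)
exists (1 + \sum_u (f u)^-1)^-1; first by rewrite invr_gt0.
move=> u; rewrite invf_ple ?posrE// (bigD1 u)//= addrCA lerDl.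
by rewrite addr_ge0//; apply: sumr_ge0 => w _; rewrite invr_ge0 ltW.
Qed.

Variables (M : nat) (S : 'I_M -> R[i] -> R[i]) (L rho : R) (lam : seq 'I_M -> R).
Hypothesis H : regular_system S L rho lam.
Variable A : 'M[nat]_M.
Hypothesis hA01 : zero_one A.
Hypothesis hA : irreducible_mx A.
Variable a0 : 'I_M.

(** A loop begins with [a0] and may be followed by [a0], so loops can be concatenated freely: they
    generate a full shift inside [SFT A]. *)
Definition loop (w : seq 'I_M) : Prop :=
  exists p, [/\ w = a0 :: p, path (adm A) a0 p & adm A (last a0 p) a0].

Lemma loop_cat w v : loop w -> loop v -> loop (w ++ v).
Proof.
move=> [p [-> pp pl]] [q [-> qp ql]]; exists (p ++ a0 :: q); split=> //.
  by rewrite cat_path pp /= pl qp.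
by rewrite last_cat.
Qed.

Lemma loop_SFT w a : loop w -> a 0%N = a0 -> SFT A a -> SFT A (wcat w a).
Proof. by move=> [p [-> pp pl]] a00; apply: SFT_wcat => //; rewrite a00. Qed.

Let L0 : 0 < L. Proof. exact: lt_le_trans (regular_L H). Qed.
Let lam0 w : 0 < lam w. Proof. exact: (regular_lam_gt0 H). Qed.

(** A stopping time: the first length at which [lam] has dropped to [r], which is positive because
    [r < lam [::]]. *)
Lemma exists_stop (a : nat -> 'I_M) (r : R) : 0 < r -> r < lam [::] ->
  exists k, lam (prefix_word a k.+1) <= r /\ r < lam (prefix_word a k).
Proof.
move=> r0 rl; have [n hn] := expr_lt_eps (regular_rho H) r0.
have ex : exists n, lam (prefix_word a n) <= r.
  by exists n; apply: le_trans (lam_le_rho H _) _; rewrite size_prefix ltW.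
case: (ex_minnP ex) => [[|k]] hk kmin.
  by exfalso; move: hk; rewrite /prefix_word /mkseq /= leNgt rl.
exists k; split=> //; rewrite ltNge; apply/negP => /kmin.
by rewrite ltnn.
Qed.

(** Words stopped at scale [r] are completed to loops, and a maximal [r]-separated family of these
    is taken. By maximality every stopped cylinder is close to a member, so about [N] sets of size
    comparable to [r] cover the limit set; if [N r^s] were small, this would be a small cover. *)
Lemma separated_loops (s : R) : 0 <= s -> ~ small_cover distC s (limit_set S A) ->
  exists c K r1 : R, [/\ 0 < c, 0 < K, 0 < r1 & forall r : R, 0 < r -> r < r1 ->
    exists N (v : 'I_N -> seq 'I_M), [/\ forall i, loop (v i),
      forall i, c * r <= lam (v i) <= L ^+ 2 * r,
      forall i j x y, i != j -> square x -> square y ->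
        r <= distC (word_map S (v i) x) (word_map S (v j) y) &
      K <= N%:R * r `^ s]].
Proof.
move=> s0 nsc.
have [e0 e00 ncov] : exists2 e : R, 0 < e & ~ exists (I : finType) (V : I -> set R[i]) (r : I -> R),
    [/\ forall x, limit_set S A x -> exists i, V i x, forall i, 0 < r i <= e,
      forall i x y, V i x -> V i y -> distC x y <= r i & \sum_i (r i) `^ s <= e].
  apply: contrapT => h; apply: nsc => e e0; apply: contrapT => h2.
  by apply: h; exists e.
have /choice[pb hb] : forall i, exists p, path (adm A) a0 p /\ adm A (last a0 p) i.
  by move=> i; exact: adm_connect.
have /choice[pc hc] : forall j, exists p, path (adm A) j p /\ adm A (last j p) a0.
  by move=> j; exact: adm_connect.
pose b i := a0 :: pb i.
(* [b i] leads from [a0] to the first letter of [w], and [pc] leads back from its last letter to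
   [a0]. *)
pose hat w := if w is i :: w' then b i ++ w ++ pc (last i w') else [::].
have [bm bm0 hbm] := @pos_lower_bound 'I_M (fun i => lam (b i)) (fun i => lam0 _).
have [cm cm0 hcm] := @pos_lower_bound 'I_M (fun i => lam (pc i)) (fun i => lam0 _).
have [lm lm0 hlm] := @pos_lower_bound 'I_M (fun i => lam [:: i]) (fun i => lam0 _).
(* In units of [r]: the diameter of the cylinder of the chosen loop, the distance of two cylinders
   violating separation, and the diameter of the stopped cylinder moved by [b]. In [C3] it is
   doubled for a diameter and divided by [bm] to undo [b]. *)
pose C2 : R := 2 * (L * (L ^+ 2)) + 1 + 2 * (L * L).
have C20 : 0 < C2 by rewrite !addr_gt0 ?mulr_gt0 ?exprn_gt0.
pose C3 : R := 2 * C2 / bm.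
have C30 : 0 < C3 by rewrite divr_gt0 ?mulr_gt0.
have M0 : 0 < M%:R :> R by rewrite ltr0n (leq_ltn_trans _ (ltn_ord a0)).
have C3s : 0 < C3 `^ s by rewrite powR_gt0.
exists (bm * lm * cm), (e0 / (M%:R * C3 `^ s)), (Num.min (lam [::]) (e0 / C3)); split.
- by rewrite !mulr_gt0.
- by rewrite divr_gt0 ?mulr_gt0.
- by rewrite lt_min lam0 divr_gt0.
move=> r r0; rewrite lt_min => /andP[rl re].
have [n0 hn0] := expr_lt_eps (regular_rho H) r0.
pose stop w := exists a k, [/\ SFT A a, w = prefix_word a k.+1, lam w <= r &
  r < lam (prefix_word a k)].
have stop_size w : stop w -> (size w < n0.+1)%N.
  move=> [a [k [_ -> _ rk]]]; rewrite size_prefix ltnS ltnNge; apply/negP => n0k.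
  move: rk; apply/negP; rewrite -leNgt; apply: le_trans (lam_le_rho H _) _.
  rewrite size_prefix; apply: le_trans (ltW hn0).
  by apply: ler_wiXn2l => //; case/andP: (regular_rho H) => // ? /ltW.
(* Stopped words have bounded length; in this finite type of words a maximal separated set
   exists. *)
pose W := {j : 'I_n0.+1 & j.-tuple 'I_M}.
pose wd (x : W) : seq 'I_M := tagged x.
have stopW w : stop w -> exists x : W, wd x = w.
  by move=> /stop_size sw; exists (@Tagged _ (Ordinal sw) (fun j : 'I_n0.+1 => j.-tuple 'I_M) (in_tuple w)).
pose sep x y := forall p q, square p -> square q ->
  r <= distC (word_map S (hat (wd x)) p) (word_map S (hat (wd y)) q).
pose P (T : {set W}) := `[< (forall x, x \in T -> stop (wd x)) /\
  forall x y, x \in T -> y \in T -> x != y -> sep x y >].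
have P0 : exists T, P T.
  by exists finset.set0; apply/asboolP; split=> [x|x y]; rewrite inE.
have [T /maxsetP[PT Tmax]] := ex_maxset P0.
have [Tstop Tsep] := asboolP _ PT.
have hat_stop w : stop w -> exists i w' j, [/\ w = i :: w', j = last i w',
    hat w = b i ++ w ++ pc j, loop (hat w) & bm * lm * cm * r <= lam (hat w) <= L ^+ 2 * r].
  move=> [a [k [Sa wE wr rk]]].
  have [pa la] := SFT_path k Sa.
  have wE2 : w = a 0%N :: prefix_word (fun n => a n.+1) k.
    rewrite wE /prefix_word /mkseq /=; congr (_ :: _).
    by rewrite (iotaDl 1 0) -map_comp.
  exists (a 0%N), (prefix_word (fun n => a n.+1) k), (a k).
  have hE : hat w = b (a 0%N) ++ w ++ pc (a k) by rewrite /hat wE2 la.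
  split; rewrite ?la//.
  - rewrite hE wE2; have [h1 h2] := hb (a 0%N); have [h3 h4] := hc (a k).
    exists (pb (a 0%N) ++ (a 0%N :: prefix_word (fun n => a n.+1) k) ++ pc (a k)); split=> //.
      by rewrite cat_path h1 /= h2 cat_path pa /= la h3.
    by rewrite last_cat /= last_cat la.
  - rewrite hE; apply/andP; split.
      apply: le_trans (regular_lamM H _ _).
      have h1 : lm * r <= lam w.
        rewrite wE prefix_wordS -cats1; apply: le_trans (regular_lamM H _ _).
        by rewrite mulrC; apply: ler_pM; rewrite ?(ltW r0) ?(ltW lm0) ?(ltW rk).
      have h2 : lm * r * cm <= lam (w ++ pc (a k)).
        apply: le_trans (regular_lamM H _ _).
        by apply: ler_pM; rewrite ?mulr_ge0 ?(ltW r0) ?(ltW lm0) ?(ltW cm0).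
      have -> : bm * lm * cm * r = bm * (lm * r * cm) by ring.
      by apply: ler_pM; rewrite ?mulr_ge0 ?(ltW r0) ?(ltW lm0) ?(ltW cm0) ?(ltW bm0).
    have := regular_lower H (b (a 0%N) ++ w ++ pc (a k)) square0 square1.
    rewrite distC01 mulr1 (word_map_cat S (b _)) (word_map_cat S (b _)) => h; apply: (le_trans h).
    have sq0 := word_map_square H (w ++ pc (a k)) (square0 (R := R)).
    have sq1 := word_map_square H (w ++ pc (a k)) (square1 (R := R)).
    apply: le_trans (word_map_dist_le H _ sq0 sq1) _.
    apply: le_trans (regular_upper H _ square0 square1) _.
    rewrite distC01 mulr1 expr2 -mulrA ler_pM2l//.
    by apply: le_trans (lam_cat_le H _ _) _; rewrite ler_pM2l.
have cover x : stop (wd x) -> exists2 y, y \in T & exists p q, [/\ square p, square q &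
    distC (word_map S (hat (wd x)) p) (word_map S (hat (wd y)) q) <= r].
  move=> sx; apply: contrapT => h.
  have xsep y : y \in T -> sep x y.
    move=> yT p q sp sq; rewrite leNgt; apply/negP => lt; apply: h; exists y => //.
    by exists p, q; split=> //; exact: ltW.
  have xT : x \in T.
    rewrite -(Tmax (x |: T)%SET); first by rewrite !inE eqxx.
      apply/asboolP; split=> [y|y z]; rewrite !inE.
        by move=> /predU1P[->|/Tstop].
      move=> /predU1P[->|yT] /predU1P[->|zT].
      + by rewrite eqxx.
      + by move=> _; exact: xsep.
      + by move=> _ p q sp sq; rewrite distCC; exact: xsep.
      + exact: Tsep.
    exact: finset.subsetUr.
  apply: h; exists x => //; exists 0, 0; split; [exact: square0|exact: square0|].
  by rewrite /distC subrr normc0 ltW.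
exists #|T|, (fun i => hat (wd (enum_val i))).
have Tst (i : 'I_#|T|) : stop (wd (enum_val i)) by apply/Tstop/enum_valP.
split.
- by move=> i; have [? [? [? [_ _ _ ]]]] := hat_stop _ (Tst i).
- by move=> i; have [? [? [? [_ _ _ _]]]] := hat_stop _ (Tst i).
- move=> i j x y ij sx sy; apply: Tsep => //; try exact: enum_valP.
  by apply: contra ij => /eqP/enum_val_inj ->.
rewrite leNgt; apply/negP => lt; apply: ncov.
pose Y (j : 'I_#|T|) := word_map S (hat (wd (enum_val j))) 0.
(* It is the image of the point under [b] that lies near a chosen loop, so the index also records
   the first letter, which tells which [b] to undo. *)
exists ('I_M * 'I_#|T|)%type, (fun p => [set z | exists2 a, SFT A a & [/\ a 0%N = p.1,
  z = coding S a & distC (word_map S (b p.1) z) (Y p.2) <= C2 * r]]), (fun=> C3 * r); split.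
- move=> _ [a Sa <-]; have [k [k1 k2]] := exists_stop a r0 rl.
  have st : stop (prefix_word a k.+1) by exists a, k.
  have [x xE] := stopW _ st; rewrite -xE in st.
  have [y yT [p [q [sp sq pq]]]] := cover x st.
  have [i [w' [j [wE jE hE lw /andP[lam1 lam2]]]]] := hat_stop _ st.
  have iE : i = a 0%N by have := wE; rewrite xE /prefix_word /mkseq /= => -[].
  exists (a 0%N, enum_rank_in yT y); exists a => //; split=> //=.
  rewrite /Y enum_rankK_in//.
  have [i2 [w2 [j2 [_ _ _ _ /andP[_ lamy]]]]] := hat_stop _ (Tstop _ yT).
  have h3 : distC (word_map S (hat (wd y)) q) (word_map S (hat (wd y)) 0) <= 2 * (L * (L ^+ 2 * r)).
    apply: le_trans (image_square_dist H (w := hat (wd y)) _ _) _.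
    - by exists q.
    - by exists 0 => //; exact: square0.
    - by rewrite !ler_pM2l.
  have h1 : distC (word_map S (b (a 0%N)) (coding S a)) (word_map S (hat (wd x)) p) <= 2 * (L * (L * r)).
    have lb : lam (b (a 0%N) ++ wd x) <= L * r.
      have := regular_lower H (b (a 0%N) ++ wd x) square0 square1.
      rewrite distC01 mulr1 (word_map_cat S (b _)) (word_map_cat S (b _)) => h; apply: (le_trans h).
      have sq0 := word_map_square H (wd x) (square0 (R := R)).
      have sq1 := word_map_square H (wd x) (square1 (R := R)).
      apply: le_trans (word_map_dist_le H _ sq0 sq1) _.
      apply: le_trans (regular_upper H _ square0 square1) _.
      by rewrite distC01 mulr1 ler_pM2l// xE.
    apply: le_trans (image_square_dist H (w := b (a 0%N) ++ wd x) _ _) _.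
    - have [u su <-] := coding_mem H a k.+1; exists u => //.
      by rewrite word_map_cat xE.
    - rewrite hE iE catA; exists (word_map S (pc j) p); first exact: (word_map_square H).
      by rewrite -word_map_cat.
    - by rewrite !ler_pM2l.
  apply: le_trans (ler_normc_sub (word_map S (hat (wd x)) p) _ _) _.
  have := ler_normc_sub (word_map S (hat (wd y)) q) (word_map S (hat (wd x)) p) (word_map S (hat (wd y)) 0).
  move: h1 h3 pq; rewrite /distC /C2; clear; lra.
- by move=> _; rewrite mulr_gt0//= mulrC -ler_pdivlMr// ltW.
- move=> [i j] /= x y [a Sa [ai -> ha]] [a' Sa' [ai' -> ha']].
  have sa := coding_square H a; have sa' := coding_square H a'.
  have h := regular_lower H (b i) sa sa'.
  have h2 : distC (word_map S (b i) (coding S a)) (word_map S (b i) (coding S a')) <= 2 * (C2 * r).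
    apply: le_trans (ler_normc_sub (Y j) _ _) _; rewrite mulr_natl mulr2n.
    by apply: lerD => //; rewrite normcBC.
  have -> : C3 * r = 2 * (C2 * r) / bm by rewrite /C3; ring.
  rewrite ler_pdivlMr// mulrC; apply: le_trans (le_trans h h2).
  by rewrite ler_wpM2r ?distC_ge0.
- rewrite sumr_card card_prod !card_ord powRM ?(ltW C30) ?(ltW r0)// natrM.
  move: lt; rewrite ltr_pdivlMr ?mulr_gt0// => /ltW; apply: le_trans.
  by apply: eq_ler; ring.
Qed.

End SeparatedLoops.

(** * An alphabet with few collisions on average *)

Section Alphabet.
Context {R : realType}.

Lemma powR_small (p B : R) : 0 < p -> 0 < B ->
  exists2 d : R, 0 < d & forall r : R, 0 < r -> r < d -> r `^ p <= B.
Proof.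
move=> p0 B0; exists (B `^ p^-1); first by rewrite powR_gt0.
move=> r r0 rd; have -> : B = (B `^ p^-1) `^ p by rewrite -powRrM mulVf ?gt_eqF// powRr1// ltW.
by apply: ge0_ler_powR; rewrite ?nnegrE ?powR_ge0 ?(ltW r0) ?(ltW p0) ?(ltW rd).
Qed.

Variables (M : nat) (S : 'I_M -> R[i] -> R[i]) (L rho : R) (lam : seq 'I_M -> R).
Hypothesis H : regular_system S L rho lam.
Variable A : 'M[nat]_M.
Hypothesis hA01 : zero_one A.
Hypothesis hA : irreducible_mx A.
Variable a0 : 'I_M.
Hypothesis ncov : forall s : R, 0 <= s -> s < 1 -> ~ small_cover distC s (limit_set S A).

Let L0 : 0 < L. Proof. exact: lt_le_trans (regular_L H). Qed.
Let L1 : 1 <= L. Proof. exact: (regular_L H). Qed.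
Let lam0 w : 0 < lam w. Proof. exact: (regular_lam_gt0 H). Qed.

(** The letters are [k]-tuples of loops at scale [r]. A small [r] brings [N^-1] and [L^3 r b] below
    a quarter of [x = q1^s], the slack in the exponents absorbing the constants. Then a large [k]
    makes [(x / 4)^k] negligible against [x^k], and a large [Q] disposes of the term [k / Q] of
    [projected_energy]. *)
Lemma separating_alphabet (s : R) : 0 < s -> s < 1 ->
  exists (N k Q : nat) (v : 'I_N -> seq 'I_M) (q e g : R),
  [/\ [/\ (0 < N)%N, (0 < Q)%N, 0 < q < 1 & 0 < g],
      forall i, loop A a0 (v i),
      forall sg : k.-tuple 'I_N, q <= lam (words_cat v sg),
      forall w, \sum_(t < Q) \sum_(sg : k.-tuple 'I_N) \sum_(sg' : k.-tuple 'I_N)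
         (collision S v (e * lam w) w t sg sg')%:R
        <= q `^ s * Q%:R * #|{: k.-tuple 'I_N}|%:R ^+ 2 :> R &
      forall w (t : 'I_Q) (sg sg' : k.-tuple 'I_N) x y, square x -> square y ->
        ~~ collision S v (e * lam w) w t sg sg' ->
        g * lam w <= `|proj (t%:R / Q%:R) (word_map S (w ++ words_cat v sg) x -
          word_map S (w ++ words_cat v sg') y)|].
Proof.
move=> s0 s1; pose s' := (s + 1) / 2.
have s'1 : s' < 1 by rewrite /s'; lra.
have ss' : s < s' by rewrite /s'; lra.
have s'0 : 0 <= s' by rewrite /s'; lra.
have [c [K [r1 [c0 K0 r10 hr]]]] := separated_loops H hA01 hA a0 s'0 (ncov s'0 s'1).
have cs : 0 < c `^ s by rewrite powR_gt0.
have p1 : 0 < s' - s by rewrite subr_gt0.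
have p2 : 0 < 1 - s by rewrite subr_gt0.
(* [B1] serves for [N^-1 <= x / 4]; [B2] and [B3] serve for [L^3 r b <= x / 4], one for each value
   of the maximum [b]. *)
have B1 : 0 < K * c `^ s / 4 by rewrite divr_gt0 ?mulr_gt0.
have B2 : 0 < c `^ s / (4 * L ^+ 3) by rewrite divr_gt0 ?mulr_gt0 ?exprn_gt0.
have B3 : 0 < K * c * c `^ s / (4 * L ^+ 3) by rewrite divr_gt0 ?mulr_gt0 ?exprn_gt0.
have [d1 d10 h1] := powR_small p1 B1; have [d2 d20 h2] := powR_small p2 B2.
have [d3 d30 h3] := powR_small p1 B3.
pose r := Num.min (Num.min r1 c^-1) (Num.min d1 (Num.min d2 d3)) / 2.
have mm : 0 < Num.min (Num.min r1 c^-1) (Num.min d1 (Num.min d2 d3)).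
  by rewrite !lt_min r10 d10 d20 d30 invr_gt0 c0.
have r0 : 0 < r by rewrite divr_gt0.
have : r < Num.min (Num.min r1 c^-1) (Num.min d1 (Num.min d2 d3)).
  by rewrite ltr_pdivrMr// ltr_pMr// ltr1n.
rewrite !lt_min => /andP[/andP[rr1 rc] /andP[rd1 /andP[rd2 rd3]]].
have [N [v [vl vlam vsep KN]]] := hr r r0 rr1.
have rs' : 0 < r `^ s' by rewrite powR_gt0.
have N0 : (0 < N)%N.
  rewrite lt0n; apply/eqP => N0; move: KN; rewrite N0 mul0r leNgt K0 //.
have Nr : 0 < N%:R :> R by rewrite ltr0n.
pose q1 := c * r; have q10 : 0 < q1 by rewrite mulr_gt0.
have q11 : q1 < 1 by rewrite /q1 -ltr_pdivlMl ?mulr1.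
pose x := q1 `^ s; have x0 : 0 < x by rewrite powR_gt0.
have xE : x = c `^ s * r `^ s by rewrite /x /q1 powRM ?ltW.
have rE : r `^ s' = r `^ (s' - s) * r `^ s.
  by rewrite -powRD ?subrK// (gt_eqF r0) implybT.
have rE1 : r = r `^ (1 - s) * r `^ s.
  by rewrite -powRD ?subrK ?powRr1 ?(ltW r0)// (gt_eqF r0) implybT.
have rs0 : 0 < r `^ s by rewrite powR_gt0.
have NK : N%:R^-1 <= r `^ s' / K.
  by rewrite -[N%:R^-1]mul1r ler_pdivrMr// mulrAC ler_pdivlMr// mul1r mulrC.
have c1 : N%:R^-1 <= x / 4.
  apply: (le_trans NK); rewrite ler_pdivrMr// rE xE.
  have := ler_wpM2r (ltW rs0) (h1 r r0 rd1); lra.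
pose b := Num.max 1 (N%:R * q1)^-1.
have b1 : 1 <= b by rewrite le_max lexx.
have bN : 1 <= b * (N%:R * q1).
  by rewrite -ler_pdivrMr ?mulr_gt0// mul1r le_max lexx orbT.
have b0 : 0 < b by apply: lt_le_trans b1.
have L30 : 0 < L ^+ 3 by rewrite exprn_gt0.
have c2 : L ^+ 3 * r * b <= x / 4.
  have e1 : L ^+ 3 * r <= x / 4.
    have := ler_wpM2r (ltW rs0) (h2 r r0 rd2); rewrite -rE1 => h.
    rewrite mulrC -ler_pdivlMr//; apply: (le_trans h); rewrite xE.
    by apply: eq_ler; field; rewrite gt_eqF.
  have e2 : L ^+ 3 * r * (N%:R * q1)^-1 <= x / 4.
    have -> : L ^+ 3 * r * (N%:R * q1)^-1 = L ^+ 3 / c * N%:R^-1.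
      by rewrite /q1; field; rewrite !gt_eqF.
    apply: (@le_trans _ _ (L ^+ 3 / c * (r `^ s' / K))).
      by rewrite ler_wpM2l// divr_ge0 ?ltW.
    have := ler_wpM2r (ltW rs0) (h3 r r0 rd3); rewrite -rE => h.
    have f0 : 0 <= L ^+ 3 / (c * K) by rewrite divr_ge0 ?mulr_ge0 ?ltW.
    have := ler_wpM2l f0 h; rewrite xE => h'.
    apply: le_trans (le_trans (eq_ler _) h') (eq_ler _); field; rewrite ?gt_eqF//.
  by rewrite /b /Num.max; case: ifP => _ //; rewrite mulr1.
(* Of the two factors in [4^k = 2^k 2^k], one absorbs the [k] in the energy bound and the other, by
   this choice, the constant. *)
have [k hk] : exists k, 2 * (1 + 128 * L / r) <= 2 ^+ k :> R by apply: natr_expr_ge; rewrite ltr1n.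
pose Q := (Num.truncn (2 * k%:R / x ^+ k)).+1.
have xk0 : 0 < x ^+ k by rewrite exprn_gt0.
have Q0 : 0 < Q%:R :> R by rewrite ltr0n.
have kQ : k%:R / Q%:R <= x ^+ k / 2.
  rewrite ler_pdivrMr// mulrAC ler_pdivlMr// mulrC -ler_pdivrMl//.
  by rewrite [leLHS]mulrC; apply/ltW; exact: truncnS_gt.
(* A point of a cylinder projects within [4 L (L^3 r)^k lam w] of the image of [0]. Two such errors
   reduce the threshold 16 to the gap 8. *)
pose e := 16 * L * (L ^+ 3 * r) ^+ k.
have e0 : 0 < e by rewrite mulr_gt0 ?exprn_gt0 ?mulr_gt0.
exists N, k, Q, v, (q1 ^+ k), e, (8 * L * (L ^+ 3 * r) ^+ k).
have k0 : (0 < k)%N.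
  rewrite lt0n; apply/eqP => k0; move: hk; rewrite k0 expr0 leNgt => /negP; apply.
  have : 0 < 128 * L / r by rewrite divr_gt0 ?mulr_gt0.
  by lra.
have small (sg : seq 'I_N) y z : square y -> square z ->
    distC (word_map S (words_cat v sg) y) (word_map S (words_cat v sg) z) <=
    (L ^+ 3 * r) ^+ size sg * distC y z.
  move=> sy sz; elim: sg => [|i sg IH]; first by rewrite expr0 mul1r.
  rewrite words_cat_cons !word_map_cat.
  apply: le_trans (regular_upper H _ (word_map_square H _ sy) (word_map_square H _ sz)) _.
  rewrite /= exprS -mulrA; have /andP[_ vi] := vlam i.
  apply: (@le_trans _ _ (L ^+ 3 * r * distC (word_map S (words_cat v sg) y)
      (word_map S (words_cat v sg) z))).
    rewrite mulrA ler_wpM2r ?distC_ge0// exprS -mulrA ler_pM2l//.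
  by rewrite -[leRHS]mulrA ler_pM2l ?mulr_gt0.
have large i (sg : seq 'I_N) : q1 ^+ (size sg).+1 <= lam (words_cat v (i :: sg)).
  elim: sg i => [|j sg IH] i.
    by rewrite expr1 words_cat_cons /words_cat /= cats0; case/andP: (vlam i).
  rewrite exprS words_cat_cons; apply: le_trans (regular_lamM H _ _).
  apply: ler_pM (IH j); rewrite ?exprn_ge0 ?(ltW q10)//.
  by case/andP: (vlam i).
split=> //.
- split=> //; first by rewrite exprn_gt0//= exprn_ilt1 ?(ltW q10)// -lt0n.
  by rewrite !mulr_gt0 ?exprn_gt0 ?mulr_gt0.
- case=> [[|i sg]] /= szk; first by exfalso; move: szk k0 => /eqP <-.
  by move/eqP: szk => <-; exact: large.
- move=> w; have lw := lam0 w.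
  apply: le_trans (@projected_energy _ M S L rho lam H N Q v r q1 N0 isT r0 q10 _ vsep
    b (e * lam w) w k (mulr_gt0 e0 lw) b1 bN) _.
    by move=> i; case/andP: (vlam i).
  rewrite card_tuple card_ord powR_exprn ?(ltW q10)// -/x natrX -exprM (mulnC k 2).
  have -> : x ^+ k * Q%:R * N%:R ^+ (2 * k) = Q%:R * N%:R ^+ (2 * k) * x ^+ k by ring.
  rewrite ler_wpM2l// ?mulr_ge0 ?exprn_ge0 ?(ltW Nr)//.
  have -> : 8 * (e * lam w) / (lam w * r) = 8 * e / r by field; rewrite !gt_eqF.
  have f1 : N%:R ^- k <= (x / 4) ^+ k.
    by rewrite -exprVn lerXn2r ?nnegrE ?invr_ge0 ?divr_ge0 ?(ltW x0) ?(ltW Nr).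
  have f2 : 8 * e / r * k%:R * b ^+ k <= (128 * L / r * k%:R) * (x / 4) ^+ k.
    have -> : 8 * e / r * k%:R * b ^+ k = (128 * L / r * k%:R) * (L ^+ 3 * r * b) ^+ k.
      by rewrite /e (exprMn k (L ^+ 3 * r) b); ring.
    apply: ler_wpM2l; first by rewrite !mulr_ge0 ?invr_ge0 ?(ltW L0) ?(ltW r0).
    apply: lerXn2r; rewrite ?nnegrE//; last by rewrite divr_ge0 ?(ltW x0).
    by rewrite (mulr_ge0 (mulr_ge0 (ltW L30) (ltW r0)) (ltW b0)).
  pose B := 128 * L / r; have B0 : 0 < B by rewrite divr_gt0 ?mulr_gt0.
  have k2 : k%:R <= 2 ^+ k :> R by rewrite -natrX ler_nat ltnW// ltn_expl.
  have one2 : 1 <= 2 ^+ k :> R by rewrite exprn_ege1// ler1n.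
  have f3 : (1 + B * k%:R) * (x / 4) ^+ k <= x ^+ k / 2.
    have two0 : 0 < 2 ^+ k :> R by rewrite exprn_gt0.
    have -> : (x / 4) ^+ k = x ^+ k / (2 ^+ k * 2 ^+ k).
      by rewrite expr_div_n -exprMn; congr (_ / _ ^+ _); ring.
    have t1 : 1 + B * k%:R <= (1 + B) * 2 ^+ k.
      by rewrite mulrDl mul1r lerD// ler_wpM2l// ltW.
    apply: (@le_trans _ _ ((1 + B) * 2 ^+ k * (x ^+ k / (2 ^+ k * 2 ^+ k)))).
      by rewrite ler_wpM2r// divr_ge0 ?mulr_ge0 ?(ltW xk0) ?(ltW two0).
    have -> : (1 + B) * 2 ^+ k * (x ^+ k / (2 ^+ k * 2 ^+ k)) = x ^+ k * ((1 + B) / 2 ^+ k).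
      by field; rewrite gt_eqF.
    rewrite ler_wpM2l ?(ltW xk0)// ler_pdivrMr// mulrC ler_pdivlMr// mulrC.
    exact: hk.
  by move: f1 f2 f3 kQ; rewrite -/B; clear; lra.
- move=> w t sg sg' y z sy sz; rewrite /collision -ltNge => nc.
  have t01 : 0 <= (t%:R / Q%:R : R) <= 1.
    by rewrite divr_ge0//= ler_pdivrMr// mul1r ler_nat ltnW.
  have close (s2 : k.-tuple 'I_N) u : square u ->
      `|proj (t%:R / Q%:R) (word_map S (w ++ words_cat v s2) u -
        word_map S (w ++ words_cat v s2) 0)| <= 4 * L * (L ^+ 3 * r) ^+ k * lam w.
    move=> su; apply: le_trans (proj_le _ t01) _; rewrite !word_map_cat.
    have s00 := square0 (R := R).
    have d1' := regular_upper H w (word_map_square H (words_cat v s2) su)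
      (word_map_square H (words_cat v s2) s00).
    have d2' := small s2 u 0 su s00; rewrite size_tuple in d2'.
    have d3' := square_dist su s00.
    have Lk : 0 < (L ^+ 3 * r) ^+ k by rewrite exprn_gt0 ?mulr_gt0.
    have d4' := ler_wpM2l (ltW Lk) d3'.
    have d5' := ler_wpM2l (mulr_ge0 (ltW L0) (ltW (lam0 w))) (le_trans d2' d4').
    by move: (le_trans d1' d5'); rewrite /distC; clear; lra.
  move: nc (close sg y sy) (close sg' z sz); rewrite !projB /e.
  set p1' := proj _ _; set p2' := proj _ _; set p3' := proj _ _; set p4' := proj _ _.
  move=> nc k1 k2.
  have : `|p1' - p2'| <= `|p3' - p4'| + `|p3' - p1'| + `|p4' - p2'|.
    have -> : p1' - p2' = (p3' - p4') - (p3' - p1') + (p4' - p2') by ring.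
    by apply: le_trans (ler_normD _ _) _; rewrite lerD2r; exact: ler_normB.
  by move: nc k1 k2; clear; lra.
Qed.

End Alphabet.

(** * Correcting rotations and reflections *)

Section Steering.
Context {R : realType} {M : nat} (S : 'I_M -> R[i] -> R[i]) (lam : seq 'I_M -> R).
Variables (A : 'M[nat]_M) (a0 : 'I_M).
Implicit Types (w v u z : seq 'I_M).

Definition conj_if (b : bool) (x : R[i]) : R[i] := if b then conjc x else x.

Lemma conj_ifB b x y : conj_if b (x - y) = conj_if b x - conj_if b y.
Proof. by rewrite /conj_if; case: b => //; exact: rmorphB. Qed.

Lemma conj_ifM b x y : conj_if b (x * y) = conj_if b x * conj_if b y.
Proof. by rewrite /conj_if; case: b => //; exact: rmorphM. Qed.

Lemma conj_if_addb b c x : conj_if (b (+) c) x = conj_if b (conj_if c x).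
Proof. by case: b; case: c; rewrite //= conjcK. Qed.

Lemma normc_conj_if b x : normc (conj_if b x) = normc x.
Proof. by case: b; case: x => //= a c; rewrite sqrrN. Qed.

Lemma conj_if1 b : conj_if b 1 = 1.
Proof. by rewrite /conj_if; case: b => //; exact: conjc1. Qed.

(** The map of such a word takes its values in the image of [z], where the linear approximation of
    the next map is valid; so these words can be composed. *)
Definition loop_after z w := exists2 v, w = z ++ v & v = [::] \/ loop A a0 v.

Lemma loop_after_cat z w v : loop A a0 z -> loop_after z w -> loop_after z v ->
  loop_after z (w ++ v).
Proof.
move=> zl [w' -> lw] [v' -> lv]; exists (w' ++ z ++ v'); first by rewrite !catA.
have lzv : loop A a0 (z ++ v').
  by case: lv => [->|lv]; [rewrite cats0|exact: loop_cat].
by right; case: lw => [->|lw] //; exact: loop_cat.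
Qed.

Lemma loop_after_loop z w : loop A a0 z -> loop_after z w -> loop A a0 w.
Proof. by move=> zl [v -> [->|lv]]; rewrite ?cats0//; exact: loop_cat. Qed.

(* On the image of [z], the maps [word_map S w] agree up to the relative error
   [eta] with [x |-> mu w * o w * x] or, if [b w], with
   [x |-> mu w * o w * x^*]; the pairs [(b w, o w)] multiply like isometries. *)
Record linearized (z : seq 'I_M) (eta : R) (b : seq 'I_M -> bool)
    (o : seq 'I_M -> R[i]) (mu : seq 'I_M -> R) : Prop := Linearized {
  linearized_loop : loop A a0 z;
  linearized_normc : forall w, loop_after z w -> normc (o w) = 1;
  linearized_lam : forall w, loop_after z w -> lam w <= mu w;
  linearized_error : forall w x y, loop_after z w ->
    (word_map S z @` square) x -> (word_map S z @` square) y ->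
    normc (word_map S w x - word_map S w y - (mu w)%:C%C * o w * conj_if (b w) (x - y))
      <= eta * mu w * normc (x - y);
  linearized_b : forall w v, loop_after z w -> loop_after z v -> b (w ++ v) = b w (+) b v;
  linearized_o : forall w v, loop_after z w -> loop_after z v ->
    normc (o (w ++ v) - o w * conj_if (b w) (o v)) <= eta }.

Variables (z : seq 'I_M) (eta : R) (b : seq 'I_M -> bool) (o : seq 'I_M -> R[i])
  (mu : seq 'I_M -> R).
Hypothesis Hl : linearized z eta b o mu.
Hypothesis eta0 : 0 < eta.

Let zl := linearized_loop Hl.

Let cells : {n : nat & {cell : R -> 'I_n | forall x y : R, `|x| <= 1 -> `|y| <= 1 ->
  cell x = cell y -> `|x - y| <= eta / 2}}.
Proof.
pose k := (Num.truncn (2 / eta)).+1.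
have k0 : 0 < k%:R :> R by rewrite ltr0n.
have ke : k%:R^-1 <= eta / 2.
  rewrite -[eta / 2]invrK lef_pV2 ?posrE ?invr_gt0 ?divr_gt0// invf_div.
  by apply/ltW; exact: truncnS_gt.
exists (k * 2).+1, (fun x => inord (Num.truncn ((x + 1) * k%:R))) => x y /ler_normlP[x1 x2] /ler_normlP[y1 y2].
move/(congr1 val) => /=.
have bnd (u : R) : - u <= 1 -> u <= 1 -> 0 <= (u + 1) * k%:R /\
    (Num.truncn ((u + 1) * k%:R) < (k * 2).+1)%N.
  move=> u1 u2; have p : 0 <= (u + 1) * k%:R by rewrite mulr_ge0 ?(ltW k0)//; lra.
  split=> //; rewrite truncn_lt_nat// -natr1 natrM (mulrC k%:R).
  have : (u + 1) * k%:R <= 2 * k%:R by rewrite ler_pM2r//; lra.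
  lra.
have [px sx] := bnd _ x1 x2; have [py sy] := bnd _ y1 y2.
rewrite !inordK// => e.
have /andP[a1 a2] := truncn_itv px; have /andP[b1 b2] := truncn_itv py.
apply: le_trans ke; rewrite -(ler_pM2r k0) mulVf ?gt_eqF//.
rewrite -(gtr0_norm k0) -normrM; apply/ler_normlP.
move: a1 a2 b1 b2; rewrite e -!natr1; set u := (Num.truncn _)%:R; split; lra.
Qed.

Let n := projT1 cells.
Let cell := sval (projT2 cells).
(** One of finitely many colours; words of equal colour have the same [b] and values of [o] within
    [eta]. *)
Let col w := (b w, (cell (complex.Re (o w)), cell (complex.Im (o w)))).

Let col_close w v : loop_after z w -> loop_after z v -> col w = col v ->
  b w = b v /\ normc (o w - o v) <= eta.
Proof.
move=> zw zv [-> e1 e2]; split=> //; apply: le_trans (normc_le_ReIm _) _; rewrite !raddfB /=.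
have R1 u : loop_after z u -> `|complex.Re (o u)| <= 1.
  by move=> zu; apply: le_trans (Re_le_normc _) _; rewrite (linearized_normc Hl zu).
have I1 u : loop_after z u -> `|complex.Im (o u)| <= 1.
  by move=> zu; apply: le_trans (Im_le_normc _) _; rewrite (linearized_normc Hl zu).
rewrite [eta]splitr; apply: lerD; apply: (svalP (projT2 cells)) => //; [exact: R1|exact: R1|exact: I1|exact: I1].
Qed.

(** The power [w^(k+1)]: exponents start at 1, since the empty word does not begin with the nonempty
    [z]. *)
Let pw w k := iter k (fun u => u ++ w) w.

Let pw_cat w j k : pw w j ++ pw w k = pw w (j + k).+1.
Proof.
elim: k => [|k IH]; first by rewrite addn0.
by rewrite addnS /pw !iterS -/(pw w k) catA IH.
Qed.

Let pw_after w k : loop_after z w -> loop_after z (pw w k).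
Proof. by move=> zw; elim: k => //= k IH; exact: loop_after_cat. Qed.

(** If [w^(2i+1)] and [w^(2j+1)] with [i < j] have the same colour, the quotient [w^(2(j-i))] acts
    almost as the identity. Only every second power is compared, so that this quotient is [w ++ u]
    with [u] a power of positive exponent. *)
Let steer_self w : loop_after z w -> exists u, [/\ loop_after z u, b (w ++ u) = false &
  normc (o (w ++ u) - 1) <= 2 * eta].
Proof.
move=> zw.
have [i [j [ij ce]]] : exists i j, (i < j)%N /\ col (pw w (2 * i)) = col (pw w (2 * j)).
  pose F := [the finType of (bool * ('I_n * 'I_n))%type].
  pose f (i : 'I_#|F|.+1) : F := col (pw w (2 * i)).
  have : ~~ injectiveb f.
    by apply/negP => /injectiveP /leq_card; rewrite card_ord ltnn.
  move=> /injectivePn[i [j ij fe]].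
  have [lt|gt|e] := ltngtP i j; [by exists i, j|by exists j, i|].
  by move: ij => /eqP; case; exact/val_inj.
have zi := pw_after (2 * i) zw; have zj := pw_after (2 * j) zw.
have [be oe] := col_close zi zj ce.
pose k := (2 * (j - i) - 2)%N.
have kE : (2 * (j - i) - 1)%N = k.+1.
  have : (0 < j - i)%N by rewrite subn_gt0.
  by rewrite /k; case: (j - i)%N => // m _; rewrite mulnS addnC addn2 subn2 subn1.
have zk := pw_after k zw; have zk1 := pw_after k.+1 zw.
have k1E : pw w k.+1 = w ++ pw w k by rewrite -[w in RHS]/(pw w 0) pw_cat add0n.
have jE : pw w (2 * j) = pw w (2 * i) ++ pw w k.+1.
  rewrite pw_cat; congr (pw w _); rewrite -kE -addSn -(subnKC (ltnW ij)) mulnDr.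
  rewrite (addnC i) addnK.
  have : (0 < j - i)%N by rewrite subn_gt0.
  by case: (j - i)%N => // m _; rewrite mulnS add2n subn1 /= addnS.
exists (pw w k); rewrite -k1E; split=> //.
  have := linearized_b Hl zi zk1; rewrite -jE be => /(congr1 (addb (b (pw w (2 * j))))).
  by rewrite addbb addbA addbb.
have h := linearized_o Hl zi zk1; rewrite -jE in h.
set B := b (pw w (2 * i)) in h; set oi := o (pw w (2 * i)) in h oe.
have ni : normc oi = 1 by apply: (linearized_normc Hl).
have -> : normc (o (pw w k.+1) - 1) = normc (oi * conj_if B (o (pw w k.+1)) - oi).
  have -> : oi * conj_if B (o (pw w k.+1)) - oi = oi * conj_if B (o (pw w k.+1) - 1).
    by rewrite conj_ifB conj_if1 mulrBr mulr1.
  by rewrite normcM ni mul1r normc_conj_if.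
apply: le_trans (ler_normc_sub (o (pw w (2 * j))) _ _) _.
by rewrite mulr_natl mulr2n; apply: lerD; rewrite normcBC.
Qed.

(* For words [w] of the same colour a single correction works. For one such word
   it is a power of [w]: two of the powers have the same colour. *)
Lemma steering : exists (I : finType) (U : I -> seq 'I_M), (forall i, loop_after z (U i)) /\
  forall w, loop_after z w -> exists i, b (w ++ U i) = false /\
    normc (o (w ++ U i) - 1) <= 5 * eta.
Proof.
pose F := [the finType of (bool * ('I_n * 'I_n))%type].
have /choice[U hU] : forall c : F, exists u, loop_after z u /\
    forall w, loop_after z w -> col w = c ->
      b (w ++ u) = false /\ normc (o (w ++ u) - 1) <= 5 * eta.
  move=> c; have [[w0 [z0 c0]]|nw] := pselect (exists w, loop_after z w /\ col w = c); last first.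
    exists z; split; first by exists [::]; rewrite ?cats0//; left.
    by move=> w zw wc; exfalso; apply: nw; exists w.
  have [u [zu b0 o0]] := steer_self z0; exists u; split=> // w zw wc.
  have [be oe] := col_close zw z0 (etrans wc (esym c0)).
  split; first by rewrite (linearized_b Hl)// be -(linearized_b Hl).
  have h1 := linearized_o Hl zw zu; have h2 := linearized_o Hl z0 zu.
  rewrite be in h1.
  have nu := linearized_normc Hl zu.
  have h3 : normc (o w * conj_if (b w0) (o u) - o w0 * conj_if (b w0) (o u)) <= eta.
    by rewrite -mulrBl normcM normc_conj_if nu mulr1.
  (* Five errors [eta]: one for each of the products [w ++ u] and [w0 ++ u], one for the common
     colour, and two from [steer_self]. *)
  apply: le_trans (ler_normc_sub (o w * conj_if (b w0) (o u)) _ _) _.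
  have := ler_normc_sub (o w0 * conj_if (b w0) (o u)) (o w * conj_if (b w0) (o u)) 1.
  have := ler_normc_sub (o (w0 ++ u)) (o w0 * conj_if (b w0) (o u)) 1.
  rewrite (normcBC (o w0 * _) (o (w0 ++ u))); lra.
exists F, U; split; first by move=> i; have [] := hU i.
by move=> w zw; exists (col w); have [_] := hU (col w); apply.
Qed.

End Steering.

(** * Positive measure of the distance set *)

Section PinnedDistance.
Context {R : realType}.
Implicit Types (x y z h : R[i]).

Definition dot (u v : R[i]) : R := complex.Re u * complex.Re v + complex.Im u * complex.Im v.

Lemma dot_le u v : `|dot u v| <= normc u * normc v.
Proof.
have -> : dot u v = complex.Re (u * conjc v) by case: u v => [a b] [c d] /=; rewrite /dot /=; ring.
apply: le_trans (Re_le_normc _) _; rewrite normcM.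
by have -> : normc (conjc v) = normc v by case: (v) => a b /=; rewrite sqrrN.
Qed.

Lemma sqr_normc_dot z : normc z ^+ 2 = dot z z.
Proof. by case: z => a b /=; rewrite sqr_sqrtr ?addr_ge0 ?sqr_ge0// /dot /= !expr2. Qed.

(** For [a = y - x] and [b = y' - x] the difference of the moduli times [s = |a| + |b|] is the
    scalar product of [a + b] with [a - b]. Here [a + b] and [s] are close to [2 w] and [2 |w|],
    where [w = y0 - x]. *)
Lemma distance_linear x y0 y y' (eta : R) : 0 < eta <= 2^-1 -> 0 < normc (y0 - x) ->
  normc (y - y0) <= eta * normc (y0 - x) -> normc (y' - y0) <= eta * normc (y0 - x) ->
  `|distC x y - distC x y' - dot (y0 - x) (y - y') / normc (y0 - x)| <=
    4 * eta * normc (y - y').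
Proof.
set w := y0 - x; set d := normc w => /andP[eta0 eta1] d0 hy hy'.
pose a := y - x; pose b := y' - x; pose s := normc a + normc b.
have aw : normc (a - w) <= eta * d by have -> : a - w = y - y0 by rewrite /a /w; ring.
have bw : normc (b - w) <= eta * d by have -> : b - w = y' - y0 by rewrite /b /w; ring.
have ha : `|normc a - d| <= eta * d.
  apply/ler_normlP; have := lerB_normc a w; have := lerB_normc w a.
  by rewrite (normcBC w a) -/d => h1 h2; split; lra.
have hb : `|normc b - d| <= eta * d.
  apply/ler_normlP; have := lerB_normc b w; have := lerB_normc w b.
  by rewrite (normcBC w b) -/d => h1 h2; split; lra.
have etad : eta * d <= d / 2 by rewrite mulrC ler_pM2l.
have sd : d <= s.
  by move: ha hb => /ler_normlP[h1 h2] /ler_normlP[h3 h4]; rewrite /s; lra.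
have s0 : 0 < s by apply: lt_le_trans sd.
have ab : y - y' = a - b by rewrite /a /b; ring.
rewrite /distC (normcBC x y) (normcBC x y') -/a -/b ab.
rewrite -(ler_pM2r s0) -{1}(gtr0_norm s0) -normrM.
pose u := a + b - (s / d)%:C%C * w.
have -> : (normc a - normc b - dot w (a - b) / d) * s = dot u (a - b).
  have e1 : (normc a - normc b) * s = dot (a + b) (a - b).
    rewrite /s -subr_sqr !sqr_normc_dot; case: (a) (b) => [a1 a2] [b1 b2].
    by rewrite /dot /=; ring.
  rewrite mulrBl e1 /u; case: (a) (b) (w) => [a1 a2] [b1 b2] [w1 w2].
  by rewrite /dot /=; field; rewrite gt_eqF.
apply: le_trans (dot_le _ _) _.
rewrite (mulrAC _ _ s); apply: ler_wpM2r; first exact: normc_ge0.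
apply: (@le_trans _ _ (4 * (eta * d))); last by rewrite mulrA ler_wpM2l ?mulr_ge0 ?(ltW eta0).
have -> : u = (a - w) + (b - w) + ((2 - s / d)%:C)%C * w by rewrite /u rmorphB /=; ring.
apply: le_trans (le_normcD _ _) _; rewrite normcM normc_real -/d.
have -> : `|2 - s / d| * d = `|2 * d - s|.
  rewrite -{2}(gtr0_norm d0) -normrM; congr `|_|; field; by rewrite gt_eqF.
have := le_normcD (a - w) (b - w).
have : `|2 * d - s| <= 2 * (eta * d).
  by move: ha hb => /ler_normlP[h1 h2] /ler_normlP[h3 h4]; rewrite /s; apply/ler_normlP; split; lra.
lra.
Qed.

(** The unit vector of [w] is its first coordinate [e1] times [(1, t)], up to an error [eta] in the
    second coordinate. Since [t <= 1], a unit vector of almost this slope has [|e1| >= 1/2]. *)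
Lemma dot_proj (t eta : R) w h : 0 <= t <= 1 -> 0 < eta <= 4^-1 -> 0 < normc w ->
  `|complex.Im w - t * complex.Re w| <= eta * normc w ->
  `|proj t h| / 2 - eta * normc h <= `|dot w h / normc w|.
Proof.
move=> /andP[t0 t1] /andP[eta0 eta1] w0 hw.
set d := normc w in w0 hw *.
pose e1 := complex.Re w / d; pose e2 := complex.Im w / d.
have E : dot w h / d = e1 * proj t h + (e2 - t * e1) * complex.Im h.
  by rewrite /dot /e1 /e2 /proj; ring.
have he : `|e2 - t * e1| <= eta.
  have -> : e2 - t * e1 = (complex.Im w - t * complex.Re w) / d by rewrite /e1 /e2; ring.
  by rewrite normrM normfV (gtr0_norm w0) ler_pdivrMr.
have unit : e1 ^+ 2 + e2 ^+ 2 = 1.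
  have : d ^+ 2 = complex.Re w ^+ 2 + complex.Im w ^+ 2 by rewrite /d sqr_normc_dot /dot !expr2.
  move=> hd; rewrite /e1 /e2 !expr_div_n -mulrDl -hd divff// expf_neq0// gt_eqF//.
have e1big : 2^-1 <= `|e1|.
  rewrite leNgt; apply/negP => lt.
  have lt2 : `|e2| < 3 / 4.
    have : `|e2| <= `|e2 - t * e1| + `|e1|.
      apply: le_trans (_ : _ <= `|e2 - t * e1| + `|t * e1|) _.
        by apply: le_trans (ler_normD _ _); rewrite subrK.
      by rewrite lerD2l normrM ger0_norm// ler_piMl.
    lra.
  move: unit; rewrite -(real_normK (num_real e1)) -(real_normK (num_real e2)).
  have := normr_ge0 e1; have := normr_ge0 e2; nra.
rewrite E.
have h1 : `|e1 * proj t h| - `|(e2 - t * e1) * complex.Im h| <= `|e1 * proj t h + (e2 - t * e1) * complex.Im h|.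
  exact: lerB_normD.
have h2 : `|(e2 - t * e1) * complex.Im h| <= eta * normc h.
  by rewrite normrM ler_pM// Im_le_normc.
have h3 : `|proj t h| / 2 <= `|e1 * proj t h|.
  by rewrite normrM mulrC ler_wpM2r.
lra.
Qed.

Lemma pinned_distance_lower x y0 y y' (t eta : R) :
  0 <= t <= 1 -> 0 < eta <= 4^-1 -> 0 < normc (y0 - x) ->
  `|complex.Im (y0 - x) - t * complex.Re (y0 - x)| <= eta * normc (y0 - x) ->
  normc (y - y0) <= eta * normc (y0 - x) -> normc (y' - y0) <= eta * normc (y0 - x) ->
  `|proj t (y - y')| / 2 - 5 * eta * normc (y - y') <= `|distC x y - distC x y'|.
Proof.
move=> t01 /andP[eta0 eta1] w0 hw hy hy'.
have eta2 : 0 < eta <= 2^-1 by rewrite eta0 /=; lra.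
have h1 := distance_linear eta2 w0 hy hy'.
have eta3 : 0 < eta <= 4^-1 by rewrite eta0.
have h2 := dot_proj (y - y') t01 eta3 w0 hw.
have := lerB_dist (dot (y0 - x) (y - y') / normc (y0 - x)) (distC x y - distC x y').
rewrite distrC; lra.
Qed.

End PinnedDistance.

Lemma prefix_loop (M : nat) (A : 'M[nat]_M) (a0 : 'I_M) (a : nat -> 'I_M) n c :
  SFT A a -> a 0%N = a0 -> path (adm A) (a n) c -> adm A (last (a n) c) a0 ->
  loop A a0 (prefix_word a n.+1 ++ c).
Proof.
move=> Sa aa0 cp cl; have [pa la] := SFT_path n Sa; rewrite aa0 in pa la.
exists (prefix_word (fun n => a n.+1) n ++ c); split.
- rewrite -cat_cons; congr (_ ++ _); rewrite /prefix_word /mkseq /= aa0; congr (_ :: _).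
  by rewrite (iotaDl 1 0) -map_comp.
- by rewrite cat_path pa la.
- by rewrite last_cat la.
Qed.

(** In the tree, [v] is the difference of two points seen inside a corrected node and [w] the
    difference of their images. All errors together amount to at most [42 eta L m l], which the
    smallness of [eta L] against [g] keeps well below [g m l / 2]. *)
Lemma proj_perturbed (R : realType) (t m g L l eta : R) (v w : R[i]) :
  0 <= t <= 1 -> 0 < m -> 0 <= l -> 0 <= g ->
  0 <= eta -> eta <= 4^-1 -> 20 * 20 * (eta * L) <= g -> g * l <= `|proj t v| ->
  normc v <= 2 * (L * l) -> normc (w - m%:C%C * v) <= 6 * (eta * m * normc v) ->
  g / 8 * (m * l) <= `|proj t w| / 2 - 5 * eta * normc w.
Proof.
move=> t01 m0 l0 g0 eta0 eta4 etag gp vl err; have nv := normc_ge0 v.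
have prj : m * `|proj t v| - 12 * (eta * m * normc v) <= `|proj t w|.
  have h1 := proj_le (w - m%:C%C * v) t01.
  have h2 : proj t (m%:C%C * v) = m * proj t v.
    by case: (v) => v1 v2; rewrite /proj /=; ring.
  rewrite projB h2 in h1.
  have h3 := lerB_dist (m * proj t v) (proj t w).
  rewrite distrC normrM (gtr0_norm m0) in h3.
  by move: h1 h3 err; lra.
have mv : 0 <= m * normc v by rewrite mulr_ge0// ltW.
have nw : normc w <= 3 * (m * normc v).
  have -> : w = (w - m%:C%C * v) + m%:C%C * v by rewrite subrK.
  apply: le_trans (le_normcD _ _) _; rewrite normcM normc_real gtr0_norm//.
  have h : eta * (m * normc v) <= 4^-1 * (m * normc v) by rewrite ler_wpM2r.
  by move: err h mv; lra.
have eL : eta * (m * normc v) <= 2 * (eta * L) * (m * l).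
  have := ler_wpM2l (mulr_ge0 eta0 (ltW m0)) vl; lra.
have eL2 : 20 * 20 * (eta * L) * (m * l) <= g * (m * l).
  by rewrite ler_wpM2r// mulr_ge0// ltW.
have gp2 := ler_wpM2l (ltW m0) gp.
have ew := ler_wpM2l eta0 nw.
have gml : 0 <= g * (m * l) by rewrite !mulr_ge0// ltW.
by move: prj eL eL2 gp2 ew gml; lra.
Qed.

(** * The tree of corrected cylinders *)

Section DistanceTree.
Context {R : realType}.
Variables (M : nat) (S : 'I_M -> R[i] -> R[i]) (L rho : R) (lam : seq 'I_M -> R).
Hypothesis H : regular_system S L rho lam.
Variable A : 'M[nat]_M.
Hypothesis hA01 : zero_one A.
Hypothesis hA : irreducible_mx A.
Variable a0 : 'I_M.
Hypothesis ncov : forall s : R, 0 <= s -> s < 1 -> ~ small_cover distC s (limit_set S A).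
Hypothesis lin : forall eta : R, 0 < eta ->
  exists z b o mu, linearized S lam A a0 z eta b o mu.

Definition parallel_to (t eta : R) (w : R[i]) : Prop :=
  0 < normc w /\ `|complex.Im w - t * complex.Re w| <= eta * normc w.

Hypothesis dense : forall z, loop A a0 z -> forall t eta : R, 0 <= t <= 1 -> 0 < eta ->
  exists a b, [/\ SFT A a, SFT A b, a 0%N = a0, b 0%N = a0 &
    parallel_to t eta (coding S (wcat z b) - coding S (wcat z a))].

Let L0 : 0 < L. Proof. exact: lt_le_trans (regular_L H). Qed.
Let L1 : 1 <= L. Proof. exact: (regular_L H). Qed.
Let lam0 w : 0 < lam w. Proof. exact: (regular_lam_gt0 H). Qed.

Lemma loop_nth (w : seq 'I_M) (x : 'I_M) l : loop A a0 w -> (l.+1 < size w)%N ->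
  A (nth x w l) (nth x w l.+1) = 1%N.
Proof.
move=> [p [-> pp _]] /= lp; apply/eqP; rewrite (set_nth_default a0)//=; last exact: ltnW.
rewrite (set_nth_default a0 x)//.
by move/pathP: pp => /(_ a0 l lp).
Qed.

Lemma limit_word (W : nat -> seq 'I_M) : (forall k, loop A a0 (W k)) ->
  (forall k, (k <= size (W k))%N) -> (forall k, exists v, W k.+1 = W k ++ v) ->
  exists2 a, SFT A a & forall k, prefix_word a (size (W k)) = W k.
Proof.
move=> Wl Ws Wp; pose a n := nth a0 (W n.+1) n.
have Wle j d : exists v, W (j + d)%N = W j ++ v.
  elim: d => [|d [v hv]]; first by exists [::]; rewrite addn0 cats0.
  have [u hu] := Wp (j + d)%N; exists (v ++ u).
  by rewrite addnS hu hv catA.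
exists a; last first.
  move=> k; apply: (@eq_from_nth _ a0); first by rewrite size_mkseq.
  rewrite size_mkseq => i ik; rewrite nth_mkseq// /a.
  have [le|lt] := leqP i.+1 k.
    have [v hv] := Wle i.+1 (k - i.+1)%N; rewrite subnKC// in hv.
    by rewrite hv nth_cat Ws.
  have [v hv] := Wle k (i.+1 - k)%N; rewrite subnKC ?(ltnW lt)// in hv.
  by rewrite hv nth_cat ik.
move=> l; have -> : a l = nth a0 (W l.+2) l.
  by have [v hv] := Wp l.+1; rewrite hv nth_cat Ws.
exact: loop_nth.
Qed.

Section Node.
Variables (N k : nat) (v : 'I_N -> seq 'I_M) (q : R).
Hypothesis vl : forall i, loop A a0 (v i).
Hypothesis q0 : 0 < q.
Hypothesis lamv : forall sg : k.-tuple 'I_N, q <= lam (words_cat v sg).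

Definition block_word (tau : seq (k.-tuple 'I_N)) : seq 'I_M :=
  words_cat v (flatten [seq tval x | x <- tau]).

Lemma block_word_cat tau tau' : block_word (tau ++ tau') = block_word tau ++ block_word tau'.
Proof. by rewrite /block_word map_cat flatten_cat words_cat_cat. Qed.

Lemma block_word_cons x tau : block_word (x :: tau) = words_cat v x ++ block_word tau.
Proof. by rewrite /block_word /= words_cat_cat. Qed.

Lemma words_cat_loop sg : words_cat v sg = [::] \/ loop A a0 (words_cat v sg).
Proof.
elim: sg => [|i sg IH]; first by left.
right; rewrite words_cat_cons; case: IH => [->|h]; first by rewrite cats0.
exact: loop_cat.
Qed.

Lemma lam_block_word z tau : lam z * q ^+ size tau <= lam (z ++ block_word tau).
Proof.
elim: tau z => [|x tau IH] z; first by rewrite mulr1 cats0.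
rewrite block_word_cons catA; apply: le_trans (IH _).
rewrite /= exprS mulrA ler_wpM2r ?exprn_ge0 ?(ltW q0)//.
apply: le_trans (regular_lamM H _ _); rewrite ler_pM2l//; exact: lamv.
Qed.

End Node.

Lemma distance_set_measure (s : R) : 0 <= s -> s < 1 ->
  hausdorff_measure distR s (distance_set (limit_set S A)) != 0%E.
Proof.
move=> s0 s1; pose s2 := (s + 1) / 2; pose s3 := (s2 + 1) / 2.
have ss2 : s < s2 by rewrite /s2; lra.
have s21 : s2 < 1 by rewrite /s2; lra.
have s23 : s2 < s3 by rewrite /s3; lra.
have s31 : s3 < 1 by rewrite /s3; lra.
have s20 : 0 < s2 by apply: le_lt_trans ss2.
have s30 : 0 < s3 by apply: lt_trans s23.
have [N [k [Q [v [q [e [g [[N0 Q0 /andP[q0 q1] g0] vl lamv energy gap]]]]]]]] :=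
  separating_alphabet H hA01 hA a0 ncov s30 s31.
pose eta := Num.min 4^-1 (g / (20 * 20 * L)).
have twL : 0 < 20 * 20 * L by rewrite !mulr_gt0 ?ltr0n.
have eta0 : 0 < eta by rewrite lt_min invr_gt0 ltr0n (divr_gt0 g0 twL).
have eta4 : eta <= 4^-1 by rewrite ge_min lexx.
have etag : 20 * 20 * (eta * L) <= g.
  have : eta <= g / (20 * 20 * L) by rewrite ge_min lexx orbT.
  by rewrite ler_pdivlMr// => h; apply: le_trans h; apply: eq_ler; ring.
have [z [b [om [mu Hl]]]] := lin eta0.
have zl := linearized_loop Hl.
have zz : loop_after A a0 z z by exists [::]; rewrite ?cats0//; left.
have [I [U [Ul hU]]] := steering Hl eta0.
have [i0 _] := hU z zz.
pose good w := b w = false /\ normc (om w - 1) <= 5 * eta.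
have /choice[st hst] : forall w, exists i, loop_after A a0 z w -> good (w ++ U i).
  move=> w; have [zw|nzw] := pselect (loop_after A a0 z w); last by exists i0.
  by have [i hi] := hU w zw; exists i.
have [kap kap0 hkap] := pos_lower_bound (fun i => lam0 (U i)).
have kap1 : kap <= 1 by apply: le_trans (hkap i0) (lam_le1 H _).
have lz1 : lam z <= 1 by exact: (lam_le1 H).
pose B := (q `^ (s3 - s2))^-1.
have qs0 : 0 < q `^ (s3 - s2) by rewrite powR_gt0.
have B1 : 1 < B.
  have : q `^ (s3 - s2) < 1 `^ (s3 - s2).
    by apply: gt0_ltr_powR; rewrite ?subr_gt0 ?nnegrE ?(ltW q0).
  by rewrite powR1 invf_gt1.
have lzk : 0 < (lam z * kap) `^ s2 by rewrite powR_gt0 ?mulr_gt0.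
(* [B^n = q^(-n (s3 - s2))] has to outweigh the cost of [z] and of one correction at exponent [s2];
   the summand 2 guarantees at least two branches. *)
have [n hn] := natr_expr_ge (2 + ((lam z * kap) `^ s2)^-1) B1.
have lzk' : 0 < ((lam z * kap) `^ s2)^-1 by rewrite invr_gt0.
have n0 : (0 < n)%N.
  by rewrite lt0n; apply/eqP => n0; move: hn; rewrite n0 expr0; lra.
pose V := (k.-tuple 'I_N : finType).
pose wd := @block_word N k v.
pose coll (t : 'I_Q) (sg : seq V) : rel V :=
  fun x y => collision S v (e * lam (z ++ wd sg)) (z ++ wd sg) t x y.
have V0 : (0 < #|V|)%N by rewrite card_tuple card_ord expn_gt0 N0.
have D0 : (0 < #|'I_Q|)%N by rewrite card_ord.
have K0 : 0 < q `^ s3 by rewrite powR_gt0.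
have csym t sg : symmetric (coll t sg).
  by move=> x y; rewrite /coll /collision !projB distrC.
(* A letter collides with itself only if [e] is nonnegative. Otherwise [gap], applied to two equal
   points, would give a positive lower bound for 0. *)
have cself t sg x : coll t sg x x.
  rewrite /coll /collision subrr /proj /= mulr0 addr0 normr0.
  have e0 : 0 <= e; last by rewrite mulr_ge0// ltW.
  rewrite leNgt; apply/negP => e0.
  have := gap [::] t x x 0 0 (square0 (R := R)) (square0 (R := R)).
  rewrite /collision !subrr /proj /= mulr0 addr0 normr0 -ltNge pmulr_llt0// => /(_ e0).
  by rewrite leNgt mulr_gt0.
have cle sg : \sum_t \sum_x (#|[set y | (y == x) || coll t sg x y]%SET|)%:R <=
    q `^ s3 * #|'I_Q|%:R * #|V|%:R ^+ 2 :> R.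
  rewrite card_ord; apply: le_trans (energy (z ++ wd sg)).
  apply: ler_sum => t _; apply: ler_sum => x _.
  rewrite -sum1_card natr_sum big_mkcond /=.
  apply: ler_sum => y _; rewrite inE; case: eqP => [->|_] /=.
    by rewrite -/(coll t sg x x) cself.
  by rewrite -/(coll t sg x y); case: (coll t sg x y).
have [t [T [Tu Ts Tsep Tm]]] := exists_separated_words V0 D0 K0 csym cle n.
pose m := size T.
have m2 : 2 + ((lam z * kap) `^ s2)^-1 <= m%:R.
  apply: le_trans hn (le_trans _ Tm); apply: lerXn2r; rewrite ?nnegrE ?invr_ge0 ?powR_ge0//.
  rewrite lef_pV2 ?posrE//; apply: ger_powR; first by rewrite q0 ltW.
  lra.
have m1 : (1 < m)%N.
  by rewrite -(ltr_nat R); move: m2 lzk'; lra.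
(* A lower bound for the scale of one step: the word [z], then [n] letters, then a correction. *)
pose Qt := lam z * q ^+ n * kap.
have qn0 : 0 < q ^+ n by rewrite exprn_gt0.
have Qt0 : 0 < Qt by rewrite !mulr_gt0.
have Qt1 : 0 < Qt < 1.
  rewrite Qt0 /= /Qt; apply: (@le_lt_trans _ _ (q ^+ n)).
    by rewrite mulrAC ler_piMl ?(ltW qn0)// mulr_ile1 ?(ltW kap0) ?(ltW (lam0 z)).
  by rewrite exprn_ilt1 ?(ltW q0)// -lt0n.
have mQ : 1 <= m%:R * Qt `^ s2.
  have -> : Qt = q ^+ n * (lam z * kap) by rewrite /Qt; ring.
  rewrite powRM ?mulr_ge0 ?(ltW (lam0 z)) ?(ltW qn0) ?(ltW kap0)//.
  rewrite powR_exprn ?(ltW q0)// mulrA -ler_pdivrMr// mul1r.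
  have qs2 : 0 < (q `^ s2) ^+ n by rewrite exprn_gt0// powR_gt0.
  rewrite -ler_pdivrMr//.
  apply: le_trans Tm; apply: (@le_trans _ _ (B ^+ n / (q `^ s2) ^+ n)).
    by rewrite ler_wpM2r ?invr_ge0 ?(ltW qs2)//; apply: le_trans hn; rewrite lerDr.
  rewrite /B -exprVn -exprMn -invfM -powRD ?subrK//.
  by rewrite (gt_eqF q0) implybT.
have t01 : 0 <= (t%:R / Q%:R : R) <= 1.
  by rewrite divr_ge0//= ler_pdivrMr ?ltr0n// mul1r ler_nat ltnW.
(* The pin is [x], and [y0 - x] has almost slope [t]. The tree grows inside a cylinder that contains
   [y0] and is so small that on it the distance to [x] is almost linear. *)
have [al [be [Sal Sbe al0 be0 [d0 par]]]] := dense zl t01 eta0.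
set x := coding S (wcat z al) in d0 par; set y0 := coding S (wcat z be) in d0 par.
have ed : 0 < eta * normc (y0 - x) / 2 by rewrite divr_gt0 ?mulr_gt0.
have [j hj] := expr_lt_eps (regular_rho H) ed.
pose pj := prefix_word be j.+1.
have [c [cp ca]] := adm_connect hA hA01 (be j) a0.
pose W0 := z ++ pj ++ c.
have zW0 : loop_after A a0 z W0.
  exists (pj ++ c) => //; right; exact: prefix_loop.
pose W00 := W0 ++ U (st W0).
(* The correction is chosen for the whole word from the root, so rotation errors do not accumulate
   with the depth. The inserted [z] keeps all factors of the form [loop_after]. *)
pose step W tau := (W ++ z ++ wd tau) ++ U (st (W ++ z ++ wd tau)).
have zwd tau : loop_after A a0 z (z ++ wd tau).
  by exists (wd tau) => //; exact: words_cat_loop.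
have zstep W tau : loop_after A a0 z W -> loop_after A a0 z (step W tau) /\ good (step W tau).
  move=> zW; have zW1 : loop_after A a0 z (W ++ z ++ wd tau) by exact: loop_after_cat.
  by split; [exact: loop_after_cat|exact: hst].
pose node (bt : nat -> 'I_m) := fix node k := if k is k'.+1 then step (node k') (nth [::] T (bt k'))
  else W00.
have znode bt i : loop_after A a0 z (node bt i) /\ good (node bt i).
  elim: i => [|i [IH _]] /=; last exact: zstep.
  by split; [exact: loop_after_cat|exact: hst].
have z0 : (0 < size z)%N by have [p [-> _ _]] := zl.
have node_size bt i : (i <= size (node bt i))%N.
  elim: i => //= i IH; rewrite /step !size_cat -addnA -addn1 leq_add//.
  by rewrite -addnA addn_gt0 z0.
have /choice[word hword] : forall bt : nat -> 'I_m, exists a, SFT A a /\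
    forall k, prefix_word a (size (node bt k)) = node bt k.
  move=> bt; have [|||a Sa ha] := @limit_word (node bt).
  - by move=> i; have [zn _] := znode bt i; exact: loop_after_loop zn.
  - exact: node_size.
  - by move=> i; eexists; rewrite /= /step -catA; reflexivity.
  - by exists a.
pose f y := distC x y.
pose ev bt := f (coding S (word bt)).
have lx : limit_set S A x by exists (wcat z al) => //; exact: (loop_SFT zl al0 Sal).
have node_lam bt i : lam W00 * Qt ^+ i <= lam (node bt i).
  elim: i => [|i IH]; first by rewrite mulr1.
  rewrite exprSr mulrA /= /step.
  apply: le_trans (regular_lamM H _ _); rewrite /Qt mulrA.
  have i_m : (bt i < size T)%N by [].
  apply: ler_pM; rewrite ?mulr_ge0 ?exprn_ge0 ?(ltW Qt0) ?(ltW (lam0 _)) ?(ltW q0) ?(ltW kap0)//.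
  apply: le_trans (regular_lamM H _ _).
  apply: ler_pM; rewrite ?mulr_ge0 ?exprn_ge0 ?(ltW Qt0) ?(ltW (lam0 _)) ?(ltW q0)//.
  rewrite -[n in q ^+ n](Ts (nth [::] T (bt i))) ?mem_nth//.
  exact: lam_block_word.
have node_eq bt bt' i : (forall l, (l < i)%N -> bt l = bt' l) -> node bt i = node bt' i.
  elim: i => //= i IH h; rewrite IH; last by move=> l li; apply/h/ltnW.
  by rewrite h.
have c0 : 0 < lam W00 * (lam z * q ^+ n * (g / 8)) by rewrite !mulr_gt0 ?divr_gt0.
have s02 : 0 <= s <= s2 by rewrite s0 ltW.
apply: (hausdorff_measure_tree m1 Qt1 c0 mQ (e := ev) _ _ s02).
  move=> bt; exists (x, coding S (word bt)) => //; split=> //.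
  by exists (word bt) => //; have [] := hword bt.
move=> i bt bt' hi ne.
have nE := node_eq bt bt' i hi.
set W := node bt i in nE *.
have [zW [bW oW]] : loop_after A a0 z W /\ good W := znode bt i.
have lW : lam W00 * Qt ^+ i <= lam W := node_lam bt i.
pose tau := nth [::] T (bt i); pose tau' := nth [::] T (bt' i).
have tT : tau \in T by rewrite mem_nth.
have tT' : tau' \in T by rewrite mem_nth.
have tne : tau != tau' by rewrite nth_uniq.
have [r [v1 [v2 [w1 [w2 [tE tE' v12 nc]]]]]] := Tsep _ _ tT tT' tne.
rewrite cat0s in nc.
pose wr := z ++ wd r.
(* Both codings pass through the node [W] and the common letters [r] up to the first separated pair
   [v1], [v2]. The linear approximation of [W] applies to the preimages, which lie in the image of
   [z]. *)
have point bt2 W2 tau2 vv ww : node bt2 i = W2 -> nth [::] T (bt2 i) = tau2 ->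
    tau2 = r ++ vv :: ww -> exists2 x1, square x1 & coding S (word bt2) =
      word_map S W2 (word_map S (wr ++ words_cat v vv) x1) /\ 
      (word_map S z @` square) (word_map S (wr ++ words_cat v vv) x1).
  move=> e1 e2 e3; have [_ hw] := hword bt2.
  have := coding_mem H (word bt2) (size (node bt2 i.+1)); rewrite hw.
  move=> [x1 sx1 hx1]; move: hx1; rewrite /= e1 e2 e3 /step /wd block_word_cat block_word_cons.
  rewrite !word_map_cat; set u := word_map S (U _) x1 => hx1.
  have su : square u by exact: (word_map_square H).
  exists (word_map S (block_word v ww) u); first exact: (word_map_square H).
  rewrite -hx1 /wr /wd !word_map_cat; split=> //.
  eexists; last by reflexivity.
  by do 3 ! apply: (word_map_square H).
have [x1 sx1 [y1 yz1]] := point bt W tau v1 w1 erefl erefl tE.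
have [x2 sx2 [y2 yz2]] := point bt' W tau' v2 w2 (esym nE) erefl tE'.
set p1 := word_map S _ x1 in y1 yz1; set p2 := word_map S _ x2 in y2 yz2.
have near0 bt2 : normc (coding S (word bt2) - y0) <= eta * normc (y0 - x).
  have [_ hw] := hword bt2.
  have h1 : (word_map S (z ++ pj) @` square) (coding S (word bt2)).
    apply: (image_cat_sub H (v := c ++ U (st W0))); rewrite catA -[(z ++ pj) ++ c]catA.
    by have := coding_mem H (word bt2) (size (node bt2 0)); rewrite hw.
  have h2 : (word_map S (z ++ pj) @` square) y0.
    by have := coding_mem H (wcat z be) (size z + j.+1); rewrite prefix_wcat.
  apply: le_trans (image_square_dist_rho H h1 h2) _.
  rewrite size_cat size_prefix addnS.
  have rho0 : 0 <= rho by case/andP: (regular_rho H).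
  have rho1 : rho <= 1 by case/andP: (regular_rho H) => _ /ltW.
  have : rho ^+ (size z + j).+1 <= rho ^+ j by apply: ler_wiXn2l => //; apply/leqW/leq_addl.
  by move: hj; rewrite ltr_pdivlMr// => /ltW hj' hr; apply: le_trans hj'; rewrite mulrC ler_pM2r.
have eta04 : 0 < eta <= 4^-1 by rewrite eta0.
have low := pinned_distance_lower t01 eta04 d0 par (near0 bt) (near0 bt').
pose Lam := lam wr.
have Lam0 : 0 < Lam := lam0 wr.
have LamE : lam z * q ^+ n <= Lam.
  apply: le_trans (lam_block_word q0 lamv z r); rewrite ler_pM2l//.
  apply: ler_wiXn2l; rewrite ?(ltW q0) ?(ltW q1)//.
  by rewrite -(Ts _ tT) tE size_cat leq_addr.
have gp : g * Lam <= `|proj (t%:R / Q%:R) (p1 - p2)|.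
  by apply: gap nc.
have pp : normc (p1 - p2) <= 2 * (L * Lam).
  apply: (image_square_dist H (w := wr)).
    by exists (word_map S (words_cat v v1) x1); [exact: (word_map_square H)|rewrite -word_map_cat].
  by exists (word_map S (words_cat v v2) x2); [exact: (word_map_square H)|rewrite -word_map_cat].
have muW : lam W <= mu W := linearized_lam Hl zW.
have mu0 : 0 < mu W by apply: lt_le_trans muW.
(* One [eta] comes from the linear approximation of [W], five from its corrected rotation. *)
have err : normc (coding S (word bt) - coding S (word bt') - (mu W)%:C%C * (p1 - p2)) <=
    6 * (eta * mu W * normc (p1 - p2)).
  have := linearized_error Hl zW yz1 yz2; rewrite -y1 -y2 bW /= => h1.
  have h2 : normc ((mu W)%:C%C * om W * (p1 - p2) - (mu W)%:C%C * (p1 - p2)) <=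
      5 * (eta * mu W * normc (p1 - p2)).
    have -> : (mu W)%:C%C * om W * (p1 - p2) - (mu W)%:C%C * (p1 - p2) =
      (om W - 1) * ((mu W)%:C%C * (p1 - p2)) by ring.
    rewrite !normcM normc_real gtr0_norm//.
    have -> : 5 * (eta * mu W * normc (p1 - p2)) = 5 * eta * (mu W * normc (p1 - p2)) by ring.
    by rewrite ler_wpM2r// mulr_ge0 ?(ltW mu0)// normc_ge0.
  apply: le_trans (ler_normc_sub ((mu W)%:C%C * om W * (p1 - p2)) _ _) _.
  by apply: le_trans (lerD h1 h2) _; apply: eq_ler; ring.
have fin := le_trans (proj_perturbed t01 mu0 (ltW Lam0) (ltW g0) (ltW eta0) eta4 etag gp pp err) low.
apply: le_trans fin.
have -> : lam W00 * (lam z * q ^+ n * (g / 8)) * Qt ^+ i =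
  g / 8 * ((lam W00 * Qt ^+ i) * (lam z * q ^+ n)) by ring.
rewrite ler_pM2l ?divr_gt0//.
apply: ler_pM => //; rewrite ?mulr_ge0 ?exprn_ge0 ?(ltW (lam0 _)) ?(ltW Qt0) ?(ltW q0)//.
exact: le_trans muW.
Qed.

End DistanceTree.

(** * Cylinders in Lipschitz graphs *)

Section LineCovers.
Context {R : realType}.
Implicit Types (P : set R) (s k l u v : R).

Lemma powRD_gt0 (x r t : R) : 0 < x -> x `^ (r + t) = x `^ r * x `^ t.
Proof. by move=> x0; rewrite powRD// (gt_eqF x0) implybT. Qed.

Lemma small_cover_subsingleton (T : Type) (d : T -> T -> R) s (E : set T) :
  0 < s -> (forall x y, E x -> E y -> d x y <= 0) -> small_cover d s E.
Proof.
move=> s0 dE e e0; have [b b0 hb] := powR_small s0 e0.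
have m0 : 0 < Num.min b e by rewrite lt_min b0.
have h0 : 0 < Num.min b e / 2 by rewrite divr_gt0.
have hm : Num.min b e / 2 < Num.min b e by rewrite ltr_pdivrMr// ltr_pMr// ltr1n.
exists unit, (fun=> E), (fun=> Num.min b e / 2); split.
- by move=> x Ex; exists tt.
- by move=> _; rewrite h0 (le_trans (ltW hm))// ge_min lexx orbT.
- by move=> _ x y Ex Ey; apply: le_trans (dE x y Ex Ey) (ltW h0).
- by rewrite big_const /= card_unit /= addr0 hb// (lt_le_trans hm)// ge_min lexx.
Qed.

Lemma small_cover_interval s u l P : 1 < s -> 0 < l ->
  (forall p, P p -> u <= p <= u + l) -> small_cover distR s P.
Proof.
move=> s1 l0 hP e e0; have s0 : 0 < s - 1 by rewrite subr_gt0.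
have [b b0 hb] := powR_small s0 (divr_gt0 e0 (mulr_gt0 l0 (ltr0Sn R 1))).
pose m := Num.min b e; have m0 : 0 < m by rewrite lt_min b0.
pose n := (Num.truncn (l / m)).+1.
have n0 : 0 < n%:R :> R by rewrite ltr0n.
have ln : l / n%:R < m.
  rewrite ltr_pdivrMr// mulrC -ltr_pdivrMr//.
  by have := truncnS_gt (l / m).
have ln0 : 0 < l / n%:R by rewrite divr_gt0.
(* One piece more than [n], because truncation assigns the index [n] to the right end point. *)
exists 'I_n.+1, (fun i : 'I_n.+1 => [set p | u + i%:R * (l / n%:R) <= p <= u + i.+1%:R * (l / n%:R)]),
  (fun=> l / n%:R); split.
- move=> p /hP /andP[up pl]; pose k := Num.truncn ((p - u) / (l / n%:R)).
  have pu : 0 <= (p - u) / (l / n%:R) by rewrite divr_ge0 ?subr_ge0 ?(ltW ln0).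
  have /andP[k1 k2] := truncn_itv pu; rewrite -/k in k1 k2.
  have kn : (k < n.+1)%N.
    rewrite ltnS -(ler_nat R); apply: le_trans k1 _; rewrite ler_pdivrMr// mulrCA divff ?gt_eqF// mulr1.
    by rewrite lerBlDl.
  exists (Ordinal kn) => /=; move: k1 k2; rewrite ler_pdivlMr// ltr_pdivrMr// => k1 /ltW k2.
  by rewrite -lerBrDl k1 -lerBlDl.
- move=> i; rewrite ln0 (le_trans (ltW ln))// ge_min lexx orbT//.
- move=> i x y /= /andP[x1 x2] /andP[y1 y2]; rewrite /distR; move: x1 x2 y1 y2.
  by rewrite -natr1 mulrDl mul1r => x1 x2 y1 y2; apply/ler_normlP; split; lra.
- rewrite sumr_card card_ord.
  have -> : (l / n%:R) `^ s = l / n%:R * (l / n%:R) `^ (s - 1).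
    rewrite [in LHS](_ : s = 1 + (s - 1)); last by rewrite addrC subrK.
    by rewrite (powRD_gt0 1)// powRr1 ?(ltW ln0).
  have h : (l / n%:R) `^ (s - 1) <= e / (l * 2).
    by apply: hb => //; apply: (lt_le_trans ln); rewrite ge_min lexx.
  apply: (@le_trans _ _ (n.+1%:R * (l / n%:R * (e / (l * 2))))).
    by rewrite ler_wpM2l// ler_wpM2l// ltW.
  have -> : n.+1%:R * (l / n%:R * (e / (l * 2))) = e * (n.+1%:R / n%:R / 2).
    by field; rewrite !gt_eqF.
  rewrite ler_piMr ?(ltW e0)// ler_pdivrMr// mul1r ler_pdivrMr// -natrM ler_nat.
  by rewrite mul2n -addnn -addn1 leq_add2l.
Qed.

(** Margins on both sides are part of the notion, so that each of the two remaining intervals keeps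
    at least the proportion [k] of the length. *)
Definition has_gap P k u v := exists u' v', [/\ u + k * (v - u) <= u',
  u' + k * (v - u) <= v', v' + k * (v - u) <= v & forall p, P p -> ~ u' < p < v'].

(** Removing a gap from an interval of length [w] leaves two pieces of lengths [x, y >= k w] with
    [x + y <= (1 - k) w]. For [s = 1 - t] this yields [x^s + y^s <= (1 - k) k^(-t) w^s], and [t] is
    so small that [k^(-t) <= 1 + k]. Each removal thus multiplies the sum by at most [1 - k^2]. *)
Lemma porous_small_cover P k l u0 : 0 < k -> 0 < l ->
  (forall u v, u < v -> v <= u + l -> has_gap P k u v) ->
  (forall p, P p -> u0 <= p <= u0 + l) ->
  exists2 s, 0 <= s < 1 & small_cover distR s P.
Proof.
move=> k0 l0 gaps hP.
have k3 : 3 * k <= 1.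
  have [|u' [v' [h1 h2 h3 _]]] := gaps u0 (u0 + l) _ (lexx _); first by rewrite ltrDl.
  have : 3 * k * l <= 1 * l by lra.
  by rewrite ler_pM2r.
have [n hn] : exists n, k^-1 <= (1 + k) ^+ n by apply: natr_expr_ge; rewrite ltrDl.
pose t : R := n.+1%:R^-1; pose s := 1 - t.
have t0 : 0 < t by rewrite invr_gt0 ltr0n.
have t1 : t <= 1 by rewrite invf_le1 ?ltr0n// ler1n.
have s01 : 0 <= s < 1 by rewrite subr_ge0 t1 ltrBlDr ltrDl.
exists s => //.
have kt : k `^ (- t) <= 1 + k.
  have k1 : k^-1 <= (1 + k) ^+ n.+1.
    by apply: le_trans hn _; rewrite exprSr ler_peMr ?exprn_ge0 ?addr_ge0 ?(ltW k0)// lerDl ltW.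
  have -> : 1 + k = ((1 + k) ^+ n.+1) `^ t.
    rewrite -powR_mulrn ?addr_ge0 ?(ltW k0)// -powRrM mulfV ?powRr1 ?addr_ge0 ?(ltW k0)//.
  have -> : k `^ (- t) = k^-1 `^ t by rewrite -(powR_inv1 (ltW k0)) -powRrM mulN1r.
  by apply: ge0_ler_powR; rewrite ?nnegrE ?(ltW t0) ?invr_ge0 ?exprn_ge0 ?addr_ge0 ?(ltW k0).
have kk : (1 - k) * (1 + k) < 1 by rewrite -subr_gt0; have := mulr_gt0 k0 k0; lra.
pose g := (1 - k) * (1 + k).
have g0 : 0 <= g by rewrite mulr_ge0//; lra.
have cov m u v : u < v -> v <= u + l -> exists (I : finType) (V : I -> set R) (r : I -> R),
  [/\ forall p, P p -> u <= p <= v -> exists i, V i p,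
      forall i, 0 < r i <= (1 - k) ^+ m * (v - u),
      forall i x y, V i x -> V i y -> distR x y <= r i
    & \sum_i (r i) `^ s <= g ^+ m * (v - u) `^ s].
  elim: m u v => [|m IH] u v uv vl.
    exists unit, (fun=> [set p | u <= p <= v]), (fun=> v - u); split.
    - by move=> p _ h; exists tt.
    - by move=> _; rewrite subr_gt0 uv mul1r lexx.
    - move=> _ x y /= /andP[? ?] /andP[? ?]; rewrite /distR; apply/ler_normlP; split; lra.
    - by rewrite big_const /= card_unit /= addr0 mul1r.
  have [u' [v' [h1 h2 h3 hg]]] := gaps u v uv vl.
  have vu : 0 < v - u by rewrite subr_gt0.
  have kvu : 0 < k * (v - u) by rewrite mulr_gt0.
  have uu' : u < u' by lra.
  have v'v : v' < v by lra.
  have [|I1 [V1 [r1 [c1 b1 d1 e1]]]] := IH u u' uu'; first by lra.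
  have [|I2 [V2 [r2 [c2 b2 d2 e2]]]] := IH v' v v'v; first by lra.
  exists (I1 + I2)%type, (fun i => match i with inl j => V1 j | inr j => V2 j end),
    (fun i => match i with inl j => r1 j | inr j => r2 j end).
  have km : 0 <= (1 - k) ^+ m by rewrite exprn_ge0//; lra.
  split.
  - move=> p Pp /andP[up pv]; have [pu'|u'p] := leP p u'.
      by have [|i hi] := c1 p Pp; [rewrite up|exists (inl i)].
    have [v'p|pv'] := leP v' p.
      by have [|i hi] := c2 p Pp; [rewrite v'p|exists (inr i)].
    by case: (hg p Pp); rewrite u'p.
  - move=> [i|i].
      have /andP[-> h] := b1 i; apply: le_trans h _; rewrite exprSr -mulrA ler_wpM2l//; lra.
    have /andP[-> h] := b2 i; apply: le_trans h _; rewrite exprSr -mulrA ler_wpM2l//; lra.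
  - by move=> [i|i] x y; [exact: d1|exact: d2].
  - rewrite big_sumType /=; apply: le_trans (lerD e1 e2) _.
    rewrite -mulrDr exprSr -mulrA ler_wpM2l ?exprn_ge0//.
    have key x : k * (v - u) <= x -> x `^ s <= x * (v - u) `^ (- t) * (1 + k).
      move=> hx; have x0 : 0 < x by lra.
      rewrite /s (powRD_gt0 1)// powRr1 ?(ltW x0)// -mulrA ler_pM2l//.
      apply: (@le_trans _ _ ((k * (v - u)) `^ (- t))).
        rewrite !powRN lef_pV2 ?posrE ?powR_gt0//.
        by apply: ge0_ler_powR; rewrite ?nnegrE ?(ltW t0) ?(ltW x0) ?(ltW kvu).
      by rewrite powRM ?(ltW k0) ?(ltW vu)// mulrC ler_wpM2l// powR_ge0.
    have -> : (v - u) `^ s = (v - u) * (v - u) `^ (- t).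
      by rewrite /s (powRD_gt0 1)// powRr1 ?(ltW vu).
    have k1 := key (u' - u); have k2 := key (v - v').
    apply: le_trans (lerD (k1 _) (k2 _)) _; [lra|lra|].
    set y := (v - u) `^ (- t).
    have y0 : 0 <= y * (1 + k) by rewrite mulr_ge0 ?powR_ge0// addr_ge0 ?(ltW k0).
    have -> : g * ((v - u) * y) = ((1 - k) * (v - u)) * (y * (1 + k)) by rewrite /g; ring.
    rewrite -[_ * y * _]mulrA -[(v - v') * y * _]mulrA -mulrDl ler_wpM2r//; move: h2; lra.
move=> e e0.
have k1 : 0 <= 1 - k < 1 by lra.
have g1 : 0 <= g < 1 by rewrite g0.
have L0 : 0 < l `^ s by rewrite powR_gt0.
have [m1 hm1] := expr_lt_eps k1 (divr_gt0 e0 l0).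
have [m2 hm2] := expr_lt_eps g1 (divr_gt0 e0 L0).
have u0l : u0 < u0 + l by rewrite ltrDl.
have [I [V [r [c b d sm]]]] := cov (m1 + m2)%N u0 (u0 + l) u0l (lexx _).
exists I, V, r; split=> //.
- by move=> p Pp; apply: c => //; exact: hP.
- move=> i; have /andP[-> h] := b i; apply: le_trans h _.
  rewrite [u0 + l]addrC addrK -ler_pdivlMr//; apply: le_trans (ltW hm1).
  by apply: ler_wiXn2l; rewrite ?leq_addr//; lra.
- apply: le_trans sm _; rewrite [u0 + l]addrC addrK -ler_pdivlMr//; apply: le_trans (ltW hm2).
  by apply: ler_wiXn2l; rewrite ?leq_addl// ltW.
Qed.

(** For [p1 <= p2] the gap begins at the supremum of the part of [E1] up to [p2]. That supremum is
    still at distance [c] from [E2], and there is no point of [E1] between it and [p2]. *)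
Lemma separated_sets_gap (E1 E2 : set R) (c : R) (p1 p2 : R) : 0 < c ->
  (forall x y, E1 x -> E2 y -> c <= `|x - y|) -> E1 p1 -> E2 p2 ->
  exists2 q, Num.min p1 p2 <= q /\ q + c <= Num.max p1 p2 &
    forall p, q < p < q + c -> ~ (E1 `|` E2) p.
Proof.
move=> c0; wlog p12 : E1 E2 p1 p2 / p1 <= p2.
  move=> h sep h1 h2; have [le|/ltW le] := leP p1 p2.
    by have := h _ _ _ _ le sep h1 h2; rewrite (min_l le) (max_r le).
  have sep' x y : E2 x -> E1 y -> c <= `|x - y| by rewrite distrC => ? ?; exact: sep.
  by have := h _ _ _ _ le sep' h2 h1; rewrite (min_l le) (max_r le) setUC.
move=> sep h1 h2; pose X := [set p | E1 p /\ p <= p2].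
have supX : has_sup X by split; [exists p1|exists p2 => x []].
have ubX x : X x -> x <= sup X by move=> Xx; apply: ub_le_sup Xx; case: supX.
have q1 : p1 <= sup X by exact: ubX.
have q2 : sup X <= p2 by apply: ge_sup; [case: supX|move=> x []].
have sepq y : E2 y -> c <= `|sup X - y|.
  move=> Ey; apply/ler_addgt0Pr => e e0.
  have [x Xx hx] := sup_adherent e0 supX.
  apply: le_trans (sep x y (proj1 Xx) Ey) _.
  have hx2 := ubX x Xx.
  have -> : x - y = (sup X - y) + (x - sup X) by ring.
  apply: le_trans (ler_normD _ _) _; rewrite lerD2l; apply/ler_normlP; split; lra.
have q3 : sup X + c <= p2 by have := sepq _ h2; rewrite distrC ger0_norm ?subr_ge0//; lra.
exists (sup X); first by rewrite (min_l p12) (max_r p12).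
move=> p /andP[qp pq] [Ep|Ep].
  by have := ubX p; rewrite leNgt qp => /(_ (conj Ep _)) h; have := h (ltW (lt_le_trans pq q3)).
by have := sepq _ Ep; rewrite distrC ger0_norm ?subr_ge0 ?(ltW qp)//; lra.
Qed.

End LineCovers.

(** * Cylinders that are bi-Lipschitz to subsets of a line *)

Section LipschitzGraph.
Context {R : realType}.
Variables (M : nat) (S : 'I_M -> R[i] -> R[i]) (L rho : R) (lam : seq 'I_M -> R).
Hypothesis H : regular_system S L rho lam.
Variable A : 'M[nat]_M.
Hypothesis hA01 : zero_one A.
Hypothesis hA : irreducible_mx A.
Variables (a0 : 'I_M) (z : seq 'I_M).
Hypothesis zl : loop A a0 z.

Definition cylinder_set : set R[i] := [set coding S (wcat z a) | a in [set a | SFT A a /\ a 0%N = a0]].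

Variables (phi : R[i] -> R) (B c : R).
Hypothesis phiB : forall x y, `|phi x - phi y| <= B * distC x y.
Hypothesis c0 : 0 < c.
Hypothesis phi_lower : forall x y, cylinder_set x -> cylinder_set y ->
  c * distC x y <= `|phi x - phi y|.

Let lam0 w : 0 < lam w. Proof. exact: (regular_lam_gt0 H). Qed.
Let L1 : 1 <= L. Proof. exact: (regular_L H). Qed.
Let L0 : 0 < L. Proof. exact: lt_le_trans (regular_L H). Qed.

Lemma wcat_cat u v (a : nat -> 'I_M) : wcat (u ++ v) a = wcat u (wcat v a).
Proof.
apply/funext => n; rewrite /wcat size_cat nth_cat.
have [nu|un] := ltnP n (size u).
  rewrite ltn_addr//; apply: set_nth_default; exact: nu.
by rewrite ltn_subLR// subnDA.
Qed.

Lemma SFT_exists i : exists2 a, SFT A a & a 0%N = i.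
Proof.
have [p [pp pl]] := adm_connect hA hA01 i i.
have pl' : adm A (last i p) i by [].
pose w := i :: p.
pose a n := nth i w (n %% size w).
exists a => // l; rewrite /a.
have s0 : (0 < size w)%N by [].
have lw : (l %% size w < size w)%N by rewrite ltn_mod.
rewrite -(addn1 l) -modnDml addn1.
have [lt|ge] := ltnP (l %% size w).+1 (size w).
  rewrite (modn_small lt); apply/eqP; move/pathP: pp => /(_ i (l %% size w)%N).
  exact.
have -> : (l %% size w).+1 = size w by apply/eqP; rewrite eqn_leq ge lw.
have -> : (l %% size w)%N = size p by apply/eqP; rewrite eqn_leq -ltnS lw -ltnS.
by rewrite modnn /= nth_last; apply/eqP.
Qed.

Lemma cylinder_sub u : cylinder_set u -> (word_map S z @` square) u.
Proof.
move=> [a _ <-]; rewrite (coding_wcat H); exists (coding S a) => //.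
exact: (coding_square H).
Qed.

(** The part of the limit set with first letter [i] is carried into the cylinder by a word map that
    is bounded below, and [phi] is bounded below there. So covers of the projected cylinder pull
    back to the whole limit set. *)
Lemma graph_small_cover s : 0 <= s -> small_cover distR s (phi @` cylinder_set) ->
  small_cover distC s (limit_set S A).
Proof.
move=> s0 sc; pose F i := [set coding S a | a in [set a | SFT A a /\ a 0%N = i]].
apply: (@small_cover_sub _ _ _ _ _ [set x | exists i, F i x]).
  by move=> _ [a Sa <-]; exists (a 0%N), a.
apply: small_cover_bigcup => i.
have [p [pp pl]] := adm_connect hA hA01 a0 i.
pose u := z ++ a0 :: p.
have uF x : F i x -> cylinder_set (word_map S u x).
  move=> [a [Sa ai] <-]; exists (wcat (a0 :: p) a); last first.
    by rewrite -wcat_cat (coding_wcat H).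
  by split=> //; apply: SFT_wcat; rewrite ?ai.
have sF x : F i x -> square x by move=> [a _ <-]; exact: (coding_square H).
apply: (small_cover_expanding (f := phi \o word_map S u) (C := (c * lam u)^-1) s0 _ _ _ sc).
- by rewrite invr_gt0 mulr_gt0.
- by move=> x Fx; exists (word_map S u x) => //; exact: uF.
- move=> x y Fx Fy; rewrite mulrC ler_pdivlMr ?mulr_gt0//.
  apply: le_trans (phi_lower (uF _ Fx) (uF _ Fy)).
  by rewrite mulrC -mulrA ler_pM2l//; apply: (regular_lower H); exact: sF.
Qed.

Let B0 : 0 <= B.
Proof.
have := phiB 0 1; rewrite distC01 mulr1; exact: le_trans.
Qed.

(** The summand 1 keeps the length of the interval positive when [B = 0]. *)
Lemma graph_bounded : forall p, (phi @` cylinder_set) p -> phi 0 - 2 * B <= p <= phi 0 - 2 * B + (4 * B + 1).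
Proof.
move=> _ [x Cx <-]; have [u su ux] := cylinder_sub Cx.
have := phiB x 0; have := square_dist (x := x) (y := 0); rewrite -ux.
have sx : square (word_map S z u) by exact: (word_map_square H).
move=> /(_ sx (square0 (R := R))) h1 h2.
have h3 := le_trans h2 (ler_wpM2l B0 h1).
by move/ler_normlP: h3 => [h3 h4]; lra.
Qed.

Lemma graph_dim_le1 s : 1 < s -> small_cover distC s (limit_set S A).
Proof.
move=> s1; apply: graph_small_cover; first by rewrite (le_trans _ (ltW s1)).
apply: (small_cover_interval s1 _ graph_bounded).
by rewrite ltr_wpDl ?mulr_ge0.
Qed.

Hypothesis sep : strong_separation S A.

(** Distinct letters form incomparable words and, by irreducibility, each begins some admissible
    sequence. Their images are thus disjoint, and compact, so they have positive distance. *)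
Lemma letters_separated : exists2 g : R, 0 < g & forall i j x y, i != j ->
  (S i @` square) x -> (S j @` square) y -> g <= distC x y.
Proof.
have cS i : compact (S i @` square : set R[i]^o).
  apply: (lipschitz_compact (B := rho)) compact_square => x y sx sy.
  exact: (regular_contr H).
have /choice[g hg] : forall p : 'I_M * 'I_M, exists g : R, 0 < g /\ forall x y, p.1 != p.2 ->
  (S p.1 @` square) x -> (S p.2 @` square) y -> g <= distC x y.
  move=> [i j] /=; case: (eqVneq i j) => [->|ij]; first by exists 1.
  have [a Sa ai] := SFT_exists i; have [b Sb bj] := SFT_exists j.
  have e := sep Sa Sb (k := 1) (l := 1).
  rewrite /prefix_word /mkseq /= ai bj in e.
  have [|g g0 hg] := compact_disjoint_dist (cS i) (cS j).
    by apply: e; split; rewrite /= ?andbT ?orbF eq_sym // eq_sym.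
  by exists g; split=> // x y _; exact: hg.
have [m m0 hm] := pos_lower_bound (fun p => proj1 (hg p)).
exists m => // i j x y ij xi yj; apply: le_trans (hm (i, j)) _.
by have [_ ] := hg (i, j); apply.
Qed.

(** Without branching, a sequence would be determined by its first letter and the limit set would be
    finite. *)
Lemma branching_letter : (forall s, 0 < s -> s < 1 -> ~ small_cover distC s (limit_set S A)) ->
  exists i j1 j2, [/\ j1 != j2, adm A i j1 & adm A i j2].
Proof.
move=> nc; apply: contrapT => nb.
have h12 : 0 < 2^-1 :> R by rewrite invr_gt0.
have h21 : 2^-1 < 1 :> R by rewrite invf_lt1// ltr1n.
apply: (nc _ h12 h21).
pose F i := [set coding S a | a in [set a | SFT A a /\ a 0%N = i]].
apply: (@small_cover_sub _ _ _ _ _ [set x | exists i, F i x]).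
  by move=> _ [a Sa <-]; exists (a 0%N), a.
apply: small_cover_bigcup => i; apply: small_cover_subsingleton => //.
move=> _ _ [a [Sa ai] <-] [b [Sb bi] <-].
suff -> : a = b by rewrite /distC subrr normc0.
apply/funext; elim=> [|n IH]; first by rewrite ai.
apply: contrapT => /eqP ab; apply: nb; exists (a n), (a n.+1), (b n.+1).
by split=> //; [exact: SFT_adm|rewrite IH; exact: SFT_adm].
Qed.

(** The first prefix at which [lam] falls to [r]. Its last letter multiplies [lam] by at least [lm];
    if the prefix is empty, the lower bound comes from [lm <= lam z / l]. *)
Lemma exists_scale (a : nat -> 'I_M) (lm r l : R) : 0 < r -> r <= l -> (forall i, lm <= lam [:: i]) ->
  lm <= lam z / l -> 0 < lm ->
  exists n, lm * r <= lam (z ++ prefix_word a n) <= r.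
Proof.
move=> r0 rl hlm lz lm0.
have ex : exists n, lam (z ++ prefix_word a n) <= r.
  have [n hn] := expr_lt_eps (regular_rho H) r0; exists n.
  apply: le_trans (lam_le_rho H _) (le_trans _ (ltW hn)).
  have /andP[rho0 /ltW rho1] := regular_rho H.
  by apply: ler_wiXn2l => //; rewrite size_cat size_prefix leq_addl.
have l0 : 0 < l by apply: lt_le_trans rl.
case: (ex_minnP ex) => n hn nmin; exists n; rewrite hn andbT.
case: n hn nmin => [|n] hn nmin.
  rewrite cats0; move: lz; rewrite ler_pdivlMr//; apply: le_trans.
  by rewrite ler_pM2l.
rewrite prefix_wordS -cats1 catA; apply: le_trans (regular_lamM H _ _).
rewrite mulrC; apply: ler_pM => //; rewrite ?(ltW lm0) ?(ltW r0)//.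
by rewrite leNgt; apply/negP => /ltW/nmin; rewrite ltnn.
Qed.

Lemma first_difference (a b : nat -> 'I_M) k : prefix_word a k != prefix_word b k ->
  exists2 l, (l < k)%N & a l != b l /\ prefix_word a l = prefix_word b l.
Proof.
move=> ab; have ex : exists l, a l != b l.
  apply: contrapT => h; move/eqP: ab; apply; apply: eq_mkseq => i.
  by apply: contrapT => /eqP ne; apply: h; exists i.
case: (ex_minnP ex) => l al lmin; exists l.
  rewrite ltnNge; apply/negP => kl; move/eqP: ab; apply.
  apply: (@eq_from_nth _ (a 0%N)); rewrite !size_prefix// => i ik.
  rewrite !nth_mkseq//; apply: contrapT => /eqP /lmin.
  by rewrite leqNgt (leq_trans ik kl).
split=> //; apply: (@eq_from_nth _ (a 0%N)); rewrite !size_prefix// => i ik.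
rewrite !nth_mkseq//; apply: contrapT => /eqP /lmin.
by rewrite leqNgt ik.
Qed.

(** After the common prefix the points are [g] apart. The map of this prefix shrinks distances at
    most by its [lam], and comparing this with the prefix of length [k] costs a factor [L]. *)
Lemma codings_separated g (a b : nat -> 'I_M) k : 0 < g ->
  (forall i j x y, i != j -> (S i @` square) x -> (S j @` square) y -> g <= distC x y) ->
  prefix_word a k.+1 != prefix_word b k.+1 ->
  lam (z ++ prefix_word a k) * g / L <= distC (coding S (wcat z a)) (coding S (wcat z b)).
Proof.
move=> g0 hg /first_difference[l lk [al pl]].
have E e : coding S (wcat z e) = word_map S (z ++ prefix_word e l) (coding S (fun n => e (l + n)%N)).
  by rewrite -(coding_wcat H) wcat_cat wcat_prefix.
rewrite (E a) (E b) -pl.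
apply: le_trans (regular_lower H _ (coding_square H _) (coding_square H _)).
have im e : (S (e l) @` square) (coding S (fun n => e (l + n)%N)).
  have := coding_mem H (fun n => e (l + n)%N) 1.
  by rewrite /prefix_word /mkseq /= addn0.
have h := hg _ _ _ _ al (im a) (im b).
have h2 : lam (z ++ prefix_word a k) <= L * lam (z ++ prefix_word a l).
  rewrite -(cat_take_drop l (prefix_word a k)) take_prefix ?(ltnW lk)// catA.
  exact: (lam_cat_le H).
rewrite mulrAC; apply: ler_pM; rewrite ?divr_ge0 ?(ltW L0) ?(ltW g0) ?(ltW (lam0 _))//.
by rewrite ler_pdivrMr// mulrC.
Qed.

(** Let an interval have length [w]. If the projection misses its middle third, this is a gap.
    Otherwise a cylinder of size comparable to [w] around the point found there projects into the
    interval and branches after boundedly many letters. By strong separation and the lower bound for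
    [phi], one branch projects at distance [del * w] from all the rest, and both have points in the
    interval. *)
Lemma graph_porous : exists2 s, 0 <= s < 1 & small_cover distC s (limit_set S A).
Proof.
apply: contrapT => nc0.
have nc s : 0 < s -> s < 1 -> ~ small_cover distC s (limit_set S A).
  by move=> s0 s1 sc; apply: nc0; exists s => //; rewrite (ltW s0).
apply: nc0; have [i0 [j1 [j2 [j12 ij1 ij2]]]] := branching_letter nc.
have [g g0 hg] := letters_separated.
have /choice[q hq] := fun i => adm_connect hA hA01 i i0.
have [kq kq0 hkq] := pos_lower_bound (fun i => lam0 (i :: rcons (q i) i0)).
have [lm1 lm10 hlm1] := pos_lower_bound (fun i => lam0 [:: i]).
pose l := 4 * B + 1; have l0 : 0 < l by rewrite ltr_wpDl ?mulr_ge0.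
pose lm := Num.min lm1 (lam z / l).
have lm0 : 0 < lm by rewrite lt_min lm10 divr_gt0.
have hlm i : lm <= lam [:: i] by apply: le_trans (hlm1 i); rewrite ge_min lexx.
have lmz : lm <= lam z / l by rewrite ge_min lexx orbT.
pose B' := B + 1; have B'0 : 0 < B' by rewrite ltr_wpDl.
have B'L : 0 < 6 * B' * L by rewrite !mulr_gt0.
have B'L1 : 1 <= 6 * B' * L.
  have : 1 <= B' by rewrite lerDr.
  by move=> h; have := ler_pM ler01 ler01 h L1; lra.
have [b1 Sb1 b1j] := SFT_exists j1; have [b2 Sb2 b2j] := SFT_exists j2.
pose del := c * (lm * (6 * B' * L)^-1 * kq * g / L).
have del0 : 0 < del by rewrite !(mulr_gt0, invr_gt0).
pose k := Num.min 3^-1 (del / 3).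
have k0 : 0 < k by rewrite lt_min invr_gt0 ltr0n divr_gt0.
have k3 : k <= 3^-1 by rewrite ge_min lexx.
have kd : k <= del / 3 by rewrite ge_min lexx orbT.
have gaps u v : u < v -> v <= u + l -> has_gap (phi @` cylinder_set) k u v.
  move=> uv vl; pose w := v - u; have w0 : 0 < w by rewrite subr_gt0.
  have kw3 : k * w <= 3^-1 * w by rewrite ler_pM2r.
  have [[x [Cx xm]]|nx] := pselect (exists x, cylinder_set x /\ u + w / 3 < phi x < v - w / 3); last first.
    exists (u + w / 3), (v - w / 3); rewrite -/w.
    split; [lra|rewrite /w in kw3 *; lra|lra|].
    by move=> _ [x Cx <-] h; apply: nx; exists x.
  (* A cylinder of scale [r] has diameter at most [2 L r], so its projection deviates by at most
     [w / 3] from a point of the middle third. *)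
  pose r := w / (6 * B' * L).
  have r0 : 0 < r by rewrite divr_gt0.
  have rl : r <= l.
    rewrite ler_pdivrMr//; apply: (@le_trans _ _ l); first by rewrite /w; lra.
    by rewrite ler_peMr// ltW.
  move: Cx xm => [a [Sa aa0] <-] xm.
  have [n /andP[lw1 lw2]] := exists_scale a r0 rl hlm lmz lm0.
  set W := z ++ prefix_word a n in lw1 lw2.
  (* [U] follows [a] for [n] letters and then moves on to the branching letter, so it may be
     continued by [j1] or by [j2]. *)
  pose U := prefix_word a n ++ a n :: rcons (q (a n)) i0.
  have nU : (n <= size U)%N by rewrite size_cat size_prefix leq_addr.
  have tU : take n U = prefix_word a n by rewrite take_cat size_prefix ltnn subnn take0 cats0.
  have UE b : SFT A b -> adm A i0 (b 0%N) -> SFT A (wcat U b) /\ wcat U b 0%N = a0.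
    move=> Sb ib.
    have -> : U = a0 :: (prefix_word (fun n => a n.+1) n ++ rcons (q (a n)) i0).
      rewrite /U -cat_rcons -prefix_wordS /prefix_word /mkseq /= aa0; congr (_ :: _ ++ _).
      by rewrite (iotaDl 1 0) -map_comp.
    split; last by [].
    have [p1 p2] := SFT_path n Sa; rewrite aa0 in p1 p2.
    have [q1 q2] := hq (a n).
    apply: SFT_wcat => //.
      by rewrite cat_path p1 p2 rcons_path q1 q2.
    by rewrite last_cat last_rcons.
  (* [E2] is the projection of the entire remainder of the cylinder, so a gap between [E1] and [E2]
     misses the whole projected set. *)
  pose E1 := phi @` [set coding S (wcat z e) | e in [set e | (SFT A e /\ e 0%N = a0) /\
    prefix_word e (size U).+1 = rcons U j1]].
  pose E2 := phi @` [set coding S (wcat z e) | e in [set e | (SFT A e /\ e 0%N = a0) /\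
    prefix_word e (size U).+1 != rcons U j1]].
  have E12 : phi @` cylinder_set `<=` E1 `|` E2.
    move=> _ [_ [e [Se e0] <-] <-].
    have [eq|ne] := eqVneq (prefix_word e (size U).+1) (rcons U j1).
      by left; exists (coding S (wcat z e)) => //; exists e.
    by right; exists (coding S (wcat z e)) => //; exists e.
  have lU : lm * r * kq <= lam (z ++ U).
    rewrite /U catA; apply: le_trans (regular_lamM H _ _).
    apply: (ler_pM _ (ltW kq0) lw1 (hkq (a n))).
    by rewrite mulr_ge0// ltW.
  have dw : del * w = c * (lm * r * kq * g / L) by rewrite /del /r; ring.
  have dw0 : 0 < del * w by rewrite mulr_gt0.
  have sepE p p' : E1 p -> E2 p' -> del * w <= `|p - p'|.
    move=> [_ [e [[Se e0] ee] <-] <-] [_ [f [[Sf f0] ff] <-] <-].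
    apply: le_trans (phi_lower _ _); [|by exists e|by exists f].
    rewrite dw ler_pM2l//; apply: le_trans (codings_separated (k := size U) g0 hg _); last first.
      by rewrite ee eq_sym.
    have -> : prefix_word e (size U) = U.
      by rewrite -(take_prefix e (leqnSn _)) ee -cats1 takel_cat// take_size.
    by rewrite !ler_pM2r ?invr_gt0.
  have pU b : prefix_word (wcat U b) (size U).+1 = rcons U (b 0%N).
    by rewrite -addn1 prefix_wcat cats1.
  have near b : SFT A b -> adm A i0 (b 0%N) ->
      `|phi (coding S (wcat z (wcat U b))) - phi (coding S (wcat z a))| <= w / 3.
    move=> Sb ib; apply: le_trans (phiB _ _) _.
    have h1 : (word_map S W @` square) (coding S (wcat z a)).
      by have := coding_mem H (wcat z a) (size z + n); rewrite prefix_wcat.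
    have h2 : (word_map S W @` square) (coding S (wcat z (wcat U b))).
      have := coding_mem H (wcat z (wcat U b)) (size z + n).
      by rewrite prefix_wcat prefix_wcat_take// tU.
    have h3 : distC (coding S (wcat z (wcat U b))) (coding S (wcat z a)) <= 2 * (L * r).
      apply: le_trans (image_square_dist H h2 h1) _.
      by rewrite ler_pM2l// ler_pM2l.
    apply: (@le_trans _ _ (B' * (2 * (L * r)))).
      by apply: ler_pM => //; [exact: distC_ge0|rewrite lerDl].
    by apply: eq_ler; rewrite /r; field; rewrite !gt_eqF.
  have in1 : E1 (phi (coding S (wcat z (wcat U b1)))).
    exists (coding S (wcat z (wcat U b1))) => //; exists (wcat U b1) => //=.
    by split; [apply: UE; rewrite ?b1j|rewrite pU b1j].
  have in2 : E2 (phi (coding S (wcat z (wcat U b2)))).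
    exists (coding S (wcat z (wcat U b2))) => //; exists (wcat U b2) => //=.
    split; [by apply: UE; rewrite ?b2j|rewrite pU b2j].
    by apply/eqP => /rcons_inj[/esym/eqP]; rewrite (negbTE j12).
  have n1 := near b1 Sb1; rewrite b1j in n1; move: (n1 ij1) => {}n1.
  have n2 := near b2 Sb2; rewrite b2j in n2; move: (n2 ij2) => {}n2.
  have [p0 [pl pr] hp] := separated_sets_gap dw0 sepE in1 in2.
  have kdw : k * w <= del / 3 * w by rewrite ler_pM2r.
  have up : u <= p0.
    apply: le_trans pl; move: n1 n2; rewrite le_min => /ler_normlP[? ?] /ler_normlP[? ?].
    by move/andP: xm => [? ?]; apply/andP; split; lra.
  have pv : p0 + del * w <= v.
    apply: (le_trans pr); move: n1 n2; rewrite ge_max => /ler_normlP[? ?] /ler_normlP[? ?].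
    by move/andP: xm => [? ?]; apply/andP; split; lra.
  (* The middle third of the gap; its outer thirds provide the margins. *)
  exists (p0 + del * w / 3), (p0 + 2 * (del * w / 3)); rewrite -/w.
  clear - up pv kdw hp E12 dw0; split; [lra|lra|lra|].
  move=> y Py /andP[y1 y2]; apply: (hp y); last exact: E12.
  by apply/andP; split; lra.
have [s s01 sc] := porous_small_cover k0 l0 gaps graph_bounded.
by exists s => //; apply: graph_small_cover sc; case/andP: s01.
Qed.

End LipschitzGraph.

Lemma hausdorff_dim_ge1 (R : realType) (T : Type) (d : T -> T -> R) (E : set T) :
  (forall s : R, 0 <= s -> s < 1 -> hausdorff_measure d s E != 0%E) -> (1 <= hausdorff_dim d E)%E.
Proof.
move=> h; apply: le_ereal_inf_tmp => _ [s [s0 hs] <-]; rewrite lee_fin leNgt.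
by apply/negP => s1; move/eqP: hs; rewrite (negbTE (h s s0 s1)).
Qed.

(** * Directions between points of a cylinder, and the dimension *)

Section DimensionOfDistances.
Context {R : realType}.
Variables (M : nat) (S : 'I_M -> R[i] -> R[i]) (L rho : R) (lam : seq 'I_M -> R).
Hypothesis H : regular_system S L rho lam.
Variable A : 'M[nat]_M.
Hypothesis hA01 : zero_one A.
Hypothesis hA : irreducible_mx A.
Hypothesis ncov : forall s : R, 0 <= s -> s < 1 -> ~ small_cover distC s (limit_set S A).
Hypothesis large : (exists2 s : R, 1 < s & ~ small_cover distC s (limit_set S A)) \/
  strong_separation S A.
Variable a0 : 'I_M.

Lemma not_lipschitz_graph z (phi : R[i] -> R) (B c : R) : loop A a0 z ->
  (forall x y, `|phi x - phi y| <= B * distC x y) -> 0 < c ->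
  ~ forall x y, cylinder_set S A a0 z x -> cylinder_set S A a0 z y ->
    c * distC x y <= `|phi x - phi y|.
Proof.
move=> zl phiB c0 hphi; case: large => [[s s1 ns]|sep].
  by apply: ns; exact: (graph_dim_le1 H hA01 hA phiB c0 hphi).
have [s /andP[s0 s1] sc] := graph_porous H hA01 hA phiB c0 hphi sep.
exact: ncov sc.
Qed.

(** [phi] vanishes exactly on differences of slope [t]. If no difference of two points of the
    cylinder came close to this slope, [phi] would be bi-Lipschitz on the cylinder. *)
Lemma dense_directions z : loop A a0 z -> forall t eta : R, 0 <= t <= 1 -> 0 < eta ->
  exists a b, [/\ SFT A a, SFT A b, a 0%N = a0, b 0%N = a0 &
    parallel_to t eta (coding S (wcat z b) - coding S (wcat z a))].
Proof.
move=> zl t eta /andP[t0 t1] eta0; apply: contrapT => nd.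
pose phi (x : R[i]) := complex.Im x - t * complex.Re x.
have phiE x y : phi x - phi y = complex.Im (x - y) - t * complex.Re (x - y).
  by rewrite /phi !raddfB /=; ring.
apply: (@not_lipschitz_graph z phi 2 eta zl _ eta0).
  move=> x y; rewrite phiE; apply: le_trans (ler_normB _ _) _; rewrite normrM (ger0_norm t0).
  have h1 := Re_le_normc (x - y); have h2 := Im_le_normc (x - y).
  have : t * `|complex.Re (x - y)| <= 1 * `|complex.Re (x - y)| by rewrite ler_wpM2r.
  rewrite /distC; lra.
move=> _ _ [b [Sb b0] <-] [a [Sa aa0] <-].
rewrite leNgt; apply/negP => h; apply: nd; exists a, b; split=> //.
rewrite phiE in h; split; last exact: ltW.
rewrite -(pmulr_rgt0 _ eta0); exact: le_lt_trans h.
Qed.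

Hypothesis lin : forall eta : R, 0 < eta ->
  exists z b o mu, linearized S lam A a0 z eta b o mu.

Lemma distance_set_dim : dimR (distance_set (limit_set S A)) = 1%E.
Proof.
apply/eqP; rewrite eq_le; apply/andP; split; last first.
  apply: hausdorff_dim_ge1 => s s0 s1.
  exact: (distance_set_measure H hA01 hA ncov lin dense_directions).
apply/lee_addgt0Pr => e e0.
have e1 : 0 <= 1 + e by rewrite addr_ge0// ltW.
rewrite -EFinD; apply: small_cover_dim => //.
apply: (@small_cover_interval _ _ 0 2); [by rewrite ltrDl|by []|].
move=> _ [[x y] [[a _ /= <-] [b _ /= <-]] <-]; rewrite add0r distC_ge0/=.
by apply: square_dist; exact: (coding_square H).
Qed.

End DimensionOfDistances.

(** * Similarities *)

Lemma normc_sqr (R : realType) (z : R[i]) : normc z ^+ 2 = complex.Re z ^+ 2 + complex.Im z ^+ 2.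
Proof. by case: z => a b /=; rewrite sqr_sqrtr ?addr_ge0 ?sqr_ge0. Qed.

Lemma square_i (R : realType) : square ('i%C : R[i]).
Proof. by split; rewrite /= ler01 lexx. Qed.

(** The distances to 0 and 1 determine the real part of [h x] and the square of its imaginary part.
    The distance to [h 'i] then makes the sign the same for all [x]. *)
Lemma plane_isometry (R : realType) (h : R[i] -> R[i]) : h 0 = 0 -> h 1 = 1 ->
  (forall x y, square x -> square y -> normc (h x - h y) = normc (x - y)) ->
  exists b, forall x, square x -> h x = conj_if b x.
Proof.
move=> h0 h1 hd.
have d0 x : square x -> complex.Re (h x) = complex.Re x /\ complex.Im (h x) ^+ 2 = complex.Im x ^+ 2.
  move=> sx.
  have e0 := congr1 (fun t => t ^+ 2) (hd x 0 sx (square0 (R := R))).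
  have e1 := congr1 (fun t => t ^+ 2) (hd x 1 sx (square1 (R := R))).
  rewrite h0 !subr0 !normc_sqr in e0; rewrite h1 !normc_sqr !raddfB /= in e1.
  have e : complex.Re (h x) = complex.Re x.
    by move: e0 e1; rewrite !expr2 !subr0; lra.
  by split=> //; move: e0; rewrite e => /addrI.
have [_ hi] := d0 _ (square_i R); rewrite /= expr1n in hi.
have {}hi : complex.Im (h 'i%C) = 1 \/ complex.Im (h 'i%C) = -1.
  move/eqP: hi; rewrite -subr_eq0 subr_sqr_1 mulf_eq0 subr_eq0 addr_eq0.
  by case/orP => /eqP ->; [left|right].
have di x : square x -> complex.Im (h x) * complex.Im (h 'i%C) = complex.Im x.
  move=> sx; have [r1 i1] := d0 x sx; have [r2 i2] := d0 _ (square_i R).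
  have := congr1 (fun t => t ^+ 2) (hd x _ sx (square_i R)).
  rewrite !normc_sqr !raddfB /= r1 r2 /= => /addrI.
  by move: i1 i2; rewrite /= !expr2; lra.
case: hi => hi; [exists false|exists true] => x sx; have := di x sx; have [+ _] := d0 x sx; rewrite hi.
  by case: (h x) => u v; case: (x) => u' v' /= ->; rewrite mulr1 => ->.
by case: (h x) => u v; case: (x) => u' v' /= -> <-; rewrite mulrN1 opprK.
Qed.

Lemma similarity_linear (R : realType) (f : R[i] -> R[i]) (r : R) : 0 < r ->
  (forall x y, square x -> square y -> distC (f x) (f y) = r * distC x y) ->
  exists b o, normc o = 1 /\ forall x y, square x -> square y ->
    f x - f y = r%:C%C * o * conj_if b (x - y).
Proof.
move=> r0 fd; pose v := f 1 - f 0.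
have vr : normc v = r.
  by have := fd 1 0 (square1 (R := R)) (square0 (R := R)); rewrite [distC 1 0]distCC distC01 mulr1.
have v0 : v != 0 by rewrite -normc_gt0 vr.
have rC0 : (r%:C)%C != 0 :> R[i] by rewrite -normc_gt0 normc_real gtr0_norm.
have [||x y sx sy|b hb] := @plane_isometry R (fun x => (f x - f 0) / v).
- by rewrite subrr mul0r.
- exact: divff.
- rewrite -mulrBl normcM normcV vr opprB addrA subrK.
  by have := fd x y sx sy; rewrite /distC => ->; rewrite mulrAC divff ?mul1r// gt_eqF.
exists b, (v / r%:C%C); split; first by rewrite normcM normcV normc_real vr (gtr0_norm r0) divff// gt_eqF.
move=> x y sx sy; rewrite mulrCA divff// mulr1.
rewrite conj_ifB -hb// -hb// -mulrBl mulrCA divff// mulr1 opprB.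
by rewrite addrA subrK.
Qed.

Section Similarities.
Context {R : realType} {M : nat}.
Variable S : 'I_M -> R[i] -> R[i].
Hypothesis self : self_maps S.
Variables (r : 'I_M -> R) (b : 'I_M -> bool) (o : 'I_M -> R[i]).
Hypothesis r01 : forall i, 0 < r i < 1.
Hypothesis o1 : forall i, normc (o i) = 1.
Hypothesis linear : forall i x y, square x -> square y ->
  S i x - S i y = (r i)%:C%C * o i * conj_if (b i) (x - y).

Definition ratio : seq 'I_M -> R := foldr (fun i x => r i * x) 1.
Definition reflection : seq 'I_M -> bool := foldr (fun i x => b i (+) x) false.
Definition rotation : seq 'I_M -> R[i] := foldr (fun i x => o i * conj_if (b i) x) 1.

Lemma ratio_gt0 w : 0 < ratio w.
Proof. by elim: w => //= i w IH; rewrite mulr_gt0//; case/andP: (r01 i). Qed.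

Lemma ratioM w v : ratio (w ++ v) = ratio w * ratio v.
Proof. by elim: w => [|i w IH] /=; rewrite ?mul1r// IH mulrA. Qed.

Lemma reflectionM w v : reflection (w ++ v) = reflection w (+) reflection v.
Proof. by elim: w => //= i w IH; rewrite IH addbA. Qed.

Lemma rotation_normc w : normc (rotation w) = 1.
Proof.
elim: w => [|i w IH]; first exact: normc1.
by rewrite [rotation _]/= normcM o1 normc_conj_if IH mulr1.
Qed.

Lemma rotationM w v : rotation (w ++ v) = rotation w * conj_if (reflection w) (rotation v).
Proof.
elim: w => /= [|i w IH]; first by rewrite mul1r.
by rewrite IH conj_ifM conj_if_addb mulrA.
Qed.

Lemma word_map_similar w x y : square x -> square y -> square (word_map S w x) /\
  word_map S w x - word_map S w y = (ratio w)%:C%C * rotation w * conj_if (reflection w) (x - y).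
Proof.
move=> sx sy; have sq w' u : square u -> square (word_map S w' u).
  by move=> su; elim: w' => //= i w' IH; apply: (self (i := i)); exists (word_map S w' u).
split; first exact: sq.
elim: w => /= [|i w IH]; first by rewrite rmorph1 !mul1r.
rewrite linear; [|exact: sq|exact: sq].
rewrite IH !conj_ifM conj_if_addb rmorphM /=.
have -> : conj_if (b i) (ratio w)%:C%C = (ratio w)%:C%C by case: (b i) => //=; rewrite oppr0.
by ring.
Qed.

Lemma word_map_similar_dist w x y : square x -> square y ->
  distC (word_map S w x) (word_map S w y) = ratio w * distC x y.
Proof.
move=> sx sy; rewrite /distC (word_map_similar w sx sy).2.
by rewrite !normcM rotation_normc normc_conj_if normc_real (gtr0_norm (ratio_gt0 w)) mulr1.
Qed.

Lemma similarity_regular : exists rho, regular_system S 1 rho ratio.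
Proof.
have r1 i : 0 < 1 - r i by rewrite subr_gt0; case/andP: (r01 i).
have [m m0 hm] := pos_lower_bound r1.
(* The maximum keeps the ratio nonnegative also for an empty alphabet, which puts no upper bound on
   [m]. *)
exists (Num.max 0 (1 - m)); split=> //.
- by rewrite le_max lexx /= gt_max ltr01 gtrBl.
- exact: ratio_gt0.
- by move=> w x y sx sy; rewrite word_map_similar_dist.
- by move=> w x y sx sy; rewrite word_map_similar_dist// mul1r.
- by move=> w v; rewrite ratioM.
- move=> i x y sx sy; have := word_map_similar_dist [:: i] sx sy; rewrite /= mulr1 => ->.
  rewrite ler_wpM2r ?distC_ge0// le_max; apply/orP; right.
  by have := hm i; lra.
Qed.

Lemma similarity_linearized (A : 'M[nat]_M) (a0 : 'I_M) (eta : R) : zero_one A ->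
  irreducible_mx A -> 0 < eta ->
  exists z b' o' mu, linearized S ratio A a0 z eta b' o' mu.
Proof.
move=> hA01 hA eta0; have [p [pp pl]] := adm_connect hA hA01 a0 a0.
exists (a0 :: p), reflection, rotation, ratio; split.
- by exists p.
- by move=> w _; exact: rotation_normc.
- by [].
- move=> w _ _ _ [x sx <-] [y sy <-].
  have [sx' _] := word_map_similar (a0 :: p) sx sx; have [sy' _] := word_map_similar (a0 :: p) sy sy.
  have [_ ->] := word_map_similar w sx' sy'.
  by rewrite subrr normc0 !mulr_ge0 ?normc_ge0 ?(ltW eta0) ?(ltW (ratio_gt0 w)).
- by move=> w v _ _; exact: reflectionM.
- by move=> w v _ _; rewrite rotationM subrr normc0 ltW.
Qed.

End Similarities.

(** * Conformal systems *)

Section BestLipschitz.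
Context {R : realType}.
Implicit Types (f g : R[i] -> R[i]) (x y : R[i]).

Lemma quotient_mem f x y : square x -> square y -> x != y ->
  quotients f (distC (f x) (f y) / distC x y)%:E.
Proof. by move=> sx sy xy; exists (x, y). Qed.

Lemma distC_gt0 x y : x != y -> 0 < distC x y.
Proof. by move=> xy; rewrite normc_gt0 subr_eq0. Qed.

Lemma distCxx x : distC x x = 0.
Proof. by rewrite /distC subrr normc0. Qed.

Lemma Lip_inf_fin f : (0 < Lip_inf f)%E -> exists2 l, Lip_inf f = l%:E & 0 < l.
Proof.
move=> l0; have h : (Lip_inf f <= (distC (f 0) (f 1) / distC (0 : R[i]) 1)%:E)%E.
  apply: ereal_inf_lbound; apply: quotient_mem square0 square1 _.
  by rewrite eq_sym oner_neq0.
by move: l0 h; case: (Lip_inf f) => [l||]//=; rewrite lte_fin => l0 _; exists l.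
Qed.

Lemma Lip_inf_le f l x y : Lip_inf f = l%:E -> square x -> square y ->
  l * distC x y <= distC (f x) (f y).
Proof.
move=> fl sx sy; have [->|xy] := eqVneq x y; first by rewrite !distCxx mulr0.
rewrite -ler_pdivlMr ?distC_gt0// -lee_fin -fl.
by apply: ereal_inf_lbound; exact: quotient_mem.
Qed.

Lemma Lip_sup_ge f l x y : (Lip_sup f <= l%:E)%E -> square x -> square y ->
  distC (f x) (f y) <= l * distC x y.
Proof.
move=> fl sx sy; have [->|xy] := eqVneq x y; first by rewrite !distCxx mulr0.
rewrite -ler_pdivrMr ?distC_gt0// -lee_fin; apply: le_trans fl.
by apply: ereal_sup_ubound; exact: quotient_mem.
Qed.

Lemma le_Lip_inf f l : (forall x y, square x -> square y -> l * distC x y <= distC (f x) (f y)) ->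
  (l%:E <= Lip_inf f)%E.
Proof.
move=> h; apply: le_ereal_inf_tmp => _ [[x y] [/= sx sy xy] <-].
by rewrite lee_fin ler_pdivlMr ?distC_gt0//; exact: h.
Qed.

End BestLipschitz.

Lemma conformal_regular (R : realType) (M : nat) (S : 'I_M -> R[i] -> R[i]) (a0 : 'I_M) :
  conformal_system S -> exists L rho lam, regular_system S L rho lam.
Proof.
move=> [self contr _ [L L1 dist]].
have dist' w : (0 < Lip_inf (word_map S w))%E /\
    (Lip_sup (word_map S w) <= L%:E * Lip_inf (word_map S w))%E.
  (* Distortion is assumed for prefixes of arbitrary sequences, and every finite word is one. *)
  have := dist (wcat w (fun=> a0)) (size w).
  by rewrite prefix_wcat_take// take_size.
have /choice[lam hlam] : forall w, exists l, Lip_inf (word_map S w) = l%:E /\ 0 < l.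
  by move=> w; have [l ? ?] := Lip_inf_fin (dist' w).1; exists l.
have /choice[r hr] : forall i, exists l, (Lip_sup (S i) <= l%:E)%E /\ 0 < 1 - l.
  move=> i; have := contr i.
  have : (-oo < Lip_sup (S i))%E.
    apply: lt_le_trans (ltNyr (distC (S i 0) (S i 1) / distC (0 : R[i]) 1)) _.
    apply: ereal_sup_ubound; apply: quotient_mem (square0 (R := R)) (square1 (R := R)) _.
    by rewrite eq_sym oner_neq0.
  case: (Lip_sup (S i)) => [l||]// _; rewrite lte_fin => l1; exists l.
  by rewrite subr_gt0.
have [m m0 hm] := pos_lower_bound (fun i => (hr i).2).
have sq w u : square u -> square (word_map S w u).
  by move=> su; elim: w => //= i w IH; apply: (self i); exists (word_map S w u).
have lower w x y (sx : square x) (sy : square y) := Lip_inf_le (hlam w).1 sx sy.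
exists L, (Num.max 0 (1 - m)), lam; split=> //.
- by rewrite le_max lexx /= gt_max ltr01 gtrBl.
- by move=> w; have [] := hlam w.
- move=> w x y sx sy; apply: Lip_sup_ge => //.
  by have := (dist' w).2; rewrite (hlam w).1.
- move=> w v; have := @le_Lip_inf R (word_map S (w ++ v)) (lam w * lam v).
  rewrite (hlam _).1 lee_fin; apply=> x y sx sy; rewrite !word_map_cat.
  apply: le_trans (lower w _ _ (sq v x sx) (sq v y sy)).
  by rewrite -mulrA ler_pM2l ?(hlam w).2//; exact: lower.
- move=> i x y sx sy; apply: le_trans (Lip_sup_ge (hr i).1 sx sy) _.
  rewrite ler_wpM2r ?distC_ge0// le_max; apply/orP; right.
  by have := hm i; lra.
Qed.

(** * Complex derivatives in the open square *)

Section ComplexDerivatives.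
Context {R : realType}.
Implicit Types (f g : R[i] -> R[i]) (z l m h u : R[i]).

Lemma cdiff_comp f g z l m : cdiff f (g z) m -> cdiff g z l -> cdiff (f \o g) z (m * l).
Proof.
move=> df dg e e0; have nl := normc_ge0 l; have nm := normc_ge0 m.
have l1 : 0 < normc l + 1 by lra.
have m1 : 0 < normc m + 1 by lra.
pose e1 := Num.min 1 (e / 2 / (normc m + 1)).
have e10 : 0 < e1 by rewrite lt_min ltr01 !divr_gt0.
have e11 : e1 <= 1 by rewrite ge_min lexx.
have e1m : e1 * (normc m + 1) <= e / 2 by rewrite -ler_pdivlMr// ge_min lexx orbT.
have e20 : 0 < e / 2 / (normc l + 1) by rewrite !divr_gt0.
have [d1 d10 h1] := dg e1 e10; have [d2 d20 h2] := df _ e20.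
exists (Num.min d1 (d2 / (normc l + 1))); first by rewrite lt_min d10 divr_gt0.
move=> h; rewrite lt_min ltr_pdivlMr// => /andP[hd1 hd2].
have nh := normc_ge0 h.
have hg := h1 h hd1; set k := g (z + h) - g z in hg.
have kh : normc k <= (normc l + 1) * normc h.
  rewrite -(subrK (l * h) k); apply: le_trans (le_normcD _ _) _; rewrite normcM mulrDl mul1r addrC lerD2l.
  by apply: le_trans hg _; rewrite ler_piMl.
have hf : normc (f (g z + k) - f (g z) - m * k) <= e / 2 / (normc l + 1) * normc k.
  by apply: h2; apply: le_lt_trans kh _; rewrite mulrC.
have {}hf : normc (f (g z + k) - f (g z) - m * k) <= e / 2 * normc h.
  apply: le_trans hf _; rewrite -mulrA ler_pM2l ?divr_gt0// mulrC ler_pdivrMr//.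
  by rewrite mulrC.
have gk : g z + k = g (z + h) by rewrite addrC subrK.
rewrite gk in hf.
have -> : (f \o g) (z + h) - (f \o g) z - m * l * h =
    (f (g (z + h)) - f (g z) - m * k) + m * (k - l * h) by rewrite /=; ring.
apply: le_trans (le_normcD _ _) _; rewrite normcM.
have : normc m * normc (k - l * h) <= (normc m + 1) * (e1 * normc h).
  by apply: ler_pM => //; [exact: normc_ge0|rewrite lerDl].
have : (e1 * (normc m + 1)) * normc h <= e / 2 * normc h by rewrite ler_wpM2r.
lra.
Qed.

Lemma cdiff_ge_lower g z l (T c : R) : 0 < T ->
  (forall h, normc h < T -> c * normc h <= normc (g (z + h) - g z)) ->
  cdiff g z l -> c <= normc l.
Proof.
move=> T0 lip dg; apply/ler_addgt0Pr => e e0; have [d d0 hd] := dg e e0.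
pose k := Num.min T d / 2.
have m0 : 0 < Num.min T d by rewrite lt_min T0.
have k0 : 0 < k by rewrite divr_gt0.
have km : k < Num.min T d by rewrite ltr_pdivrMr// ltr_pMr// ltr1n.
have nk : normc (k%:C%C) = k by rewrite normc_real gtr0_norm.
have := lip k%:C%C; have := hd k%:C%C; move: km; rewrite nk lt_min => /andP[-> ->] /(_ isT) h1 /(_ isT) h2.
have h3 : c * k <= (normc l + e) * k.
  apply: (le_trans h2); rewrite -[X in normc X](subrK (l * k%:C%C)).
  by apply: le_trans (le_normcD _ _) _; rewrite normcM nk mulrDl addrC lerD2l.
by rewrite -(ler_pM2r k0).
Qed.

(** The increment [t u / l] is the one that the derivative [l] turns into [t u]. *)
Lemma cdiff_direction f z l u (T : R) : cdiff f z l -> l != 0 -> normc u = 1 -> 0 < T ->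
  exists2 t : R, 0 < t & exists2 h, normc h < T &
    normc (f (z + h) - f z - t%:C%C * u) <= t / 2.
Proof.
move=> df l0 u1 T0; have nl : 0 < normc l by rewrite normc_gt0.
have [d d0 hd] := df (normc l / 2) (divr_gt0 nl (ltr0Sn _ 1)).
have m0 : 0 < Num.min T d by rewrite lt_min T0.
have km : Num.min T d / 2 < Num.min T d by rewrite ltr_pdivrMr// ltr_pMr// ltr1n.
pose t := Num.min T d / 2 * normc l.
have t0 : 0 < t by rewrite mulr_gt0// divr_gt0.
have nh : normc (t%:C%C * u / l) = Num.min T d / 2.
  by rewrite !normcM normcV u1 normc_real gtr0_norm// mulr1 /t mulfK ?gt_eqF.
move: km; rewrite lt_min => /andP[kT kd].
exists t => //; exists (t%:C%C * u / l); first by rewrite nh.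
have := hd (t%:C%C * u / l); rewrite nh => /(_ kd).
have -> : l * (t%:C%C * u / l) = t%:C%C * u by rewrite mulrC divfK.
by have -> : normc l / 2 * (Num.min T d / 2) = t / 2 by rewrite /t; ring.
Qed.

Lemma open_square_ball z : open_square z -> exists2 T : R, 0 < T &
  forall x, normc (x - z) < T -> open_square x.
Proof.
move=> [/andP[a0 a1] /andP[b0 b1]].
pose T := Num.min (Num.min (complex.Re z) (1 - complex.Re z)) (Num.min (complex.Im z) (1 - complex.Im z)).
exists T; first by rewrite !lt_min a0 b0 !subr_gt0 a1 b1.
move=> x; rewrite !lt_min => /andP[/andP[h1 h2] /andP[h3 h4]].
have := Re_le_normc (x - z); have := Im_le_normc (x - z).
rewrite !raddfB /= => /ler_normlP[i1 i2] /ler_normlP[r1 r2].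
by split; apply/andP; split; lra.
Qed.

Lemma open_square_square z : open_square z -> square z.
Proof. by move=> [/andP[? ?] /andP[? ?]]; split; apply/andP; split; apply: ltW. Qed.

(* A map with nonvanishing derivative moves points in every direction, so
   it cannot send an interior point to the boundary. *)
Lemma open_square_mapped f z l : f @` square `<=` square -> cdiff f z l -> l != 0 ->
  open_square z -> open_square (f z).
Proof.
move=> fs df l0 zU; have [T T0 hT] := open_square_ball zU.
have move_to u : normc u = 1 -> exists2 t : R, 0 < t & exists2 y, square y &
    normc (y - f z - t%:C%C * u) <= t / 2.
  move=> u1; have [t t0 [h hT' hh]] := cdiff_direction df l0 u1 T0.
  exists t => //; exists (f (z + h)) => //; apply: fs; exists (z + h) => //.
  by apply/open_square_square/hT; rewrite addrC addKr.
have n1 : normc (1 : R[i]) = 1 by exact: normc1.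
have nN1 : normc (-1 : R[i]) = 1 by rewrite normcN normc1.
have ni : normc ('i%C : R[i]) = 1 by rewrite /= expr0n add0r expr1n sqrtr1.
have nNi : normc (- 'i%C : R[i]) = 1 by rewrite normcN.
have [t1 t10 [[u1 v1] [/= /andP[? ?] /andP[? ?]] /(le_trans (Re_le_normc _))]] := move_to _ n1.
have [t2 t20 [[u2 v2] [/= /andP[? ?] /andP[? ?]] /(le_trans (Re_le_normc _))]] := move_to _ nN1.
have [t3 t30 [[u3 v3] [/= /andP[? ?] /andP[? ?]] /(le_trans (Im_le_normc _))]] := move_to _ ni.
have [t4 t40 [[u4 v4] [/= /andP[? ?] /andP[? ?]] /(le_trans (Im_le_normc _))]] := move_to _ nNi.
case: (f z) => u v /= /ler_normlP[? ?] /ler_normlP[? ?] /ler_normlP[? ?] /ler_normlP[? ?].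
by split => /=; apply/andP; split; lra.
Qed.

Lemma direction_dist l m : l != 0 -> m != 0 ->
  normc (m / (normc m)%:C%C - l / (normc l)%:C%C) <= 2 * (normc (m - l) / normc l).
Proof.
move=> l0 m0; have nl : 0 < normc l by rewrite normc_gt0.
have nm : 0 < normc m by rewrite normc_gt0.
have nlC : (normc l)%:C%C != 0 :> R[i] by rewrite -normc_gt0 normc_real gtr0_norm.
have nmC : (normc m)%:C%C != 0 :> R[i] by rewrite -normc_gt0 normc_real gtr0_norm.
have -> : m / (normc m)%:C%C - l / (normc l)%:C%C =
    (m - l) / (normc l)%:C%C + m / (normc m)%:C%C * (normc l - normc m)%:C%C / (normc l)%:C%C.
  by rewrite rmorphB /=; field; rewrite nlC nmC.
apply: le_trans (le_normcD _ _) _.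
rewrite !normcM !normcV !normc_real (gtr0_norm nl) (gtr0_norm nm) divff ?gt_eqF// mul1r.
have : `|normc l - normc m| / normc l <= normc (m - l) / normc l.
  rewrite ler_pM2r ?invr_gt0//; apply/ler_normlP; split.
    by rewrite opprB; exact: lerB_normc.
  by rewrite normcBC; exact: lerB_normc.
lra.
Qed.

End ComplexDerivatives.

(** Along the two sides through the corner [(v1, v2)] the function [x - y], if [v1 = v2], or else
    [x + y], is monotone. Its increments are therefore the full sums of the coordinate
    increments. *)
Lemma adjacent_sides_expanding (R : realType) (v1 v2 x1 x2 y1 y2 : R) :
  v1 = 0 \/ v1 = 1 -> v2 = 0 \/ v2 = 1 ->
  0 <= x1 <= 1 -> 0 <= x2 <= 1 -> 0 <= y1 <= 1 -> 0 <= y2 <= 1 ->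
  x1 = v1 \/ x2 = v2 -> y1 = v1 \/ y2 = v2 ->
  `|x1 - y1| + `|x2 - y2| <= `|x1 - y1 + (if v1 == v2 then -1 else 1) * (x2 - y2)|.
Proof.
have key (u v e : R) : e = 1 \/ e = -1 -> (0 <= u /\ 0 <= e * v) \/ (u <= 0 /\ e * v <= 0) ->
    `|u| + `|v| <= `|u + e * v|.
  move=> he; have -> : `|v| = `|e * v| by case: he => ->; rewrite ?mul1r// mulN1r normrN.
  move=> [[h1 h2]|[h1 h2]].
    by rewrite (ger0_norm h1) (ger0_norm h2) ger0_norm ?addr_ge0.
  by rewrite (ler0_norm h1) (ler0_norm h2) ler0_norm ?opprD//; lra.
move=> hv1 hv2 /andP[? ?] /andP[? ?] /andP[? ?] /andP[? ?] hx hy.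
have e1 : `|(if v1 == v2 then -1 else 1) : R| = 1 by case: ifP; rewrite ?normrN normr1.
case: hx hy => [-> [->|hy]|-> [hy|->]].
- by rewrite subrr normr0 !add0r normrM e1 mul1r.
- apply: key; first by case: ifP; [right|left].
  case: hv1 => ->; case: hv2 hy => -> ->; rewrite ?eqxx ?oner_eq0 ?(eq_sym 0) ?oner_eq0;
    first [by left; split; lra|by right; split; lra].
- apply: key; first by case: ifP; [right|left].
  case: hv1 hy => -> ->; case: hv2 => ->; rewrite ?eqxx ?oner_eq0 ?(eq_sym 0) ?oner_eq0;
    first [by left; split; lra|by right; split; lra].
- by rewrite subrr normr0 mulr0 !addr0.
Qed.

(** * Linearization of conformal systems *)

Section ConformalLinearization.
Context {R : realType}.
Variables (M : nat) (S : 'I_M -> R[i] -> R[i]) (L rho : R) (lam : seq 'I_M -> R).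
Hypothesis H : regular_system S L rho lam.
Hypothesis conf : forall i, conformal_on open_square (S i).
Variable A : 'M[nat]_M.
Hypothesis hA01 : zero_one A.
Hypothesis hA : irreducible_mx A.
Variable a0 : 'I_M.

(** The derivative of [word_map S w] at [z], as the product given by the chain rule. *)
Definition word_deriv (w : seq 'I_M) (z : R[i]) : R[i] :=
  (fix d w := if w is i :: v then
     ('D_1 (S i : R[i]^o -> R[i]^o) (word_map S v z) : R[i]) * d v else 1) w.

Lemma conformal_cdiff i z : open_square z ->
  cdiff (S i) z ('D_1 (S i : R[i]^o -> R[i]^o) z).
Proof. by move=> zU e e0; apply: derivable_expand e0; have [] := @conf i z zU. Qed.

Lemma word_map_open w z : open_square z -> open_square (word_map S w z).
Proof.
move=> zU; elim: w => [|i w IH]; first by [].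
have [_ D0] := @conf i _ IH.
have := @open_square_mapped R (S i) _ _ (@regular_self _ _ _ _ _ _ H i) (@conformal_cdiff i _ IH).
by apply.
Qed.

Lemma word_map_cdiff w z : open_square z -> cdiff (word_map S w) z (word_deriv w z).
Proof.
move=> zU; elim: w => [|i w IH].
  move=> e e0; exists 1 => // h _; rewrite mul1r [z + h]addrC addrK subrr normc0.
  by rewrite mulr_ge0 ?normc_ge0 ?(ltW e0).
exact: (cdiff_comp (@conformal_cdiff i _ (word_map_open w zU)) IH).
Qed.

Lemma word_deriv_cat w v z : word_deriv (w ++ v) z = word_deriv w (word_map S v z) * word_deriv v z.
Proof. by elim: w => /= [|i w IH]; rewrite ?mul1r// IH word_map_cat mulrA. Qed.

Let lam0 w : 0 < lam w. Proof. exact: (regular_lam_gt0 H). Qed.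
Let L1 : 1 <= L. Proof. exact: (regular_L H). Qed.
Let L0 : 0 < L. Proof. exact: lt_le_trans (regular_L H). Qed.

Lemma lam_le_deriv w z : open_square z -> lam w <= normc (word_deriv w z).
Proof.
move=> zU; have [T T0 hT] := open_square_ball zU.
apply: (cdiff_ge_lower T0 _ (word_map_cdiff w zU)) => h hh.
have := regular_lower H w (open_square_square (hT (z + h) _)) (open_square_square zU).
by rewrite /distC addrC addKr; apply.
Qed.

(** Here [mu w] and [o w] are modulus and direction of the derivative at the interior point [p], and
    no conjugation occurs. The Lipschitz constant [L * lam w] is at most [L * mu w], which makes the
    errors relative to [mu w]. The product rule needs the derivative of [w] at the image of [p]
    under [v]; this point is close to [p] because [v] begins with [z], which prolongs a long prefix
    of the code of [p]. *)
Lemma conformal_linearized (a : nat -> 'I_M) (eta : R) : SFT A a -> a 0%N = a0 ->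
  open_square (coding S a) -> 0 < eta -> exists z b o mu, linearized S lam A a0 z eta b o mu.
Proof.
move=> Sa aa0 pU eta0; set p := coding S a in pU.
have [T2 T20 hT] := open_square_ball pU.
pose T := T2 / 2; have T0 : 0 < T by rewrite divr_gt0.
have TT : 2 * T = T2 by rewrite /T; field.
(* On this radius both the distortion and the change of direction of the derivative are at most
   [eta / 2], relative to [mu w]. *)
pose r := Num.min T (eta * T / (16 * 2 * L)).
have L16 : 0 < 16 * 2 * L by rewrite !mulr_gt0.
have r0 : 0 < r by rewrite lt_min T0 divr_gt0// mulr_gt0.
have rT : r <= T by rewrite ge_min lexx.
have rE : 16 * L / T * r <= eta / 2.
  have : r <= eta * T / (16 * 2 * L) by rewrite ge_min lexx orbT.
  rewrite ler_pdivlMr// => h; rewrite mulrAC ler_pdivrMr//; lra.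
have [n hn] := expr_lt_eps (regular_rho H) (divr_gt0 r0 (ltr0Sn R 1)).
have [c [cp cl]] := adm_connect hA hA01 (a n) a0.
pose z := prefix_word a n.+1 ++ c.
have zl : loop A a0 z by exact: prefix_loop.
have zp x : (word_map S z @` square) x -> normc (x - p) < r.
  move=> /(image_cat_sub H) xi.
  apply: le_lt_trans (image_square_dist_rho H xi (coding_mem H a n.+1)) _.
  rewrite size_prefix mulrC -ltr_pdivlMr//; apply: le_lt_trans hn.
  by have /andP[? /ltW ?] := regular_rho H; apply: ler_wiXn2l.
have lip w x y : normc (x - p) < 2 * T -> normc (y - p) < 2 * T ->
    normc (word_map S w x - word_map S w y) <= L * lam w * normc (x - y).
  rewrite TT => /hT/open_square_square xs /hT/open_square_square ys.
  exact: (regular_upper H).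
have dif w x : normc (x - p) < 2 * T -> cdiff (word_map S w) x (word_deriv w x).
  by rewrite TT => /hT; exact: word_map_cdiff.
pose mu w := normc (word_deriv w p).
have lm w : lam w <= mu w by exact: lam_le_deriv.
have mu0 w : 0 < mu w by apply: lt_le_trans (lm w).
have d0 w : word_deriv w p != 0 by rewrite -normc_gt0; exact: mu0.
have unit w : normc (word_deriv w p / (mu w)%:C%C) = 1.
  rewrite normcM normcV normc_real (gtr0_norm (mu0 w)) divff//.
  by rewrite gt_eqF//; exact: mu0.
have muC w : (mu w)%:C%C != 0 :> R[i].
  by rewrite -normc_gt0 normc_real gtr0_norm; exact: mu0.
exists z, (fun=> false), (fun w => word_deriv w p / (mu w)%:C%C), mu; split=> //.
- move=> w x y _ /zp xr /zp yr.
  have -> : (mu w)%:C%C * (word_deriv w p / (mu w)%:C%C) = word_deriv w p by rewrite mulrC divfK.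
  apply: le_trans (holomorphic_distortion T0 (dif w) (lip w) rT xr yr) _.
  rewrite ler_wpM2r ?normc_ge0//.
  have : 16 * L / T * r * lam w <= eta / 2 * mu w.
    apply: ler_pM => //; rewrite ?(ltW (lam0 w))// mulr_ge0 ?(ltW r0)//.
    by rewrite divr_ge0 ?(ltW T0)// mulr_ge0 ?(ltW L0).
  have := mulr_gt0 eta0 (mu0 w); lra.
- move=> w v _ [v' -> _] /=; rewrite -/(mu w).
  set v2 := z ++ v'; pose q := word_map S v2 p.
  have qr : normc (q - p) < r.
    apply: zp; rewrite /q /v2 word_map_cat; eexists; last by reflexivity.
    by apply: (word_map_square H); exact: (coding_square H).
  have qT : normc (q - p) < T by apply: lt_le_trans rT.
  have qU : open_square q by exact: word_map_open.
  have dq0 : word_deriv w q != 0 by rewrite -normc_gt0; apply: lt_le_trans (lam_le_deriv w qU).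
  have dd := derivative_lipschitz T0 (dif w) (lip w) qT.
  have -> : word_deriv (w ++ v2) p / (mu (w ++ v2))%:C%C -
        word_deriv w p / (mu w)%:C%C * (word_deriv v2 p / (mu v2)%:C%C)
     = (word_deriv w q / (normc (word_deriv w q))%:C%C - word_deriv w p / (normc (word_deriv w p))%:C%C)
        * (word_deriv v2 p / (mu v2)%:C%C).
    rewrite mulrBl /mu word_deriv_cat normcM rmorphM /= -/q; congr (_ - _).
    by rewrite invfM mulrACA.
  rewrite normcM unit mulr1.
  apply: le_trans (direction_dist (d0 w) dq0) _.
  rewrite mulrA ler_pdivrMr -/(mu w); last exact: mu0.
  have h1 : 8 * (L * lam w) / T * normc (q - p) <= 8 * (L * lam w) / T * r.
    by rewrite ler_wpM2l ?(ltW qr)// divr_ge0 ?(ltW T0)// !mulr_ge0 ?(ltW L0) ?(ltW (lam0 w)).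
  have h2 : 16 * L / T * r * lam w <= eta / 2 * mu w.
    apply: ler_pM => //; rewrite ?(ltW (lam0 w))// mulr_ge0 ?(ltW r0)//.
    by rewrite divr_ge0 ?(ltW T0)// mulr_ge0 ?(ltW L0).
  by have := mulr_gt0 eta0 (mu0 w); move: dd h1 h2; rewrite /mu; lra.
Qed.

Hypothesis ncov : forall s : R, 0 <= s -> s < 1 -> ~ small_cover distC s (limit_set S A).
Hypothesis large : (exists2 s : R, 1 < s & ~ small_cover distC s (limit_set S A)) \/
  strong_separation S A.

(* A cylinder of small diameter inside the boundary of the square lies in two
   adjacent sides, on which [x + y] or [x - y] is expanding. *)
Lemma meets_open_square : exists a, [/\ SFT A a, a 0%N = a0 & open_square (coding S a)].
Proof.
apply: contrapT => no.
(* With [rho^n < 1/4] the cylinder has diameter below [1/2] and cannot meet two opposite sides. *)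
have h4 : 0 < 4^-1 :> R by rewrite invr_gt0.
have [n hn] := expr_lt_eps (regular_rho H) h4.
have [a Sa aa0] := SFT_exists hA01 hA a0.
have [c [cp cl]] := adm_connect hA hA01 (a n) a0.
pose z := prefix_word a n.+1 ++ c.
have zl : loop A a0 z by exact: prefix_loop.
have bd x : cylinder_set S A a0 z x -> square x /\ ~ open_square x.
  move=> [b [Sb b0] <-]; split; first exact: (coding_square H).
  by move=> xU; apply: no; exists (wcat z b); split=> //; exact: loop_SFT zl b0 Sb.
have near x y : cylinder_set S A a0 z x -> cylinder_set S A a0 z y -> distC x y < 2^-1.
  move=> /(cylinder_sub H)/(image_cat_sub H) xi /(cylinder_sub H)/(image_cat_sub H) yi.
  apply: le_lt_trans (image_square_dist_rho H xi yi) _.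
  have : rho ^+ n.+1 <= rho ^+ n.
    by have /andP[? /ltW ?] := regular_rho H; apply: ler_wiXn2l.
  rewrite size_prefix; move: hn; lra.
have graph (e : R) : e = 1 \/ e = -1 ->
    ~ forall x y, cylinder_set S A a0 z x -> cylinder_set S A a0 z y ->
      distC x y <= `|complex.Re (x - y) + e * complex.Im (x - y)|.
  move=> e1 hg; pose phi (x : R[i]) := complex.Re x + e * complex.Im x.
  have phiE x y : phi x - phi y = complex.Re (x - y) + e * complex.Im (x - y).
    by rewrite /phi !raddfB /=; ring.
  have ne : `|e| = 1 by case: e1 => ->; rewrite ?normrN normr1.
  apply: (@not_lipschitz_graph R _ S L rho lam H A hA01 hA ncov large a0 z phi 2 1 zl) => //.
    move=> x y; rewrite phiE; apply: le_trans (ler_normD _ _) _; rewrite normrM ne mul1r.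
    by have := Re_le_normc (x - y); have := Im_le_normc (x - y); rewrite /distC; lra.
  by move=> x y Fx Fy; rewrite mul1r phiE; exact: hg.
pose side (f : R[i] -> R) (v : R) := forall x, cylinder_set S A a0 z x -> f x != v.
have dich f : (forall x y, `|f x - f y| <= distC x y) -> side f 0 \/ side f 1.
  move=> fl; apply: contrapT => /not_orP[n0 n1].
  have [x Fx /eqP fx] : exists2 x, cylinder_set S A a0 z x & f x == 0.
    apply: contrapT => h; apply: n0 => x Fx; apply/negP => fx; apply: h; by exists x.
  have [y Fy /eqP fy] : exists2 x, cylinder_set S A a0 z x & f x == 1.
    apply: contrapT => h; apply: n1 => y Fy; apply/negP => fy; apply: h; by exists y.
  have := le_lt_trans (fl x y) (near x y Fx Fy); rewrite fx fy sub0r normrN normr1.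
  lra.
have reL (x y : R[i]) : `|complex.Re x - complex.Re y| <= distC x y by rewrite -raddfB; exact: Re_le_normc.
have imL (x y : R[i]) : `|complex.Im x - complex.Im y| <= distC x y by rewrite -raddfB; exact: Im_le_normc.
have bdE x : cylinder_set S A a0 z x -> [/\ 0 <= complex.Re x <= 1, 0 <= complex.Im x <= 1 &
    [\/ complex.Re x = 0, complex.Re x = 1, complex.Im x = 0 | complex.Im x = 1]].
  move=> /bd[[/andP[r0 r1] /andP[i0 i1]] nU]; split; rewrite ?r0 ?i0//.
  apply: contrapT => h; apply: nU; split; apply/andP; split; rewrite lt_neqAle ?r0 ?r1 ?i0 ?i1 andbT.
  - by apply/eqP => e; apply: h; apply: Or41.
  - by apply/eqP => e; apply: h; apply: Or42.
  - by apply/eqP => e; apply: h; apply: Or43.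
  - by apply/eqP => e; apply: h; apply: Or44.
(* Of the two opposite sides [f = 0] and [f = 1], the cylinder can meet only [f = v]. *)
have side_of f : (forall x y, `|f x - f y| <= distC x y) -> exists v : R, (v = 0 \/ v = 1) /\
    forall x, cylinder_set S A a0 z x -> f x = 0 \/ f x = 1 -> f x = v.
  move=> /dich[h|h]; [exists 1|exists 0]; (split; [by [left|right]|]) => x /h/eqP h' [|]//.
have [v1 [hv1 s1]] := side_of _ reL; have [v2 [hv2 s2]] := side_of _ imL.
pose e : R := if v1 == v2 then -1 else 1.
apply: (graph e); first by rewrite /e; case: ifP => _; [right|left].
move=> x y /[dup] Fx /bdE[x1 x2 hx] /[dup] Fy /bdE[y1 y2 hy].
apply: le_trans (normc_le_ReIm _) _; rewrite !raddfB /=.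
apply: adjacent_sides_expanding => //.
  by case: hx => h; [left|left|right|right]; (apply: s1 || apply: s2) => //; by [left|right].
by case: hy => h; [left|left|right|right]; (apply: s1 || apply: s2) => //; by [left|right].
Qed.

End ConformalLinearization.

(** * The two kinds of systems and the conclusion *)

Lemma similarity_dim (R : realType) (M : nat) (S : 'I_M -> R[i] -> R[i]) (A : 'M[nat]_M) (a0 : 'I_M) :
  similarity_system S -> zero_one A -> irreducible_mx A ->
  (forall s : R, 0 <= s -> s < 1 -> ~ small_cover distC s (limit_set S A)) ->
  (exists2 s : R, 1 < s & ~ small_cover distC s (limit_set S A)) \/ strong_separation S A ->
  dimR (distance_set (limit_set S A)) = 1%E.
Proof.
move=> [self sim] hA01 hA ncov large.
have /choice[r hr] : forall i, exists r : R, 0 < r < 1 /\ exists b o, normc o = 1 /\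
    forall x y, square x -> square y -> S i x - S i y = r%:C%C * o * conj_if b (x - y).
  move=> i; have [r r01 hr] := sim i; exists r; split=> //.
  by apply: similarity_linear hr; case/andP: r01.
have /choice[b hb] := fun i => (hr i).2; have /choice[rot ho] := hb.
have r01 i := (hr i).1; have o1 i := (ho i).1; have lin i := (ho i).2.
have [rho H] := similarity_regular self r01 o1 lin.
apply: (distance_set_dim H hA01 hA ncov large (a0 := a0)) => eta eta0.
exact: (similarity_linearized self r01 o1 lin a0 hA01 hA eta0).
Qed.

Lemma conformal_dim (R : realType) (M : nat) (S : 'I_M -> R[i] -> R[i]) (A : 'M[nat]_M) (a0 : 'I_M) :
  conformal_system S -> zero_one A -> irreducible_mx A ->
  (forall s : R, 0 <= s -> s < 1 -> ~ small_cover distC s (limit_set S A)) ->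
  (exists2 s : R, 1 < s & ~ small_cover distC s (limit_set S A)) \/ strong_separation S A ->
  dimR (distance_set (limit_set S A)) = 1%E.
Proof.
move=> hS hA01 hA ncov large; have [L [rho [lam H]]] := conformal_regular a0 hS.
have [_ _ conf _] := hS.
apply: (distance_set_dim H hA01 hA ncov large (a0 := a0)) => eta eta0.
have [a [Sa aa0 aU]] := meets_open_square H hA01 hA a0 ncov large.
exact: (conformal_linearized H conf hA01 hA Sa aa0 aU eta0).
Qed.

Theorem theorem2p7 (R : realType) (M : nat) (S : 'I_M -> R[i] -> R[i])
    (hS : conformal_system S \/ similarity_system S)
    (A : 'M[nat]_M) (hA01 : zero_one A) (hA : irreducible_mx A) :
  ((1 < dimC (limit_set S A))%E ->
     dimR (distance_set (limit_set S A)) = 1%E) /\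
  (strong_separation S A ->
     (1 <= dimC (limit_set S A))%E ->
     dimR (distance_set (limit_set S A)) = 1%E).
Proof.
set F := limit_set S A.
have main : (1 <= dimC F)%E ->
    (exists2 s : R, 1 < s & ~ small_cover distC s F) \/ strong_separation S A ->
    dimR (distance_set F) = 1%E.
  move=> dim1 large.
  have ncov (s : R) : 0 <= s -> s < 1 -> ~ small_cover distC s F.
    move=> s0 s1 /(small_cover_dim s0) /(le_trans dim1).
    by rewrite lee_fin leNgt s1.
  (* An empty limit set has small covers even for exponent 0, which [ncov] excludes; the sequence
     found supplies the base letter [a0]. *)
  have [a _] : exists a, SFT A a.
    apply: contrapT => na; apply: (ncov 0 (lexx _) ltr01) => e e0.
    exists void, (fun=> set0), (fun=> 0); split.
    - by move=> x [a Sa]; case: na; exists a.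
    - by case.
    - by case.
    - by rewrite big_pred0 ?(ltW e0)//; case.
  case: hS => hS'; first exact: (conformal_dim (a 0%N) hS' hA01 hA ncov large).
  exact: (similarity_dim (a 0%N) hS' hA01 hA ncov large).
split=> [dim1|sep dim1]; apply: main; [exact: ltW| |by []|by right].
(* If small covers existed for every exponent above 1, the dimension would be at most 1. *)
left; apply: contrapT => ns; move: dim1; rewrite ltNge => /negP; apply.
apply/lee_addgt0Pr => e e0; rewrite -EFinD; apply: small_cover_dim.
  by rewrite addr_ge0// ltW.
by apply: contrapT => sc; apply: ns; exists (1 + e) => //; rewrite ltrDl.
Qed.
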